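(* Let $n=1$ and $m>2$, and consider the Cauchy problem for wave maps $\phi:\mathbb{R}^{1+1}\to S^{m-1}\subset\mathbb{R}^m$ with zero initial velocity, $$-\phi_{tt}+\phi_{xx}+\phi\,\bigl(|\phi_x|^2-|\phi_t|^2\bigr)=0,\qquad \phi(0,x)=f(x),\qquad \phi_t(0,x)=0,\qquad f(x)\in S^{m-1}.$$ Then both of the following assertions are false: (i) this Cauchy problem is well-posed for small data in $\dot H^{1/2}$; (ii) this Cauchy problem is well-posed for small data in $\dot B^{1/2,1}_2$. In fact, one can construct data $f$ with arbitrarily small norm in $\dot B^{1/2,1}_2$ (and thus in $\dot H^{1/2}$) which cannot be continued for any non-zero time in $\dot B^{1/2,1}_2$ or even in $\dot H^{1/2}$.
   Context: Here $n$ is the spatial dimension, $S^{m-1}$ is the unit sphere in $\mathbb{R}^m$, $|\cdot|$ is the Euclidean norm on $\mathbb{R}^m$, and $(t,x)\in\mathbb{R}\times\mathbb{R}$. The spaces are the homogeneous Sobolev and Besov spaces on $\mathbb{R}$ (applied to $\mathbb{R}^m$-valued functions of $x$), with norms $$\|f\|_{\dot H^{1/2}}=\Bigl(\int|\xi|\,|\hat f(\xi)|^2\,d\xi\Bigr)^{1/2},\qquad \|f\|_{\dot B^{1/2,1}_2}=\sum_{j}2^{j/2}\Bigl(\int_{|\xi|\sim 2^j}|\hat f(\xi)|^2\,d\xi\Bigr)^{1/2},$$ where $\hat f$ is the Fourier transform, $j$ ranges over the integers and $|\xi|\sim 2^j$ denotes a dyadic shell. By convention constant functions have zero norm; in practice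 one subtracts a constant (such as a fixed unit vector $e_1$) from a sphere-valued function before measuring its norm. Well-posedness is meant in the usual sense for Cauchy problems; because the spaces are scale-invariant for this equation, local and global well-posedness for small data are equivalent. *)

(* Defs.v *)
From HB Require Import structures.
From mathcomp Require Import all_boot all_order all_algebra.
From mathcomp Require Import all_classical all_reals all_analysis.

Set Implicit Arguments.
Unset Strict Implicit.
Unset Printing Implicit Defensive.

Import Order.TTheory GRing.Theory Num.Theory.
Import numFieldNormedType.Exports.

Local Open Scope classical_set_scope.
Local Open Scope ring_scope.

(* The norm that the library puts on row vectors is the sup norm, so the
   Euclidean structure of R^m is introduced here: [sqn v] is |v|^2. *)
Definition dot (R : realType) (m : nat) (u v : 'rV[R]_m) : R :=
  \sum_(i < m) u ord0 i * v ord0 i.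

Definition sqn (R : realType) (m : nat) (v : 'rV[R]_m) : R := dot v v.

Definition smooth (R : realType) (g : R -> R) : Prop :=
  forall (n : nat) (x : R), derivable (derive1n n g) x 1.

Definition smoothv (R : realType) (m : nat) (f : R -> 'rV[R]_m) : Prop :=
  forall i : 'I_m, smooth (fun x => f x ord0 i).

(* Real-valued functions in C_c^oo(R \ {0}). *)
Definition test_off0 (R : realType) (psi : R -> R) : Prop :=
  smooth psi /\
  exists r M : R, 0 < r /\ forall xi, psi xi != 0 -> r <= `|xi| <= M.

(* [fourier f a b]: on R \ {0}, the Fourier transform of the bounded function
   f, taken in the sense of tempered distributions with the normalization
     fhat(xi) = \int e^{- i x xi} f(x) dx,
   is the function a + i b. This is the duality <fhat, psi> = <f, psihat>,
   split into real and imaginary parts; real psi are enough by linearity.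
   The transform of a constant is a multiple of the Dirac mass at 0, so
   discarding xi = 0 is what gives constants zero norm. *)
Definition fourier (R : realType) (m : nat) (f a b : R -> 'rV[R]_m) : Prop :=
  let mu := @lebesgue_measure R in
  forall i : 'I_m,
  [/\ measurable_fun setT (fun x => f x ord0 i),
      exists M : R, forall x, `|f x ord0 i| <= M,
      forall r M : R, 0 < r ->
        mu.-integrable [set xi : R | r <= `|xi| <= M]
          (fun xi => (a xi ord0 i)%:E) /\
        mu.-integrable [set xi : R | r <= `|xi| <= M]
          (fun xi => (b xi ord0 i)%:E) &
      forall psi : R -> R, test_off0 psi ->
        \int[mu]_(xi in setT) (a xi ord0 i * psi xi) =
          \int[mu]_(x in setT) (f x ord0 i *
            \int[mu]_(xi in setT) (psi xi * cos (x * xi))) /\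
        \int[mu]_(xi in setT) (b xi ord0 i * psi xi) =
          - \int[mu]_(x in setT) (f x ord0 i *
              \int[mu]_(xi in setT) (psi xi * sin (x * xi)))].

(* Each norm below is an infimum over a set with at most one element: the
   transform is unique up to null sets, and the infimum is +oo when the
   Fourier transform of f is not a function away from 0. *)
Definition Hhalf_norm (R : realType) (m : nat) (f : R -> 'rV[R]_m) : \bar R :=
  let mu := @lebesgue_measure R in
  ereal_inf [set N : \bar R | exists a b : R -> 'rV[R]_m, fourier f a b /\
    N = poweR (\int[mu]_(xi in setT)
                 (`|xi| * (sqn (a xi) + sqn (b xi)))%:E)%E 2^-1].

Definition dyadic_shell (R : realType) (j : int) : set R :=
  [set xi : R | (2 : R) ^ j <= `|xi| < (2 : R) ^ (j + 1)].

Definition Bhalf_norm (R : realType) (m : nat) (f : R -> 'rV[R]_m) : \bar R :=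
  let mu := @lebesgue_measure R in
  ereal_inf [set N : \bar R | exists a b : R -> 'rV[R]_m, fourier f a b /\
    N = esum [set: int] (fun j : int =>
          (2 `^ (j%:~R / 2))%:E *
          poweR (\int[mu]_(xi in (dyadic_shell j : set R))
                   (sqn (a xi) + sqn (b xi))%:E) 2^-1)%E].

(* Weak decay at infinity. On such functions the two seminorms above are
   norms, since 0 is the only constant that vanishes at infinity. *)
Definition vanishes_at_infinity (R : realType) (m : nat)
    (h : R -> 'rV[R]_m) : Prop :=
  forall a : R, 0 < a ->
    ((@lebesgue_measure R) [set x : R | (a <= sqn (h x))%R] < +oo)%E.

Definition in_space (R : realType) (m : nat)
    (N : (R -> 'rV[R]_m) -> \bar R) (e1 : 'rV[R]_m)
    (f : R -> 'rV[R]_m) : Prop :=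
  [/\ forall x, sqn (f x) = 1,
      vanishes_at_infinity (fun x => f x - e1) &
      (N (fun x => f x - e1)%R < +oo)%E].

Definition small_data (R : realType) (m : nat)
    (N : (R -> 'rV[R]_m) -> \bar R) (e1 : 'rV[R]_m) (delta : R)
    (f : R -> 'rV[R]_m) : Prop :=
  in_space N e1 f /\ (N (fun x => f x - e1)%R < delta%:E)%E.

Definition test_data (R : realType) (m : nat) (e1 : 'rV[R]_m)
    (f : R -> 'rV[R]_m) : Prop :=
  smoothv f /\ exists M : R, forall x, M <= `|x| -> f x = e1.

Definition dt (R : realType) (u : R -> R -> R) : R -> R -> R :=
  fun t x => derive1 (fun s => u s x) t.

Definition dx (R : realType) (u : R -> R -> R) : R -> R -> R :=
  fun t x => derive1 (u t) x.

Definition C1_strip (R : realType) (T : R) (u : R -> R -> R) : Prop :=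
  forall t x : R, `|t| < T ->
  [/\ derivable (fun s => u s x) t 1, derivable (u t) x 1,
      {for (t, x), continuous (fun p : R * R => dt u p.1 p.2)} &
      {for (t, x), continuous (fun p : R * R => dx u p.1 p.2)}].

Definition C2_strip (R : realType) (T : R) (u : R -> R -> R) : Prop :=
  [/\ C1_strip T u, C1_strip T (dt u) & C1_strip T (dx u)].

Definition coordf (R : realType) (m : nat) (phi : R -> R -> 'rV[R]_m)
    (i : 'I_m) : R -> R -> R := fun t x => phi t x ord0 i.

Definition dtv (R : realType) (m : nat) (phi : R -> R -> 'rV[R]_m)
    (t x : R) : 'rV[R]_m := \row_i dt (coordf phi i) t x.

Definition dxv (R : realType) (m : nat) (phi : R -> R -> 'rV[R]_m)
    (t x : R) : 'rV[R]_m := \row_i dx (coordf phi i) t x.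

(* Classical solutions on ]-T, T[ x R of the Cauchy problem with zero initial
   velocity. Such solutions are even in time, so a symmetric time interval is
   no loss of generality. *)
Definition wave_map (R : realType) (m : nat) (T : R) (f : R -> 'rV[R]_m)
    (phi : R -> R -> 'rV[R]_m) : Prop :=
  [/\ forall i : 'I_m, C2_strip T (coordf phi i),
      forall t x, `|t| < T -> sqn (phi t x) = 1,
      forall t x, `|t| < T ->
        - dtv (dtv phi) t x + dxv (dxv phi) t x
        + (sqn (dxv phi t x) - sqn (dtv phi t x)) *: phi t x = 0,
      forall x, phi 0 x = f x &
      forall x, dtv phi 0 x = 0].

(* Hadamard well-posedness for small data in the space with norm N, on a time
   interval uniform over a ball of data. Functions in these spaces are too
   rough for the equation to be read pointwise, or the nonlinearity as a
   distribution, so S is the continuous extension to the ball of the classical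
   solution map on [test_data]: for those data S f is the one and only
   classical solution, and for the others continuous dependence makes S f
   the limit of classical solutions. *)
Definition well_posed_small (R : realType) (m : nat)
    (N : (R -> 'rV[R]_m) -> \bar R) (e1 : 'rV[R]_m) : Prop :=
  exists (delta T : R) (S : (R -> 'rV[R]_m) -> R -> R -> 'rV[R]_m),
  [/\ 0 < delta /\ 0 < T,
      forall f, small_data N e1 delta f ->
        [/\ S f 0 = f,
            forall t, `|t| < T -> in_space N e1 (S f t) &
            forall t, `|t| < T -> forall eps : R, 0 < eps ->
              exists2 eta : R, 0 < eta &
                forall s, `|s| < T -> `|s - t| < eta ->
                  (N (fun x => S f s x - S f t x)%R < eps%:E)%E],
      forall f, small_data N e1 delta f -> test_data e1 f ->
        wave_map T f (S f) /\
        (forall phi, wave_map T f phi ->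
           forall t x, `|t| < T -> phi t x = S f t x) &
      forall f, small_data N e1 delta f ->
        forall eps : R, 0 < eps ->
        exists2 eta : R, 0 < eta &
          forall g, small_data N e1 delta g ->
            (N (fun x => g x - f x)%R < eta%:E)%E ->
            forall t, `|t| < T ->
              (N (fun x => S g t x - S f t x)%R < eps%:E)%E].

(* Main.v *)
Require Import Defs.
From HB Require Import structures.
From mathcomp Require Import all_boot all_order all_algebra.
From mathcomp Require Import all_classical all_reals all_analysis.
From mathcomp Require Import interval_inference measurable_realfun.
From mathcomp Require Import ring lra.

(* In null coordinates u = x - t, v = x + t a wave map solves
   Phi_uv = - (Phi_u . Phi_v) Phi, and the lengths of Phi_u and Phi_v are those of
   f'(u) / 2 and f'(v) / 2. Integrating twice, a component w . Phi that is of the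
   order of the variation V of the data equals (fw(u) + fw(v)) / 2 plus an explicit
   cubic term, up to O(V^4).

   The data are bubbles: f leaves e1 by a small angle eps, and while bent makes one
   full turn around the axis e1 within a window of width 2L. The turn is invisible
   outside the window at time 0, but the cubic term contains the area swept by it.
   Hence at every time t <> 0 the solution is constant on both sides of a window
   of width 2L, with values that differ by at least c eps^3. A jump at scale L next
   to plateaus of length d contributes log(d / L) to the square of the
   H^{1/2} norm, so L can be chosen so small that this norm is huge, whereas
   the B^{1/2,1}_2 norm of the bubble is scale invariant and O(eps).

   Bubbles with summable eps_k, and L_k tending to 0 fast enough, placed far apart do
   not interact before time t when k is large, so by finite speed of propagation
   the norm of the solution is infinite at all t <> 0. A single one shows that the
   solution map is not continuous at the constant datum. *)

Import Order.TTheory GRing.Theory Num.Theory.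
Import numFieldNormedType.Exports.
Set Implicit Arguments.
Unset Strict Implicit.
Unset Printing Implicit Defensive.
Local Open Scope classical_set_scope.
Local Open Scope ring_scope.

(** The data are bounded in the Besov norm and the solution from below in the H^{1/2} norm; since
    the latter norm is at most twice the former, both spaces are served at once. The order of
    choices is essential: the Besov bound of a bubble does not involve L, so L is chosen last, when
    the size eps^3 of the jump to be amplified is already known.

    The component watched is the one along e3. It vanishes off the window, so the free wave (fw(u) +
    fw(v)) / 2 takes the same values on both sides. The correction pairs the swept area, a vector of
    length pi sin^2 eps along e2, with the displacement f(v) - f(u) from the plateau to the value e1
    beyond the bubble, whose e2 component is - sin eps. This is why the plateau must differ from e1,
    and why the turn needs a plane orthogonal to e1, which exists because m > 2. Small eps makes the
    jump dominate the quartic error.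

    The Fourier transform is defined by duality, so lower bounds come from pairings with test
    functions; upper bounds come from the decay of the transform of an integrable function. *)

Section Smoothness.
Context {R : realType}.
Implicit Types (f g h : R -> R).

Lemma derive1E_is_derive f (df : R -> R) : (forall x : R, is_derive x 1 f (df x)) ->
  derive1 f = df.
Proof. by move=> h; apply/funext => x; rewrite derive1E; apply: derive_val. Qed.

Lemma smooth_derivable g (x : R) : smooth g -> derivable g x 1.
Proof. by move=> /(_ 0 x). Qed.

Lemma smooth_derive1 g : smooth g -> smooth (derive1 g).
Proof. by move=> sg n x; rewrite -derive1Sn. Qed.

Lemma smooth_is_derive g (x : R) : smooth g -> is_derive x 1 g (derive1 g x).
Proof. by move=> sg; rewrite derive1E; apply/derivableP/smooth_derivable. Qed.

Lemma smooth_continuous g : smooth g -> continuous g.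
Proof.
by move=> sg x; apply/differentiable_continuous/derivable1_diffP/smooth_derivable.
Qed.

(** The recursion peels off the first derivative, so closure under products, inverses and
    composition is a plain induction, without formulas for higher derivatives. *)
Fixpoint Cn (n : nat) (g : R -> R) : Prop :=
  if n is k.+1 then (forall x : R, derivable g x 1) /\ Cn k (derive1 g) else True.

Lemma smoothP g : smooth g <-> forall n, Cn n g.
Proof.
split=> [sg n|cg n x].
  elim: n g sg => //= n ih g sg.
  by split=> [x|]; [exact: smooth_derivable|exact/ih/smooth_derive1].
elim: n g cg => [|n ih] g cg; first by have [] := cg 1%N.
by rewrite derive1Sn; apply: ih => k; have [] := cg k.+1.
Qed.

Lemma CnS n g dg : (forall x : R, is_derive x 1 g (dg x)) -> Cn n dg -> Cn n.+1 g.
Proof.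
move=> dgE cdg; split=> [x|]; last by rewrite (derive1E_is_derive dgE).
exact: ex_derive.
Qed.

Lemma Cn_is_derive n g (x : R) : Cn n.+1 g -> is_derive x 1 g (derive1 g x).
Proof. by case=> + _ => /(_ x) dg; rewrite derive1E; apply/derivableP. Qed.

Lemma CnW n g : Cn n.+1 g -> Cn n g.
Proof. by elim: n g => //= n ih g [dg cg]; split=> //; exact: ih. Qed.

Lemma Cn_cst n (c : R) : Cn n (cst c).
Proof.
elim: n c => [|n ih] c //.
exact: (@CnS n (cst c) (cst 0) (fun x => is_derive_cst _ _ _) (ih 0)).
Qed.

Lemma Cn_id n : Cn n id.
Proof.
case: n => // n.
exact: (@CnS n id (cst 1) (fun x => is_derive_id _ _) (@Cn_cst _ _)).
Qed.

Lemma CnD n f g : Cn n f -> Cn n g -> Cn n (fun x => f x + g x).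
Proof.
elim: n f g => // n ih f g cf cg.
apply: (@CnS n (fun x => f x + g x) (fun x => derive1 f x + derive1 g x)).
  by move=> x; exact: is_deriveD (Cn_is_derive x cf) (Cn_is_derive x cg).
by apply: ih; [case: cf|case: cg].
Qed.

Lemma CnM n f g : Cn n f -> Cn n g -> Cn n (fun x => f x * g x).
Proof.
elim: n f g => // n ih f g cf cg.
apply: (@CnS n (fun x => f x * g x) (fun x => f x * derive1 g x + g x * derive1 f x)).
  by move=> x; exact: is_deriveM (Cn_is_derive x cf) (Cn_is_derive x cg).
by apply: CnD; apply: ih; [exact: CnW|by case: cg|exact: CnW|by case: cf].
Qed.

Lemma Cn_comp n f g : Cn n f -> Cn n g -> Cn n (fun x => f (g x)).
Proof.
elim: n f g => // n ih f g cf cg.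
apply: (@CnS n (fun x => f (g x)) (fun x => derive1 f (g x) * derive1 g x)).
  by move=> x; exact: is_derive1_comp (Cn_is_derive _ cf) (Cn_is_derive _ cg).
by apply: CnM; [apply: ih; [by case: cf|exact: CnW]|by case: cg].
Qed.

Lemma CnV n f : (forall x, f x != 0) -> Cn n f -> Cn n (fun x => (f x)^-1).
Proof.
move=> f0; elim: n => // n ih cf.
apply: (@CnS n (fun x => (f x)^-1) (fun x => (-1 * derive1 f x) * ((f x)^-1 * (f x)^-1))).
  move=> x; have dfx := Cn_is_derive x cf.
  apply: (is_derive_eq (is_deriveV (f0 x) dfx)).
  by rewrite /GRing.scale /=; field; exact: f0.
apply: CnM; first by apply: CnM; [exact: Cn_cst|case: cf].
by apply: CnM; exact/ih/CnW.
Qed.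

Lemma Cn_sincos n : Cn n (@sin R) /\ Cn n (@cos R).
Proof.
elim: n => // n [cs cc]; split; first exact: (@CnS n _ (@cos R)).
apply: (@CnS n (@cos R) (fun x => -1 * sin x)) => [x|].
  by rewrite mulN1r; exact: is_derive_cos.
by apply: CnM => //; exact: Cn_cst.
Qed.

Lemma smooth_cst (c : R) : smooth (cst c).
Proof. by apply/smoothP => n; exact: Cn_cst. Qed.
Lemma smooth_id : smooth (@id R).
Proof. by apply/smoothP => n; exact: Cn_id. Qed.
Lemma smoothD f g : smooth f -> smooth g -> smooth (fun x => f x + g x).
Proof. by move=> /smoothP sf /smoothP sg; apply/smoothP => n; exact: CnD. Qed.
Lemma smoothM f g : smooth f -> smooth g -> smooth (fun x => f x * g x).
Proof. by move=> /smoothP sf /smoothP sg; apply/smoothP => n; exact: CnM. Qed.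
Lemma smoothN f : smooth f -> smooth (fun x => - f x).
Proof.
move=> sf; have -> : (fun x => - f x) = (fun x => cst (-1) x * f x).
  by apply/funext => x /=; rewrite mulN1r.
exact: (smoothM (@smooth_cst (-1)) sf).
Qed.
Lemma smoothB f g : smooth f -> smooth g -> smooth (fun x => f x - g x).
Proof. by move=> sf sg; exact: (smoothD sf (smoothN sg)). Qed.
Lemma smooth_comp f g : smooth f -> smooth g -> smooth (fun x => f (g x)).
Proof. by move=> /smoothP sf /smoothP sg; apply/smoothP => n; exact: Cn_comp. Qed.
Lemma smoothV f : (forall x, f x != 0) -> smooth f -> smooth (fun x => (f x)^-1).
Proof. by move=> f0 /smoothP sf; apply/smoothP => n; exact: CnV. Qed.
Lemma smooth_sin : smooth (@sin R).
Proof. by apply/smoothP => n; have [] := Cn_sincos n. Qed.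
Lemma smooth_cos : smooth (@cos R).
Proof. by apply/smoothP => n; have [] := Cn_sincos n. Qed.
Lemma smooth_affine (a b : R) : smooth (fun x => a * x + b).
Proof.
exact: (smoothD (smoothM (@smooth_cst a) smooth_id) (@smooth_cst b)).
Qed.
Lemma smooth_sum n (F : 'I_n -> R -> R) :
  (forall i, smooth (F i)) -> smooth (fun x => \sum_(i < n) F i x).
Proof.
elim: n F => [|n ih] F sF.
  have -> : (fun x => \sum_(i < 0) F i x) = cst 0.
    by apply/funext => x; rewrite big_ord0.
  exact: smooth_cst.
have -> : (fun x => \sum_(i < n.+1) F i x) =
    (fun x => \sum_(i < n) F (widen_ord (leqnSn n) i) x + F ord_max x).
  by apply/funext => x; rewrite big_ord_recr.
exact: (smoothD (ih _ (fun i => sF _)) (sF _)).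
Qed.

Lemma derive1n_near f g (a : R) n : (\forall x \near a, f x = g x) ->
  \forall x \near a, derive1n n f x = derive1n n g x.
Proof.
move=> fg; elim: n => [//|n ih]; rewrite !derive1nS.
apply: filterS (nbhs_interior ih) => x fgx.
by rewrite !derive1E; apply: near_eq_derive.
Qed.

(** Serves locally finite sums, which near each point agree with a finite one. *)
Lemma smooth_local f :
  (forall a : R, exists2 g, smooth g & \forall x \near a, f x = g x) ->
  smooth f.
Proof.
move=> H n a; have [g sg fg] := H a.
apply: (near_eq_derivable _ (sg n a)).
by apply: filterS (derive1n_near n fg) => x ->.
Qed.

End Smoothness.

(** * A smooth monotone step between the constants 0 and 1 *)

Section Step.
Context {R : realType}.

(* Up to linear combinations this family is closed under differentiation. *)
Definition flatfun (k : nat) (x : R) : R :=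
  if 0 < x then x^-1 ^+ k * expR (- x^-1) else 0.

Lemma flatfun_ge0 k x : 0 <= flatfun k x.
Proof.
rewrite /flatfun; case: ifPn => // x0.
by rewrite mulr_ge0 ?expR_ge0// exprn_ge0// invr_ge0 ltW.
Qed.

(** With y = 1/x, the exponential series gives e^y >= y^(k+2) / (k+2)!. A quadratic bound is what
    makes the difference quotient at 0 tend to 0. *)
Lemma flatfun_le k (x : R) : `|flatfun k x| <= (k.+2)`!%:R * `|x| ^+ 2.
Proof.
rewrite ger0_norm ?flatfun_ge0// /flatfun; case: ifPn => [x0|_]; last first.
  by rewrite mulr_ge0 ?exprn_ge0.
have y0 : 0 <= x^-1 by rewrite invr_ge0 ltW.
have := expR_ge1Dxn k.+1 y0; rewrite expRN.
set y := x^-1 in y0 *; have -> : `|x| = y^-1 by rewrite gtr0_norm// /y invrK.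
have yp : 0 < y by rewrite /y invr_gt0.
clearbody y; move=> h.
have h2 : y ^+ k.+2 <= k.+2`!%:R * expR y.
  have f0 : (0 : R) < k.+2`!%:R by rewrite ltr0n fact_gt0.
  rewrite mulrC -ler_pdivrMr//; apply: le_trans h; lra.
rewrite ler_pdivrMr ?expR_gt0// exprVn -(ler_pM2r (exprn_gt0 2 yp)) -exprD addn2.
by apply: (le_trans h2); rewrite mulrAC mulfVK// expf_neq0// gt_eqF.
Qed.

Lemma is_derive_flatfun k (x : R) :
  is_derive x 1 (flatfun k) (flatfun k.+2 x - k%:R * flatfun k.+1 x).
Proof.
have [x0|x0|->] := ltgtP x 0.
- apply: (@near_eq_is_derive _ _ _ (cst 0) (flatfun k)).
    near=> y; rewrite /flatfun ltNge.
    by have /ltW -> : y < 0 by near: y; exact: lt_nbhsl.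
  rewrite /flatfun ltNge (ltW x0) /= mulr0 subr0; exact: is_derive_cst.
- apply: (@near_eq_is_derive R R R (fun y => y^-1 ^+ k * expR (- y^-1)) (flatfun k)).
  + near=> y; rewrite /flatfun.
    by have -> : 0 < y by near: y; exact: lt_nbhsr.
  + have xn : x != 0 by rewrite gt_eqF.
    have dV : is_derive x 1 (fun y : R => y^-1) (- x ^-2).
      apply: (is_derive_eq (@is_deriveV _ id _ _ _ xn (is_derive_id _ _))).
      by rewrite /GRing.scale /= mulr1.
    have dX : is_derive x 1 (fun y : R => y^-1 ^+ k) (- k%:R * x^-1 ^+ k.+1).
      have := is_deriveX k dV; rewrite exprfctE => dVk; apply: (is_derive_eq dVk).
      rewrite /GRing.scale /= {dVk}; case: k => [|k]; first by rewrite oppr0 !mul0r.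
      by rewrite -exprVn; move: x^-1 => v; rewrite /= !exprS expr0; ring.
    have dE : is_derive x 1 (fun y : R => expR (- y^-1)) (x^-2 * expR (- x^-1)).
      apply: (is_derive_eq (@is_derive1_comp _ expR (fun y => - y^-1) _ _ _
        (is_derive_expR _) (is_deriveN dV))).
      by rewrite /GRing.scale /= opprK mulrC.
    apply: (is_derive_eq (is_deriveM dX dE)).
    rewrite /flatfun x0 /GRing.scale /= !exprSr expr0 !mul1r; field.
    by rewrite xn.
- have e : flatfun k.+2 0 - k%:R * flatfun k.+1 0 = 0 :> R.
    by rewrite /flatfun ltxx mulr0 subr0.
  (* The slope function is bounded by a multiple of |z|, hence continuous at 0; its value there is
     0, by the convention for division by zero. *)
  rewrite e; apply/is_derive1_caratheodory; exists (fun z => flatfun k z / z).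
  have f0 : flatfun k 0 = 0 :> R by rewrite /flatfun ltxx.
  split=> [z||]; last by rewrite f0 mul0r.
    rewrite f0 !subr0; have [->|z0] := eqVneq z 0; first by rewrite f0 !mul0r.
    by rewrite divfK.
  have gle (z : R) : `|flatfun k z / z| <= k.+2`!%:R * `|z|.
    have [->|z0] := eqVneq z 0; first by rewrite f0 mul0r normr0 mulr0.
    rewrite normrM normfV ler_pdivrMr ?normr_gt0// -mulrA -expr2.
    exact: flatfun_le.
  rewrite /prop_for /continuous_at /= f0 mul0r; apply: norm_cvg0.
  apply: (@squeeze_cvgr _ _ _ _ (fun=> 0) (fun z => k.+2`!%:R * `|z|)).
  + by apply: nearW => z; rewrite normr_ge0 gle.
  + exact: cvg_cst.
  + have H : (fun z : R => k.+2`!%:R * `|z|) @ (0 : R) --> k.+2`!%:R * `|0 : R|.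
      by apply: cvgMr; apply: cvg_norm; exact: cvg_id.
    by rewrite normr0 mulr0 in H.
Unshelve. all: by end_near. Qed.

Lemma Cn_flatfun n k : Cn n (flatfun k : R -> R).
Proof.
elim: n k => // n ih k.
apply: (@CnS _ n (flatfun k) (fun x => flatfun k.+2 x + (- k%:R) * flatfun k.+1 x)).
  by move=> x; rewrite mulNr; exact: is_derive_flatfun.
exact: (CnD (ih k.+2) (CnM (@Cn_cst _ n (- k%:R)) (ih k.+1))).
Qed.

Lemma flatfun_eq0 k (x : R) : x <= 0 -> flatfun k x = 0.
Proof. by move=> x0; rewrite /flatfun ltNge x0. Qed.

Lemma flatfun_gt0 k (x : R) : 0 < x -> 0 < flatfun k x.
Proof.
by move=> x0; rewrite /flatfun x0 mulr_gt0 ?expR_gt0// exprn_gt0// invr_gt0.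
Qed.

Lemma smooth_flatfun k : smooth (flatfun k : R -> R).
Proof. by apply/smoothP => n; exact: Cn_flatfun. Qed.

(** The classical quotient of flat functions; x and 1 - x are never both nonpositive, so the
    denominator is positive everywhere. *)
Definition step (x : R) : R := flatfun 0 x / (flatfun 0 x + flatfun 0 (1 - x)).

Let denom_gt0 (x : R) : 0 < flatfun 0 x + flatfun 0 (1 - x).
Proof.
have [x0|x0] := ltP 0 x.
  by rewrite ltr_wpDr ?flatfun_gt0// flatfun_ge0.
by rewrite ltr_wpDl ?flatfun_ge0// flatfun_gt0//; lra.
Qed.

Let smooth_flatfunB : smooth (fun x : R => flatfun 0 (1 - x)).
Proof.
exact: (smooth_comp (@smooth_flatfun 0) (smoothB (@smooth_cst _ 1) smooth_id)).
Qed.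

Lemma smooth_step : smooth step.
Proof.
apply: (smoothM (@smooth_flatfun 0) (smoothV _ (smoothD (@smooth_flatfun 0) smooth_flatfunB))).
by move=> x; rewrite gt_eqF.
Qed.

Lemma step_eq0 x : x <= 0 -> step x = 0.
Proof. by move=> x0; rewrite /step flatfun_eq0// mul0r. Qed.

Lemma step_eq1 x : 1 <= x -> step x = 1.
Proof.
move=> x1; rewrite /step (@flatfun_eq0 0 (1 - x)) ?subr_le0// addr0 divff//.
by rewrite gt_eqF// flatfun_gt0// (lt_le_trans _ x1).
Qed.

(** This closed form shows at a glance that the derivative is nonnegative and that it vanishes
    outside ]0, 1[, end points included. *)
Lemma derive1_step (x : R) : derive1 step x =
  (flatfun 0 (1 - x) * flatfun 2 x + flatfun 0 x * flatfun 2 (1 - x)) /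
  (flatfun 0 x + flatfun 0 (1 - x)) ^+ 2.
Proof.
have dE (y : R) : is_derive y 1 (flatfun 0) (flatfun 2 y).
  by apply: is_derive_eq (is_derive_flatfun 0 y) _; rewrite mul0r subr0.
have dEB : is_derive x 1 (fun y : R => flatfun 0 (1 - y)) (- flatfun 2 (1 - x)).
  apply: (is_derive_eq (@is_derive1_comp _ (flatfun 0) (fun y => 1 - y) _ _ _
    (dE _) (is_deriveB (is_derive_cst _ _ _) (is_derive_id _ _)))).
  by rewrite sub0r mulrN1.
have dV := @is_deriveV R (fun y => flatfun 0 y + flatfun 0 (1 - y)) x _ 1
  (lt0r_neq0 (denom_gt0 x)) (is_deriveD (dE x) dEB).
have dst : is_derive x 1 step _ := is_deriveM (dE x) dV.
rewrite derive1E (@derive_val _ _ _ _ _ _ _ dst) /GRing.scale /=.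
have := denom_gt0 x; set D := flatfun 0 x + _ => D0.
have -> : D^-1 = (flatfun 0 x + flatfun 0 (1 - x)) / D ^+ 2.
  by rewrite -/D; field; rewrite gt_eqF.
by ring.
Qed.

Lemma derive1_step_ge0 x : 0 <= derive1 step x.
Proof.
rewrite derive1_step; apply: divr_ge0; last exact/exprn_ge0/ltW.
by rewrite addr_ge0// mulr_ge0// flatfun_ge0.
Qed.

Lemma derive1_step_eq0 x : x <= 0 \/ 1 <= x -> derive1 step x = 0.
Proof.
rewrite derive1_step => -[x0|x1].
  by rewrite (flatfun_eq0 2 x0) (flatfun_eq0 0 x0) mulr0 mul0r addr0 mul0r.
have x1' : 1 - x <= 0 by rewrite subr_le0.
by rewrite (flatfun_eq0 2 x1') (flatfun_eq0 0 x1') mulr0 mul0r addr0 mul0r.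
Qed.

Lemma step_ge0 x : 0 <= step x.
Proof. by rewrite divr_ge0 ?flatfun_ge0// ltW. Qed.

Lemma step_le1 x : step x <= 1.
Proof. by rewrite ler_pdivrMr// mul1r lerDl flatfun_ge0. Qed.

End Step.

(** * Integrals of dominated and of compactly supported real functions *)

Section RealIntegrals.
Context {R : realType}.
Notation mu := (@lebesgue_measure R).
Implicit Types (f g h : R -> R).

Definition intble h := mu.-integrable setT (EFin \o h).

Lemma intble_measurable h : intble h -> measurable_fun setT h.
Proof. by move=> /measurable_int/measurable_EFinP. Qed.

Lemma intble_le g h : measurable_fun setT g -> (forall x, `|g x| <= h x) ->
  intble h -> intble g.
Proof.
move=> mg gh ih; apply: le_integrable ih => //; first exact/measurable_EFinP.
by move=> x _ /=; rewrite lee_fin (le_trans (gh x))// ler_norm.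
Qed.

Lemma intble_norm h : intble h -> intble (fun x => `|h x|).
Proof.
move=> ih; apply: le_integrable (ih) => //.
  by apply/measurable_EFinP/measurableT_comp => //; exact: intble_measurable.
by move=> x _ /=; rewrite normr_id.
Qed.

Lemma intbleD f g : intble f -> intble g -> intble (fun x => f x + g x).
Proof. by move=> fi gi; exact: (integrableD measurableT fi gi). Qed.

Lemma intbleZ c f : intble f -> intble (fun x => c * f x).
Proof. by move=> fi; exact: (integrableZl measurableT c fi). Qed.

Lemma intbleN f : intble f -> intble (fun x => - f x).
Proof.
move=> fi; have -> : (fun x => - f x) = (fun x => -1 * f x).
  by apply/funext => x; rewrite mulN1r.
exact: intbleZ.
Qed.

Lemma intbleB f g : intble f -> intble g -> intble (fun x => f x - g x).
Proof. by move=> fi gi; apply: intbleD => //; exact: intbleN. Qed.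

Lemma intble_sum n (F : 'I_n -> R -> R) : (forall i, intble (F i)) ->
  intble (fun x => \sum_(i < n) F i x).
Proof.
elim: n F => [|n ih] F Fi.
  have -> : (fun x => \sum_(i < 0) F i x) = cst 0.
    by apply/funext => x; rewrite big_ord0.
  exact: integrable0.
have -> : (fun x => \sum_(i < n.+1) F i x) =
    (fun x => \sum_(i < n) F (widen_ord (leqnSn n) i) x + F ord_max x).
  by apply/funext => x; rewrite big_ord_recr.
by apply: intbleD => //; exact: ih.
Qed.

Lemma intbleM_bounded f g M : intble f -> measurable_fun setT g ->
  (forall x, `|g x| <= M) -> intble (fun x => f x * g x).
Proof.
move=> fi mg gM; apply: (@intble_le _ (fun x => M * `|f x|)).
- by apply: measurable_funM => //; exact: intble_measurable.
- by move=> x; rewrite normrM mulrC ler_wpM2r.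
- exact/intbleZ/intble_norm.
Qed.

Lemma intble_indic (a b : R) : intble (\1_(`[a, b]%classic : set R)).
Proof.
exact: (integrable_indic_itv a b true false).
Qed.

Lemma Rintegral_indic_itv (a b : R) : a <= b ->
  \int[mu]_(x in setT) (\1_(`[a, b]%classic : set R) x : R) = b - a.
Proof.
move=> ab; rewrite /Rintegral integral_indic//= setIT lebesgue_measure_itv/=.
by rewrite lte_fin; case: ltgtP ab => // -> _; rewrite subrr.
Qed.

Definition supported h (a b : R) := forall x, h x != 0 -> a <= x <= b.

Lemma supported_eq0 h (a b x : R) : supported h a b -> ~~ (a <= x <= b) -> h x = 0.
Proof. by move=> sh; apply: contraNeq => /sh. Qed.

Lemma supported_bounded h a b : continuous h -> supported h a b ->
  exists2 M, 0 <= M & forall x, `|h x| <= M.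
Proof.
move=> ch sh; have [ab|ba] := leP a b; last first.
  exists 0 => // x; rewrite (supported_eq0 sh) ?normr0//.
  by apply/negP => /andP[ax xb]; move: (le_trans ax xb); rewrite leNgt ba.
have cn : {within `[a, b], continuous (fun x => `|h x|)}.
  by apply: continuous_subspaceT => x; apply: cvg_norm; exact: ch.
have [c _ hc] := EVT_max ab cn.
exists `|h c| => // x; have [xab|xab] := boolP (a <= x <= b).
  by apply: hc; rewrite in_itv.
by rewrite (supported_eq0 sh xab) normr0.
Qed.

Lemma supported_le_indic h a b M : supported h a b -> (forall x, `|h x| <= M) ->
  forall x, `|h x| <= M * (\1_(`[a, b]%classic : set R) x).
Proof.
move=> sh hM x; rewrite indicE; have [xab|xab] := boolP (a <= x <= b).
  by rewrite mem_set ?mulr1//= in_itv.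
rewrite (supported_eq0 sh xab) normr0 memNset ?mulr0//=.
by rewrite in_itv/=; exact/negP.
Qed.

Lemma supported_intble h a b M : measurable_fun setT h -> supported h a b ->
  (forall x, `|h x| <= M) -> intble h.
Proof.
move=> mh sh hM; apply: (intble_le mh (supported_le_indic sh hM)).
by apply: intbleZ; exact: intble_indic.
Qed.

Lemma continuous_supported_intble h a b : continuous h -> supported h a b ->
  intble h.
Proof.
move=> ch sh; have [M _ hM] := supported_bounded ch sh.
by apply: supported_intble sh hM; exact: continuous_measurable_fun.
Qed.

Lemma Rintegral_supported_le h a b M : a <= b -> measurable_fun setT h ->
  supported h a b -> (forall x, `|h x| <= M) ->
  `|\int[mu]_(x in setT) h x| <= (b - a) * M.
Proof.
move=> ab mh sh hM; have hi := supported_intble mh sh hM.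
apply: (le_trans (le_normr_Rintegral measurableT hi)).
rewrite mulrC -(Rintegral_indic_itv ab) -RintegralZl//; last exact: intble_indic.
apply: le_Rintegral => //; first exact: intble_norm.
  by apply: intbleZ; exact: intble_indic.
by move=> x _; exact: supported_le_indic.
Qed.

Lemma Rintegral_supported h a b : supported h a b ->
  \int[mu]_(x in setT) h x = \int[mu]_(x in `[a, b]) h x.
Proof.
move=> sh; rewrite [RHS]Rintegral_mkcond; apply: eq_Rintegral => x _.
rewrite patchE; case: ifPn => //; rewrite notin_setE /= in_itv/= => /negP.
exact: supported_eq0.
Qed.

Lemma supported_derive1 h a b : supported h a b -> supported (derive1 h) a b.
Proof.
move=> sh x; apply: contraNT => xab; apply/eqP.
suff : \forall y \near x, h y = cst 0 y.
  by move=> /near_eq_derive; rewrite derive1E => ->; rewrite derive_cst.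
move: xab; rewrite negb_and -!ltNge => /orP[xa|bx]; near=> y.
  apply: (supported_eq0 sh); rewrite negb_and -!ltNge.
  by apply/orP; left; near: y; exact: lt_nbhsl.
apply: (supported_eq0 sh); rewrite negb_and -!ltNge.
by apply/orP; right; near: y; exact: lt_nbhsr.
Unshelve. all: by end_near. Qed.

Lemma smooth_LRcontinuous g (a b : R) : smooth g -> derivable_oo_LRcontinuous g a b.
Proof.
move=> sg; split=> [x _||]; first exact: smooth_derivable.
- by apply: cvg_at_right_filter; exact: smooth_continuous.
- by apply: cvg_at_left_filter; exact: smooth_continuous.
Qed.

Lemma smooth_Rintegral_derive1 g (a b : R) : a < b -> smooth g ->
  \int[mu]_(x in `[a, b]) derive1 g x = g b - g a.
Proof.
move=> ab sg; rewrite /Rintegral (@continuous_FTC2 _ _ g a b)//.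
- by apply: continuous_subspaceT; exact/smooth_continuous/smooth_derive1.
- exact: smooth_LRcontinuous.
Qed.

Lemma Rintegral_derive1_supported h (a b : R) : smooth h -> supported h a b ->
  \int[mu]_(x in setT) derive1 h x = 0.
Proof.
(* On this larger interval h vanishes at both end points; the maximum keeps A < B even when b <
   a. *)
move=> sh hab; pose A := a - 1; pose B := Num.max (b + 1) a.
have AB : A < B by rewrite lt_max; apply/orP; right; rewrite /A; lra.
have hAB : supported (derive1 h) A B.
  move=> y /(supported_derive1 hab) /andP[ay yb].
  by rewrite le_max; apply/andP; split; [rewrite /A; lra|apply/orP; left; lra].
rewrite (Rintegral_supported hAB) smooth_Rintegral_derive1//.
rewrite (supported_eq0 hab (x := A)) ?(supported_eq0 hab (x := B)) ?subr0//.
  rewrite negb_and -!ltNge lt_max; apply/orP; right; apply/orP; left; lra.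
by rewrite negb_and -!ltNge; apply/orP; left; rewrite /A; lra.
Qed.

End RealIntegrals.

(** * Oscillatory integrals and their decay *)

Section Oscillatory.
Context {R : realType}.
Notation mu := (@lebesgue_measure R).
Implicit Types (g h : R -> R).

(* With k = 0 and k = pi / 2 this is the real and the imaginary part of the Fourier transform. *)
Definition osc g (k x : R) : R := \int[mu]_(xi in setT) (g xi * cos (x * xi + k)).

Let smooth_wave (k x : R) : smooth (fun xi : R => cos (x * xi + k)).
Proof. exact: (smooth_comp smooth_cos (@smooth_affine _ x k)). Qed.

Lemma supportedMl g h (a b : R) : supported g a b -> supported (fun x => g x * h x) a b.
Proof. by move=> sg x; rewrite mulf_eq0 negb_or => /andP[/sg]. Qed.

Lemma intble_wave g (k x : R) : intble g -> intble (fun xi => g xi * cos (x * xi + k)).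
Proof.
move=> gi; apply: (@intbleM_bounded _ _ _ 1) => //.
  by apply: continuous_measurable_fun; exact/smooth_continuous/smooth_wave.
by move=> y; rewrite ler_norml cos_geN1 cos_le1.
Qed.

(** Integration by parts against sin(x xi + k), without boundary terms by compact support. The phase
    shift pi / 2 turns cos into - sin and so absorbs the sign. *)
Lemma osc_by_parts g (a b k x : R) : smooth g -> supported g a b ->
  x * osc g k x = osc (derive1 g) (k + pi / 2) x.
Proof.
move=> sg gab.
have gi := continuous_supported_intble (smooth_continuous sg) gab.
have g'i := continuous_supported_intble (smooth_continuous (smooth_derive1 sg))
  (supported_derive1 gab).
pose w (xi : R) := sin (x * xi + k).
have dw (xi : R) : is_derive xi 1 w (x * cos (x * xi + k)).
  have h1 : is_derive xi 1 (fun y : R => x * y + k) x.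
    apply: (is_derive_eq (is_deriveD (is_deriveZ x (is_derive_id xi 1))
      (is_derive_cst k xi 1))).
    by rewrite addr0 /GRing.scale /= mulr1.
  apply: (is_derive_eq (@is_derive1_comp _ sin (fun y => x * y + k) _ _ _
     (is_derive_sin _) h1)).
  by rewrite mulrC.
have sw : smooth w by exact: (smooth_comp smooth_sin (@smooth_affine _ x k)).
have dgw (y : R) : derive1 (fun xi => g xi * w xi) y = g y * (x * cos (x * y + k)) + derive1 g y * w y.
  rewrite derive1E (@derive_val _ _ _ _ _ _ _ (is_deriveM (smooth_is_derive y sg) (dw y))).
  by rewrite /GRing.scale /= [w y * _]mulrC.
have sgw := smoothM sg sw.
have := Rintegral_derive1_supported sgw (@supportedMl _ w _ _ gab).
under eq_Rintegral do rewrite dgw.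
have i1 : intble (fun y => g y * (x * cos (x * y + k))).
  have -> : (fun y => g y * (x * cos (x * y + k))) =
      (fun y => x * (g y * cos (x * y + k))) by apply/funext => y; ring.
  by apply: intbleZ; exact: intble_wave.
have i2 : intble (fun y => derive1 g y * w y).
  apply: (@intbleM_bounded _ _ _ 1) => //.
    by apply: continuous_measurable_fun; exact/smooth_continuous.
  by move=> y; rewrite ler_norml sin_geN1 sin_le1.
rewrite RintegralD// => /eqP; rewrite addr_eq0 => /eqP h0.
rewrite /osc -RintegralZl//; last exact: intble_wave.
have e1 : (fun y => x * (g y * cos (x * y + k))) =1
    (fun y => g y * (x * cos (x * y + k))) by move=> y; ring.
under eq_Rintegral do rewrite e1.
rewrite h0 -mulN1r -RintegralZl//; apply: eq_Rintegral => y _.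
by rewrite addrA cosDpihalf /w mulN1r mulrN.
Qed.

Lemma osc_le g (a b M k x : R) : a <= b -> continuous g -> supported g a b ->
  (forall y, `|g y| <= M) -> `|osc g k x| <= (b - a) * M.
Proof.
move=> ab cg gab gM; apply: Rintegral_supported_le => //.
- apply: measurable_funM; apply: continuous_measurable_fun => //.
  exact/smooth_continuous/smooth_wave.
- exact: supportedMl.
- move=> y; rewrite normrM -[M]mulr1 ler_pM//.
  by rewrite ler_norml cos_geN1 cos_le1.
Qed.

(** Two integrations by parts: quadratic decay suffices for integrability in x and for the sums over
    dyadic shells. *)
Lemma osc_decay g (a b M k x : R) : a <= b -> smooth g -> supported g a b ->
  (forall y, `|derive1 (derive1 g) y| <= M) -> x ^+ 2 * `|osc g k x| <= (b - a) * M.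
Proof.
move=> ab sg gab gM; have sg' := smooth_derive1 sg.
have -> : x ^+ 2 * `|osc g k x| = `|x * (x * osc g k x)|.
  by rewrite !normrM mulrA -expr2 -normrX (ger0_norm (sqr_ge0 x)).
rewrite (osc_by_parts _ _ sg gab) (osc_by_parts _ _ sg' (supported_derive1 gab)).
apply: (osc_le _ _ ab (smooth_continuous (smooth_derive1 sg')) _ gM).
exact/supported_derive1/supported_derive1.
Qed.

End Oscillatory.

(** * Inverse square tails *)

Section Tails.
Context {R : realType}.
Notation mu := (@lebesgue_measure R).
Implicit Types (f g h : R -> R).

Lemma is_derive_shift_inv (y x : R) : x != y ->
  is_derive x 1 (fun z : R => - (z - y)^-1) ((x - y) ^- 2).
Proof.
move=> xy; have xy0 : x - y != 0 by rewrite subr_eq0.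
have h1 : is_derive x 1 (fun z : R => z - y) 1.
  apply: (is_derive_eq (is_deriveB (is_derive_id x 1) (is_derive_cst y x 1))).
  by rewrite subr0.
have h2 := @is_deriveV _ (fun z : R => z - y) x _ 1 xy0 h1.
apply: (is_derive_eq (is_deriveN h2)).
by rewrite /GRing.scale /= mulr1 opprK.
Qed.

Lemma continuous_invsq (y : R) (A : set R) : ~ A y ->
  {within A, continuous (fun x : R => (x - y) ^- 2)}.
Proof.
move=> Ay; apply: continuous_in_subspaceT => x; rewrite inE => Ax.
have xy : x != y by apply/eqP => xy; apply: Ay; rewrite -xy.
apply: cvgV; first by rewrite expf_eq0/= subr_eq0.
apply: (@continuous_comp _ _ _ (fun z : R => z - y) (fun z => z ^+ 2)).
  by apply: cvgB; [exact: cvg_id|exact: cvg_cst].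
exact: exprn_continuous.
Qed.

Lemma integral_tail_right (y D : R) : 0 < D ->
  (\int[mu]_(x in `[(y + D)%R, +oo[) ((x - y) ^- 2)%:E = (D^-1)%:E)%E.
Proof.
move=> D0.
have xy (x : R) : y + D <= x -> x != y by move=> h; rewrite gt_eqF//; lra.
rewrite (@ge0_continuous_FTC2y _ _ (fun z : R => - (z - y)^-1) _ 0).
- by rewrite -EFinB sub0r opprK addrAC subrr add0r.
- by move=> x _; rewrite invr_ge0 sqr_ge0.
- by apply: continuous_invsq; rewrite /= in_itv/= andbT; lra.
- rewrite -oppr0; apply: cvgN; apply/gtr0_cvgV0.
    by near=> z; rewrite subr_gt0; near: z; apply: nbhs_pinfty_gt; exact: num_real.
  exact: cvg_addrr.
- move=> x Dx; apply: ex_derive; apply: is_derive_shift_inv.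
  exact/xy/ltW.
- apply: cvg_at_right_filter; apply: cvgN; apply: cvgV.
    by rewrite addrAC subrr add0r gt_eqF.
  by apply: cvgB; [exact: cvg_id|exact: cvg_cst].
- move=> x; rewrite in_itv /= andbT => /ltW /xy/is_derive_shift_inv dx.
  by rewrite derive1E; apply: derive_val.
Unshelve. all: by end_near. Qed.

Definition tailset (y D : R) : set R := [set x | D <= `|x - y|].
Definition tailf (y D : R) : R -> R := (fun x => (x - y) ^- 2) \_ (tailset y D).

Lemma tailsetE (y D : R) : 0 < D ->
  tailset y D = `]-oo, y - D]%classic `|` `[y + D, +oo[%classic.
Proof.
move=> D0; apply/seteqP; split=> x; rewrite /tailset /= !in_itv /= andbT.
  by rewrite ler_normr => /orP[|] h; [right|left]; lra.
by rewrite ler_normr => -[] h; apply/orP; [right|left]; lra.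
Qed.

Lemma integral_tail_left (y D : R) : 0 < D ->
  (\int[mu]_(x in `]-oo, (y - D)%R]) ((x - y) ^- 2)%:E = (D^-1)%:E)%E.
Proof.
move=> D0; have -> : y - D = - (- y + D) by lra.
rewrite ge0_integration_by_substitutionNy.
- rewrite -(integral_tail_right (- y) D0); apply: eq_integral => x _ /=.
  by congr (_^-1)%:E; ring.
- by apply: continuous_invsq; rewrite /= in_itv/=; lra.
- by move=> x _; rewrite invr_ge0 sqr_ge0.
Qed.

Lemma measurable_tailset (y D : R) : 0 < D -> measurable (tailset y D).
Proof. by move=> D0; rewrite tailsetE//; exact: measurableU. Qed.

Lemma measurable_invsq (y D : R) : 0 < D ->
  measurable_fun (tailset y D) (fun x : R => (x - y) ^- 2).
Proof.
move=> D0; apply: subspace_continuous_measurable_fun.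
  exact: measurable_tailset.
apply: continuous_invsq => yD; move: yD.
by rewrite /tailset /= subrr normr0 leNgt D0.
Qed.

Lemma integral_tailset (y D : R) : 0 < D ->
  (\int[mu]_(x in tailset y D) ((x - y) ^- 2)%:E = (2 * D^-1)%:E)%E.
Proof.
move=> D0; rewrite tailsetE// ge0_integral_setU//=.
- by rewrite integral_tail_left// integral_tail_right// -EFinD; congr EFin; ring.
- apply/measurable_EFinP; rewrite -?tailsetE//; exact: measurable_invsq.
- by move=> x _; rewrite lee_fin invr_ge0 sqr_ge0.
- apply/disj_setPS => x /=; rewrite !in_itv/= andbT => -[]; lra.
Qed.

Lemma intble_tailf (y D : R) : 0 < D -> intble (tailf y D).
Proof.
move=> D0; rewrite /intble /tailf -restrict_EFin.
apply/integrable_restrict => //; first exact: measurable_tailset.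
rewrite setTI.
apply/integrableP; split.
  apply/measurable_EFinP; rewrite -?tailsetE//; exact: measurable_invsq.
under eq_integral do rewrite gee0_abs ?lee_fin ?invr_ge0 ?sqr_ge0//.
by rewrite /= integral_tailset// ltry.
Qed.

Lemma Rintegral_tailf (y D : R) : 0 < D ->
  \int[mu]_(x in setT) tailf y D x = 2 / D.
Proof. by move=> D0; rewrite -Rintegral_mkcond /Rintegral integral_tailset. Qed.

(** Dominated by M on [-1, 1] plus M / x^2 outside. *)
Lemma intble_decay f M : measurable_fun setT f -> (forall x, `|f x| <= M) ->
  (forall x, x ^+ 2 * `|f x| <= M) -> intble f.
Proof.
move=> mf fM f2M.
apply: (@intble_le _ _ (fun x => M * \1_(`[-1, 1]%classic : set R) x + M * tailf 0 1 x)) => //.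
  move=> x; have M0 : 0 <= M by exact: le_trans (fM 0).
  have [x1|x1] := leP 1 `|x|.
    rewrite /tailf patchE mem_set; last by rewrite /tailset /= subr0.
    rewrite subr0 (@le_trans _ _ (M * x ^- 2))//; last first.
      by rewrite lerDr mulr_ge0.
    rewrite ler_pdivlMr 1?mulrC//.
    by rewrite exprn_even_gt0//= -normr_gt0 (lt_le_trans _ x1).
  rewrite indicE mem_set/= ?mulr1; last by rewrite in_itv/= -ler_norml ltW.
  rewrite (le_trans (fM x))// lerDl mulr_ge0// /tailf patchE.
  by case: ifPn => // _; rewrite invr_ge0 sqr_ge0.
apply: intbleD; apply: intbleZ; first exact: intble_indic.
exact: intble_tailf.
Qed.

End Tails.

(** * Differentiation of oscillatory integrals in the parameter *)

Section OscillatoryDerivative.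
Context {R : realType}.
Notation mu := (@lebesgue_measure R).
Implicit Types (g h : R -> R).

(** Differentiation under the integral, dominated by |xi g(xi)|. It multiplies by xi and advances
    the phase by pi / 2, so the family [osc] is stable. *)
Lemma is_derive_osc g (a b k x : R) : continuous g -> supported g a b ->
  is_derive x 1 (osc g k) (osc (fun xi => xi * g xi) (k + pi / 2) x).
Proof.
move=> cg gab.
have gi := continuous_supported_intble cg gab.
have cxg : continuous (fun xi : R => xi * g xi).
  move=> y; apply: (@continuousM _ _ id g); [exact: cvg_id|exact: cg].
have xgi : intble (fun xi => xi * g xi).
  apply: (@continuous_supported_intble _ _ a b) => //.
  by move=> y; rewrite mulf_eq0 negb_or => /andP[_ /gab].
pose F (x : R) (xi : R) := g xi * cos (x * xi + k).
have dF (z xi : R) : is_derive z 1 (F ^~ xi) (xi * g xi * cos (z * xi + (k + pi / 2))).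
  have h1 : is_derive z 1 (fun y : R => y * xi + k) xi.
    apply: (is_derive_eq (is_deriveD (is_deriveM (is_derive_id z 1) (is_derive_cst xi z 1))
      (is_derive_cst k z 1))).
    by rewrite addr0 scaler0 add0r /GRing.scale /= mulr1.
  have h2 := @is_derive1_comp _ cos (fun y => y * xi + k) _ _ _ (is_derive_cos _) h1.
  apply: (is_derive_eq (is_deriveZ (g xi) h2)).
  by rewrite addrA cosDpihalf /GRing.scale /=; ring.
have d1F : partial1of2 F = fun z xi => xi * g xi * cos (z * xi + (k + pi / 2)).
  by apply/funext => z; apply/funext => xi; rewrite partial1of2E (@derive_val _ _ _ _ _ _ _ (dF z xi)).
have ox : (`]x - 1, x + 1[%classic : set R) x by rewrite /= in_itv/=; lra.
have intF (z : R) : (`]x - 1, x + 1[%classic : set R) z ->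
  mu.-integrable setT (EFin \o F z) by move=> _; exact: intble_wave.
have derF (z xi : R) : (`]x - 1, x + 1[%classic : set R) z -> [set: R] xi ->
  derivable (F ^~ xi) z 1 by move=> _ _; exact: (@ex_derive _ _ _ _ _ _ _ (dF z xi)).
have Fub (z xi : R) : (`]x - 1, x + 1[%classic : set R) z -> [set: R] xi ->
    `|partial1of2 F z xi| <= `|xi * g xi|.
  move=> _ _; rewrite d1F normrM -[leRHS]mulr1 ler_wpM2l//.
  by rewrite ler_norml cos_geN1 cos_le1.
have h1 := derivable_under_integral measurableT ox intF derF
  (fun y => normr_ge0 _) (intble_norm xgi) Fub.
have h2 := differentiation_under_integral measurableT ox intF derF
  (fun y => normr_ge0 _) (intble_norm xgi) Fub.
apply: DeriveDef; first exact: h1.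
rewrite -derive1E; apply: (etrans h2); apply: eq_Rintegral => xi _.
by rewrite d1F.
Qed.

Lemma continuous_osc g (a b k : R) : continuous g -> supported g a b ->
  continuous (osc g k).
Proof.
move=> cg gab x; apply/differentiable_continuous/derivable1_diffP.
by have [] := is_derive_osc k x cg gab.
Qed.

End OscillatoryDerivative.

(** * Test functions on the frequency side and their dilates *)

Section Bump.
Context {R : realType}.
Notation mu := (@lebesgue_measure R).
Implicit Types (f g h : R -> R).

Lemma derive1_affine g (a b : R) : smooth g ->
  derive1 (fun x => g (a * x + b)) = (fun x => a * derive1 g (a * x + b)).
Proof.
move=> sg; apply: derive1E_is_derive => x.
have h1 : is_derive x 1 (fun y : R => a * y + b) a.
  apply: (is_derive_eq (is_deriveD (is_deriveZ a (is_derive_id x 1))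
    (is_derive_cst b x 1))).
  by rewrite addr0 /GRing.scale /= mulr1.
apply: (is_derive_eq (@is_derive1_comp _ g (fun y => a * y + b) _ _ _
  (smooth_is_derive _ sg) h1)).
by rewrite mulrC.
Qed.

Lemma derive1Z g (c : R) : smooth g -> derive1 (fun x => c * g x) = (fun x => c * derive1 g x).
Proof.
move=> sg; apply: derive1E_is_derive => x.
exact: (is_deriveZ c (smooth_is_derive x sg)).
Qed.

Lemma smooth_rescale g (a b : R) : smooth g -> smooth (fun x => g (a * x + b)).
Proof. by move=> sg; exact: (smooth_comp sg (@smooth_affine _ a b)). Qed.

Lemma smoothZ g (c : R) : smooth g -> smooth (fun x => c * g x).
Proof. by move=> sg; exact: (smoothM (@smooth_cst _ c) sg). Qed.

Lemma derive2_rescale g (c a b : R) : smooth g ->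
  derive1 (derive1 (fun x => c * g (a * x + b))) =
  (fun x => c * a ^+ 2 * derive1 (derive1 g) (a * x + b)).
Proof.
move=> sg; have sg' := smooth_derive1 sg.
rewrite derive1Z; last exact: smooth_rescale.
rewrite derive1_affine// derive1Z; last first.
  by apply: smoothZ; exact: smooth_rescale.
rewrite derive1Z; last exact: smooth_rescale.
rewrite derive1_affine//; apply/funext => x; ring.
Qed.

(** Support in [1, 2], so that dilates by powers of 2 do not overlap. The factor x in [xbump] makes
    its transform the derivative of that of [bump], so that pairing with a step function reduces to
    point values. *)
Definition bump (x : R) : R := flatfun 0 (1 * x + -1) * flatfun 0 (-1 * x + 2).
Definition xbump (x : R) : R := x * bump x.

Lemma smooth_bump : smooth bump.
Proof.
apply: smoothM; apply: smooth_rescale; exact: smooth_flatfun.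
Qed.

Lemma smooth_xbump : smooth xbump.
Proof. exact: (smoothM smooth_id smooth_bump). Qed.

Lemma bump_ge0 x : 0 <= bump x.
Proof. by rewrite mulr_ge0 ?flatfun_ge0. Qed.

Lemma bump_gt0 (x : R) : 1 < x < 2 -> 0 < bump x.
Proof. by move=> /andP[x1 x2]; rewrite mulr_gt0 ?flatfun_gt0//; lra. Qed.

Lemma bump_neq0 x : bump x != 0 -> 1 < x < 2.
Proof.
rewrite /bump mulf_eq0 negb_or => /andP[h1 h2]; apply/andP; split.
  by rewrite ltNge; apply: contraNN h1 => x1; rewrite flatfun_eq0//; lra.
by rewrite ltNge; apply: contraNN h2 => x1; rewrite flatfun_eq0//; lra.
Qed.

Lemma supported_bump : supported bump 1 2.
Proof. by move=> x /bump_neq0 /andP[/ltW -> /ltW ->]. Qed.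

Lemma xbump_neq0 x : xbump x != 0 -> 1 < x < 2.
Proof. by rewrite mulf_eq0 negb_or => /andP[_]; exact: bump_neq0. Qed.

Lemma supported_xbump : supported xbump 1 2.
Proof. by move=> x /xbump_neq0 /andP[/ltW -> /ltW ->]. Qed.

Lemma bump_bounds : exists2 C : R, 0 < C &
  forall x, [/\ `|derive1 (derive1 bump) x| <= C, `|xbump x| <= C &
                `|derive1 (derive1 xbump) x| <= C].
Proof.
have b2 := smooth_derive1 (smooth_derive1 smooth_bump).
have x2 := smooth_derive1 (smooth_derive1 smooth_xbump).
have [A A0 hA] := supported_bounded (smooth_continuous b2)
  (supported_derive1 (supported_derive1 supported_bump)).
have [B B0 hB] := supported_bounded (smooth_continuous smooth_xbump) supported_xbump.
have [D D0 hD] := supported_bounded (smooth_continuous x2)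
  (supported_derive1 (supported_derive1 supported_xbump)).
clear b2 x2; exists (1 + A + B + D); first lra.
by move=> x; split; [move: (hA x)|move: (hB x)|move: (hD x)] => h;
  apply: (le_trans h); lra.
Qed.

Lemma bump_lower : exists2 m : R, 0 < m & forall x : R, 5/4 <= x <= 7/4 -> m <= bump x.
Proof.
have cb : {within `[5/4, 7/4 : R], continuous bump}.
  by apply: continuous_subspaceT; exact/smooth_continuous/smooth_bump.
have h : (5/4 : R) <= 7/4 by lra.
have [c cin hc] := EVT_min h cb.
exists (bump c); last by move=> x xin; apply: hc; rewrite in_itv.
by apply: bump_gt0; move: cin; rewrite in_itv/= => /andP[]; lra.
Qed.

(** The normalizations make the integral of [bumpr rho] and the supremum of [xbumpr rho] independent
    of rho. The neutral 1 and 0 keep the shape c * g (a * x + b) of the rescaling lemmas. *)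
Definition bumpr (rho xi : R) : R := rho^-1 * bump (rho^-1 * xi + 0).
Definition xbumpr (rho xi : R) : R := 1 * xbump (rho^-1 * xi + 0).

Lemma smooth_bumpr (rho : R) : smooth (bumpr rho).
Proof. by apply: smoothZ; apply: smooth_rescale; exact: smooth_bump. Qed.
Lemma smooth_xbumpr (rho : R) : smooth (xbumpr rho).
Proof. by apply: smoothZ; apply: smooth_rescale; exact: smooth_xbump. Qed.

Lemma xbumprE rho : xbumpr rho = fun xi => xi * bumpr rho xi.
Proof. by apply/funext => xi; rewrite /xbumpr /bumpr /xbump; ring. Qed.

Lemma xbumpr_neq0 (rho xi : R) : 0 < rho -> xbumpr rho xi != 0 -> rho < xi < 2 * rho.
Proof.
move=> r0; rewrite /xbumpr mul1r addr0 => /xbump_neq0.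
by rewrite mulrC ltr_pdivlMr// ltr_pdivrMr// mul1r.
Qed.

Lemma supported_xbumpr (rho : R) : 0 < rho -> supported (xbumpr rho) rho (2 * rho).
Proof. by move=> r0 xi /(xbumpr_neq0 r0) /andP[/ltW -> /ltW ->]. Qed.

Lemma supported_bumpr (rho : R) : 0 < rho -> supported (bumpr rho) rho (2 * rho).
Proof.
move=> r0 xi; rewrite /bumpr mulf_eq0 negb_or addr0 => /andP[_ /bump_neq0].
by rewrite mulrC ltr_pdivlMr// ltr_pdivrMr// mul1r => /andP[/ltW -> /ltW ->].
Qed.

(** The value at 0 is the integral of [bump], for every rho: at least its minimum m on [5/4, 7/4]
    times the length 1/2. *)
Lemma osc_bumpr0_lower : exists2 kappa : R, 0 < kappa &
  forall rho : R, 0 < rho -> kappa <= osc (bumpr rho) 0 0.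
Proof.
have [m m0 hm] := bump_lower; exists (m / 2); first by rewrite divr_gt0.
move=> rho r0; rewrite /osc; under eq_Rintegral do rewrite mul0r add0r cos0 mulr1.
have h : 5/4 * rho <= 7/4 * rho by rewrite ler_wpM2r ?ltW//; lra.
have -> : m / 2 = (rho^-1 * m) * (7/4 * rho - 5/4 * rho).
  by field; rewrite gt_eqF.
rewrite -(Rintegral_indic_itv h).
rewrite -(@RintegralZl _ _ _ mu setT _ (rho^-1 * m) measurableT (@intble_indic _ _ _)).
apply: le_Rintegral => //.
- by apply: intbleZ; exact: intble_indic.
- apply: continuous_supported_intble (supported_bumpr r0).
  exact/smooth_continuous/smooth_bumpr.
- move=> x _; rewrite indicE.
  case: (boolP (x \in _)) => [|_]; last first.
    by rewrite mulr0 mulr_ge0 ?invr_ge0 ?bump_ge0// ltW.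
  rewrite inE /= in_itv/= => /andP[x1 x2].
  rewrite mulr1 /bumpr ler_wpM2l ?invr_ge0 ?(ltW r0)// addr0.
  by apply: hm; rewrite [rho^-1 * x]mulrC ler_pdivlMr// ler_pdivrMr// x1.
Qed.

(** All are the case rho = 1 after scaling: the transform of [bumpr rho] depends on rho x only, that
    of [xbumpr rho] is rho times such a function. Hence one constant for all scales. *)
Lemma osc_bumpr_bounds : exists2 C : R, 0 < C & forall rho x : R, 0 < rho ->
  [/\ (rho * x) ^+ 2 * `|osc (bumpr rho) 0 x| <= C,
      forall xi, `|xbumpr rho xi| <= C,
      `|osc (xbumpr rho) (0 + pi / 2) x| <= C * rho &
      rho * x ^+ 2 * `|osc (xbumpr rho) (0 + pi / 2) x| <= C].
Proof.
have [C C0 hC] := bump_bounds; exists C => // rho x r0.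
have r2 : rho <= 2 * rho by lra.
have xb xi : `|xbumpr rho xi| <= C by rewrite /xbumpr mul1r; have [] := hC (rho^-1 * xi + 0).
split=> //.
- have h : forall y, `|derive1 (derive1 (bumpr rho)) y| <= C * rho ^- 3.
    move=> y; rewrite derive2_rescale; last exact: smooth_bump.
    have [h _ _] := hC (rho^-1 * y + 0).
    rewrite normrM mulrC ler_pM//.
    by rewrite ger0_norm ?mulr_ge0 ?sqr_ge0 ?invr_ge0 ?(ltW r0)// -exprS exprVn.
  have := osc_decay 0 x r2 (smooth_bumpr (rho:=rho)) (supported_bumpr r0) h.
  have -> : (2 * rho - rho) * (C * rho ^- 3) = C * rho ^- 2 by field; rewrite gt_eqF.
  by move=> h'; rewrite exprMn -mulrA mulrC -ler_pdivlMr ?exprn_gt0.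
- have := osc_le (0 + pi / 2) x r2 (smooth_continuous (smooth_xbumpr (rho:=rho))) (supported_xbumpr r0) xb.
  by have -> : (2 * rho - rho) * C = C * rho by ring.
- have h : forall y, `|derive1 (derive1 (xbumpr rho)) y| <= C * rho ^- 2.
    move=> y; rewrite derive2_rescale; last exact: smooth_xbump.
    have [_ _ h] := hC (rho^-1 * y + 0).
    rewrite normrM mulrC ler_pM// mul1r.
    by rewrite ger0_norm ?sqr_ge0// exprVn.
  have := osc_decay (0 + pi / 2) x r2 (smooth_xbumpr (rho:=rho)) (supported_xbumpr r0) h.
  have -> : (2 * rho - rho) * (C * rho ^- 2) = C * rho ^- 1 by field; rewrite gt_eqF.
  by move=> h'; rewrite -mulrA mulrC -ler_pdivlMr.
Qed.

End Bump.

(** * Detection of a jump at one frequency scale *)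

Section Pairing.
Context {R : realType}.
Notation mu := (@lebesgue_measure R).
Implicit Types (f g h : R -> R).

(* Nothing is assumed about g on ]y - L, y + L[. *)
Definition edge g (y L d P Q : R) :=
  (forall x : R, y - d <= x <= y - L -> g x = P) /\
  (forall x : R, y + L <= x <= y + d -> g x = Q).

(** An exact derivative in x of the transform of [bumpr rho] centred at y, hence integrated
    explicitly over intervals. *)
Definition kern (rho y x : R) : R := osc (xbumpr rho) (0 + pi / 2) (x - y).

Lemma is_derive_kern (rho y x : R) : 0 < rho ->
  is_derive x 1 (fun z => osc (bumpr rho) 0 (z - y)) (kern rho y x).
Proof.
move=> r0.
have h1 : is_derive x 1 (fun z : R => z - y) 1.
  apply: (is_derive_eq (is_deriveB (is_derive_id x 1) (is_derive_cst y x 1))).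
  by rewrite subr0.
have h2 := is_derive_osc 0 (x - y) (smooth_continuous (smooth_bumpr (rho:=rho))) (supported_bumpr r0).
apply: (is_derive_eq (@is_derive1_comp _ (osc (bumpr rho) 0) (fun z => z - y) _ _ _ h2 h1)).
by rewrite mulr1 /kern xbumprE.
Qed.

Lemma continuous_kern (rho y : R) : 0 < rho -> continuous (kern rho y).
Proof.
move=> r0 x; apply: (@continuous_comp _ _ _ (fun z : R => z - y)).
  by apply: cvgB; [exact: cvg_id|exact: cvg_cst].
exact: (continuous_osc (smooth_continuous (smooth_xbumpr (rho:=rho))) (supported_xbumpr r0)).
Qed.

Lemma Rintegral_kern (rho y a b : R) : 0 < rho -> a < b ->
  \int[mu]_(x in `[a, b]) kern rho y x =
  osc (bumpr rho) 0 (b - y) - osc (bumpr rho) 0 (a - y).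
Proof.
move=> r0 ab; pose F z := osc (bumpr rho) 0 (z - y).
have cF : continuous F.
  move=> x; apply/differentiable_continuous/derivable1_diffP.
  by have [] := is_derive_kern y x r0.
rewrite /Rintegral (@continuous_FTC2 _ _ F a b)//.
- by apply: continuous_subspaceT; exact: continuous_kern.
- split=> [x _||]; first by have [] := is_derive_kern y x r0.
  + by apply: cvg_at_right_filter; exact: cF.
  + by apply: cvg_at_left_filter; exact: cF.
- move=> x _; rewrite derive1E.
  exact: (@derive_val _ _ _ _ _ _ _ (is_derive_kern y x r0)).
Qed.

Lemma Rintegral_indicM f (A : set R) :
  \int[mu]_(x in setT) (f x * \1_A x) = \int[mu]_(x in A) f x.
Proof.
rewrite [RHS]Rintegral_mkcond; apply: eq_Rintegral => x _.
by rewrite patchE indicE; case: ifPn => _; rewrite ?mulr1 ?mulr0.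
Qed.

(** For an exact step at y the pairing telescopes to (P - Q) times the transform at 0, up to its
    values at distance d, which are O((rho d)^-2). The unknown window costs the size rho of the
    kernel times L, and the part beyond d costs the integral of its tail, O((rho d)^-1). *)
Lemma kern_pairing : exists2 C : R, 0 < C &
  forall g (rho y L d P Q : R), measurable_fun setT g -> (forall x, `|g x| <= 2) ->
    0 < rho -> 0 < L <= d -> 1 <= rho * d -> edge g y L d P Q ->
  intble (fun x => g x * kern rho y x) /\
  `|\int[mu]_(x in setT) (g x * kern rho y x) + (Q - P) * osc (bumpr rho) 0 0|
    <= C * (rho * L + (rho * d)^-1).
Proof.
have [C C0 hC] := @osc_bumpr_bounds R.
exists (16 * C); first lra.
move=> g rho y L d P Q mg g2 r0 /andP[L0 Ld] rd [gP gQ].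
have d0 : 0 < d by exact: lt_le_trans Ld.
have mk : measurable_fun setT (kern rho y).
  by apply: continuous_measurable_fun; exact: continuous_kern.
have K1 x : `|kern rho y x| <= C * rho by have [] := hC rho (x - y) r0.
have K2 (x D : R) : 0 < D -> D <= `|x - y| ->
    `|kern rho y x| <= C / rho * tailf y D x.
  move=> D0 Dx; have [_ _ _] := hC rho (x - y) r0.
  rewrite /tailf patchE (mem_set (Dx : tailset y D x)) => h.
  have xy : 0 < (x - y) ^+ 2.
    by rewrite exprn_even_gt0//= -normr_gt0 (lt_le_trans D0).
  rewrite /= -mulrA -invfM ler_pdivlMr; first by rewrite mulrC.
  by rewrite mulr_gt0.
have tail_ge0 (D x : R) : 0 <= C / rho * tailf y D x.
  rewrite mulr_ge0 ?divr_ge0 ?(ltW C0) ?(ltW r0)// /tailf patchE.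
  by case: ifPn => // _; rewrite invr_ge0 sqr_ge0.
have ind_ge0 (A : set R) x : 0 <= C * rho * \1_A x.
  by rewrite mulr_ge0 ?mulr_ge0 ?(ltW C0) ?(ltW r0)// indicE ler0n.
have ik : intble (kern rho y).
  apply: (@intble_le _ _ (fun x => C * rho * \1_(`[y - 1, y + 1]%classic : set R) x + C / rho * tailf y 1 x)) => //.
    move=> x; have [x1|x1] := leP 1 `|x - y|.
      by rewrite (le_trans (K2 _ _ _ x1))// lerDr.
    rewrite (le_trans (K1 x))//; rewrite indicE mem_set ?mulr1 ?lerDl//=.
    by rewrite in_itv/= -ler_distl ltW.
  by apply: intbleD; apply: intbleZ; [exact: intble_indic|exact: intble_tailf].
have igk : intble (fun x => g x * kern rho y x).
  have -> : (fun x => g x * kern rho y x) = (fun x => kern rho y x * g x).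
    by apply/funext => x; rewrite mulrC.
  exact: intbleM_bounded g2.
split => //.
(* The comparison integrand [s] replaces g by the step function that jumps from P to Q at y itself
   and vanishes beyond distance d. *)
pose Am : set R := `[y - d, y]%classic; pose Ap : set R := `[y, y + d]%classic.
pose s x := P * (kern rho y x * \1_Am x) + Q * (kern rho y x * \1_Ap x).
have imA (A : set R) : measurable A -> intble (fun x => kern rho y x * \1_A x).
  move=> mA; apply: (@intbleM_bounded _ _ _ 1) => // x.
  by rewrite indicE; case: (x \in A); rewrite ?normr1 ?normr0.
have iAm : intble (fun x => kern rho y x * \1_Am x) by apply: imA; exact: measurable_itv.
have iAp : intble (fun x => kern rho y x * \1_Ap x) by apply: imA; exact: measurable_itv.
have is_ : intble s by apply: intbleD; exact: intbleZ.
have sE : \int[mu]_(x in setT) s x = P * (osc (bumpr rho) 0 0 - osc (bumpr rho) 0 (- d)) +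
    Q * (osc (bumpr rho) 0 d - osc (bumpr rho) 0 0).
  rewrite RintegralD//; [|exact: intbleZ..].
  rewrite !RintegralZl//.
  rewrite !Rintegral_indicM !Rintegral_kern//; try lra.
  by rewrite subrr [y - d]addrC [y + d]addrC -!addrA subrr !addr0.
have P2 : `|P| <= 2 by rewrite -(gP (y - d)) ?lexx ?lerD2l ?lerN2.
have Q2 : `|Q| <= 2 by rewrite -(gQ (y + d)) ?lexx ?lerD2l ?andbT.
(* On the window g, P and Q contribute at most 2 each, whence 6; beyond distance d, [s] vanishes and
   only |g| <= 2 remains; in between the difference is zero. *)
pose e x := 6 * (C * rho) * \1_(`[y - L, y + L]%classic : set R) x + 2 * (C / rho) * tailf y d x.
have ie : intble e by apply: intbleD; apply: intbleZ; [exact: intble_indic|exact: intble_tailf].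
have key x : `|g x * kern rho y x - s x| <= e x.
  have [xin|xout] := boolP (y - L <= x <= y + L).
    rewrite /e indicE mem_set; last by rewrite /= in_itv.
    rewrite mulr1; have t0 := tail_ge0 d x.
    have h1 : `|g x * kern rho y x| <= 2 * (C * rho) by rewrite normrM ler_pM//; exact: K1.
    have ib (A : set R) : `|kern rho y x * \1_A x| <= C * rho.
      rewrite normrM -[C * rho]mulr1 ler_pM ?K1// indicE.
      by case: (x \in A); rewrite ?normr1 ?normr0.
    have h2 : `|P * (kern rho y x * \1_Am x)| <= 2 * (C * rho) by rewrite normrM ler_pM.
    have h3 : `|Q * (kern rho y x * \1_Ap x)| <= 2 * (C * rho) by rewrite normrM ler_pM.
    apply: (le_trans (ler_normB _ _)); apply: (le_trans (lerD h1 (ler_normD _ _))).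
    apply: (le_trans (lerD (lexx _) (lerD h2 h3))).
    move: (C * rho) (C / rho) t0 => u v; rewrite -mulrA; lra.
  have [xd|xd] := leP `|x - y| d; last first.
    have xAm : x \notin Am.
      rewrite notin_setE /Am /= in_itv/= => /andP[x1 x2].
      by move: xd; rewrite ltNge ler_distl; apply/negP; rewrite negbK; lra.
    have xAp : x \notin Ap.
      rewrite notin_setE /Ap /= in_itv/= => /andP[x1 x2].
      by move: xd; rewrite ltNge ler_distl; apply/negP; rewrite negbK; lra.
    rewrite /s !indicE (negbTE xAm) (negbTE xAp) !mulr0 !addr0 subr0.
    apply: (@le_trans _ _ (2 * (C / rho * tailf y d x))).
      by rewrite normrM ler_pM// (K2 _ _ d0)// ltW.
    rewrite /e -[2 * (C / rho) * _]mulrA lerDr -[6 * _ * _]mulrA.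
    by apply: mulr_ge0 => //; exact: ind_ge0.
  have e0 : 0 <= e x.
    rewrite /e -[2 * (C / rho) * _]mulrA -[6 * _ * _]mulrA.
    by apply: addr_ge0; apply: mulr_ge0.
  suff -> : g x * kern rho y x - s x = 0 by rewrite normr0.
  move: xd; rewrite ler_distl => /andP[x1 x2].
  move: xout; rewrite negb_and -!ltNge => /orP[xl|xr].
    have xAm : x \in Am by rewrite inE /Am /= in_itv/=; lra.
    have xAp : x \notin Ap by rewrite notin_setE /Ap /= in_itv/=; lra.
    rewrite /s !indicE xAm (negbTE xAp) gP ?x1 ?ltW//.
    by rewrite !mulr0 addr0 mulr1 subrr.
  have xAm : x \notin Am by rewrite notin_setE /Am /= in_itv/=; lra.
  have xAp : x \in Ap by rewrite inE /Ap /= in_itv/=; lra.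
  rewrite /s !indicE xAp (negbTE xAm) gQ ?x2 ?ltW//.
  by rewrite !mulr0 add0r mulr1 subrr.
have rd0 : rho * d != 0 by rewrite gt_eqF// mulr_gt0.
have eE : \int[mu]_(x in setT) e x = 12 * C * (rho * L) + 4 * C * (rho * d)^-1.
  have i1 : intble (\1_(`[y - L, y + L]%classic : set R)) := @intble_indic _ _ _.
  have i2 := intble_tailf y d0.
  rewrite RintegralD//; [|exact: intbleZ..].
  rewrite !RintegralZl//.
  rewrite Rintegral_indic_itv; last lra.
  rewrite Rintegral_tailf// invfM; move: (rho^-1) (d^-1) => u v; ring.
have kd z : `|z| = d -> `|osc (bumpr rho) 0 z| <= C * (rho * d)^-1.
  move=> zd; have [+ _ _ _] := hC rho z r0.
  rewrite exprMn -[z ^+ 2]ger0_norm ?sqr_ge0// normrX zd -exprMn mulrC.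
  rewrite -ler_pdivlMr ?exprn_gt0 ?mulr_gt0// => h; apply: (le_trans h).
  rewrite ler_pM2l// lef_pV2 ?posrE ?exprn_gt0 ?mulr_gt0//.
  by rewrite expr2 ler_peMr// ltW// mulr_gt0.
have -> : \int[mu]_(x in setT) (g x * kern rho y x) =
    \int[mu]_(x in setT) s x + \int[mu]_(x in setT) (g x * kern rho y x - s x).
  by rewrite RintegralB// addrCA subrr addr0.
have ir := intbleB igk is_.
have hr : `|\int[mu]_(x in setT) (g x * kern rho y x - s x)| <=
    12 * C * (rho * L) + 4 * C * (rho * d)^-1.
  rewrite -eE; apply: (le_trans (le_normr_Rintegral measurableT ir)).
  by apply: le_Rintegral => //; exact: intble_norm.
have hP : `|P * osc (bumpr rho) 0 (- d)| <= 2 * (C * (rho * d)^-1).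
  by rewrite normrM ler_pM// kd// normrN gtr0_norm.
have hQ : `|Q * osc (bumpr rho) 0 d| <= 2 * (C * (rho * d)^-1).
  by rewrite normrM ler_pM// kd// gtr0_norm.
have -> t : \int[mu]_(x in setT) s x + t + (Q - P) * osc (bumpr rho) 0 0 =
    Q * osc (bumpr rho) 0 d - P * osc (bumpr rho) 0 (- d) + t by rewrite sE; ring.
apply: (le_trans (ler_normD _ _)).
apply: (le_trans (lerD (le_trans (ler_normB _ _) (lerD hQ hP)) hr)).
have rL : 0 <= C * (rho * L) by rewrite !mulr_ge0// ltW.
have rd1 : 0 <= C * (rho * d)^-1 by rewrite mulr_ge0 ?invr_ge0 ?mulr_ge0// ltW.
rewrite mulrDr -![_ * C * _]mulrA.
by move: (C * (rho * L)) (C * (rho * d)^-1) rL rd1 => u v u0 v0; lra.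
Qed.

End Pairing.

(** * Duality with modulated test functions *)

Section FourierPairing.
Context {R : realType}.
Notation mu := (@lebesgue_measure R).
Implicit Types (psi : R -> R).

Definition annulus (r M : R) : set R := [set xi | r <= `|xi| <= M].

Lemma measurable_annulus (r M : R) : measurable (annulus r M).
Proof.
have -> : annulus r M = (fun x : R => `|x|) @^-1` `[r, M]%classic.
  by apply/seteqP; split=> x; rewrite /annulus /= in_itv.
rewrite -[X in measurable X]setTI.
have : measurable_fun setT (fun x : R => `|x|) by exact: measurableT_comp.
by move=> h; apply: h => //; exact: measurable_itv.
Qed.

(** The annuli 1/(n+1) <= |xi| <= n+1 exhaust the complement of 0, and a single point does not
    affect measurability. *)
Lemma measurable_away0 (u : R -> R) :
  (forall r M, 0 < r -> mu.-integrable (annulus r M) (EFin \o u)) ->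
  measurable_fun setT u.
Proof.
move=> hu.
have -> : [set: R] = [set 0] `|` \bigcup_n annulus (n.+1%:R^-1) n.+1%:R.
  apply/seteqP; split=> // x _; have [->|x0] := eqVneq x 0; first by left.
  have nx : 0 < `|x| by rewrite normr_gt0.
  right; exists (Num.truncn (`|x| + `|x|^-1)) => //=.
  set n := Num.truncn _; have hn : `|x| + `|x|^-1 < n.+1%:R.
    exact: truncnS_gt.
  have ix : 0 < `|x|^-1 by rewrite invr_gt0.
  apply/andP; split; last by rewrite ltW//; lra.
  rewrite -[leRHS]invrK lef_pV2 ?posrE//; lra.
apply/measurable_funU => //.
  by apply: bigcup_measurable => n _; exact: measurable_annulus.
split; first exact: measurable_fun_set1.
apply/measurable_fun_bigcup => n; first exact: measurable_annulus.
have n0 : 0 < n.+1%:R^-1 :> R by rewrite invr_gt0.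
by have /measurable_int/measurable_EFinP := hu _ n.+1%:R n0.
Qed.

Lemma osc_sin psi (x : R) :
  osc psi (- (pi / 2)) x = \int[mu]_(xi in setT) (psi xi * sin (x * xi)).
Proof.
apply: eq_Rintegral => xi _; congr (_ * _).
by rewrite -[in RHS](subrK (pi / 2) (x * xi)) sinDpihalf.
Qed.

Lemma osc_cos psi (x : R) :
  osc psi 0 x = \int[mu]_(xi in setT) (psi xi * cos (x * xi)).
Proof. by apply: eq_Rintegral => xi _; rewrite addr0. Qed.

Lemma intble_osc psi (a b k : R) : smooth psi -> supported psi a b ->
  intble (osc psi k).
Proof.
move=> sp pab.
have [A A0 hA] := supported_bounded (smooth_continuous sp) pab.
have sp2 := smooth_derive1 (smooth_derive1 sp).
have [B B0 hB] := supported_bounded (smooth_continuous sp2)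
  (supported_derive1 (supported_derive1 pab)).
pose b' := Num.max a b.
have ab' : a <= b' by rewrite le_max lexx.
have pab' : supported psi a b'.
  by move=> x /pab /andP[ax xb]; rewrite ax le_max xb orbT.
apply: (@intble_decay _ _ ((b' - a) * (A + B))).
- exact: continuous_measurable_fun (continuous_osc (smooth_continuous sp) pab).
- move=> x; apply: osc_le => //; first exact: smooth_continuous.
  by move=> y; rewrite (le_trans (hA y))// lerDl.
- move=> x; apply: osc_decay => // y.
  by rewrite (le_trans (hB y))// lerDr.
Qed.

Lemma test_off0_supported psi r M : 0 < r -> smooth psi -> supported psi r M ->
  test_off0 psi.
Proof.
move=> r0 sp prM; split=> //; exists r, M; split=> // xi /prM /andP[rx xM].
by rewrite gtr0_norm ?rx// (lt_le_trans r0).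
Qed.

(** Modulation in frequency translates the transform by y. Two real functions are needed because
    [fourier] is tested with real ones only; the phase pi / 2 is that of [kern]. *)
Definition psic psi (y xi : R) := psi xi * cos (- y * xi + pi / 2).
Definition psis psi (y xi : R) := psi xi * sin (- y * xi + pi / 2).

Lemma smooth_psic psi y : smooth psi -> smooth (psic psi y).
Proof.
move=> sp; apply: (smoothM sp).
exact: (smooth_comp smooth_cos (@smooth_affine _ (- y) (pi / 2))).
Qed.

Lemma smooth_psis psi y : smooth psi -> smooth (psis psi y).
Proof.
move=> sp; apply: (smoothM sp).
exact: (smooth_comp smooth_sin (@smooth_affine _ (- y) (pi / 2))).
Qed.

Lemma osc_shift psi (a b x y : R) : continuous psi -> supported psi a b ->
  osc psi (0 + pi / 2) (x - y) =
  osc (psic psi y) 0 x - osc (psis psi y) (- (pi / 2)) x.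
Proof.
move=> cp pab.
have ip := continuous_supported_intble cp pab.
have i1 : intble (psic psi y) by exact: intble_wave.
have i2 : intble (psis psi y).
  have -> : psis psi y = fun xi => psi xi * cos (- y * xi + (pi / 2 - pi / 2)).
    apply/funext => xi; rewrite /psis; congr (_ * _).
    by rewrite subrr addr0 sinDpihalf.
  exact: intble_wave.
rewrite osc_cos osc_sin /osc -RintegralB//; first last.
- apply: (@intbleM_bounded _ _ _ 1) => //.
    apply: continuous_measurable_fun.
    have := smooth_comp smooth_sin (@smooth_affine R x 0).
    by under eq_fun do rewrite addr0; exact: smooth_continuous.
  by move=> z; rewrite ler_norml sin_geN1 sin_le1.
- have := @intble_wave R _ 0 x i1.
  by under eq_fun do rewrite addr0.
apply: eq_Rintegral => xi _; rewrite /psic /psis add0r.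
have -> : (x - y) * xi + pi / 2 = x * xi + (- y * xi + pi / 2) by ring.
by rewrite cosD; ring.
Qed.

Lemma intble_away0M (u psi : R -> R) r M : 0 < r ->
  (forall r M, 0 < r -> mu.-integrable (annulus r M) (EFin \o u)) ->
  continuous psi -> supported psi r M -> intble (fun xi => u xi * psi xi).
Proof.
move=> r0 hu cp prM.
have [A A0 hA] := supported_bounded cp prM.
have mA := measurable_annulus r M.
have iu : intble (u \_ (annulus r M)).
  rewrite /intble -restrict_EFin; apply/integrable_restrict => //.
  by rewrite setTI; exact: hu.
have -> : (fun xi => u xi * psi xi) = (fun xi => (u \_ (annulus r M)) xi * psi xi).
  apply/funext => xi; rewrite patchE; case: ifPn => // xiA.
  rewrite (supported_eq0 prM) ?mulr0//.
  apply: contra xiA => /andP[rx xM]; rewrite inE /annulus /=.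
  by rewrite gtr0_norm ?rx// (lt_le_trans r0).
by apply: intbleM_bounded hA => //; exact: continuous_measurable_fun.
Qed.

(** The addition formula for cos splits the translated transform into a cosine part, tested against
    a, and a sine part, tested against b; its minus sign is the one in the sine clause of
    [fourier]. *)
Lemma fourier_pairing (m : nat) (f a b : R -> 'rV[R]_m) (i : 'I_m) psi (r M y : R) :
  fourier f a b -> 0 < r -> smooth psi -> supported psi r M ->
  [/\ intble (fun xi => a xi ord0 i * psic psi y xi),
      intble (fun xi => b xi ord0 i * psis psi y xi) &
  \int[mu]_(x in setT) (f x ord0 i * osc psi (0 + pi / 2) (x - y)) =
  \int[mu]_(xi in setT) (a xi ord0 i * psic psi y xi + b xi ord0 i * psis psi y xi)].
Proof.
move=> /(_ i)[mf [K fK] hab hpsi] r0 sp prM.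
have sc := smooth_psic (y := y) sp; have ss := smooth_psis (y := y) sp.
have cM : supported (psic psi y) r M := supportedMl prM.
have sM : supported (psis psi y) r M := supportedMl prM.
have ia : intble (fun xi => a xi ord0 i * psic psi y xi).
  apply: (intble_away0M r0 _ (smooth_continuous sc) cM).
  by move=> r' M' h; have [] := hab r' M' h.
have ib : intble (fun xi => b xi ord0 i * psis psi y xi).
  apply: (intble_away0M r0 _ (smooth_continuous ss) sM).
  by move=> r' M' h; have [] := hab r' M' h.
split=> //; rewrite RintegralD//.
have [-> _] := hpsi _ (test_off0_supported r0 sc cM).
have [_ ->] := hpsi _ (test_off0_supported r0 ss sM).
have e1 (x : R) : f x ord0 i * osc psi (0 + pi / 2) (x - y) =
    f x ord0 i * osc (psic psi y) 0 x - f x ord0 i * osc (psis psi y) (- (pi / 2)) x.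
  by rewrite (osc_shift _ _ (smooth_continuous sp) prM) mulrBr.
under eq_Rintegral do rewrite e1.
have fosc (h : R -> R) k : smooth h -> supported h r M -> intble (fun x => f x ord0 i * osc h k x).
  move=> sh hrM; have io := intble_osc k sh hrM.
  have -> : (fun x => f x ord0 i * osc h k x) = (fun x => osc h k x * f x ord0 i).
    by apply/funext => x; rewrite mulrC.
  exact: intbleM_bounded fK.
rewrite (RintegralB measurableT (fosc _ 0 sc cM) (fosc _ (- (pi / 2)) ss sM)).
have ec : (fun x => f x ord0 i * osc (psic psi y) 0 x) = (fun x => f x ord0 i *
    \int[mu]_(xi in setT) (psic psi y xi * cos (x * xi))).
  by apply/funext => x; rewrite osc_cos.
have es : (fun x => f x ord0 i * osc (psis psi y) (- (pi / 2)) x) = (fun x => f x ord0 i *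
    \int[mu]_(xi in setT) (psis psi y xi * sin (x * xi))).
  by apply/funext => x; rewrite osc_sin.
by rewrite ec es.
Qed.

End FourierPairing.

(** * A logarithmic lower bound for the energy at a jump *)

Section EdgeLowerBound.
Context {R : realType}.
Notation mu := (@lebesgue_measure R).

Lemma Rintegral_sum n (F : 'I_n -> R -> R) : (forall i, intble (F i)) ->
  \int[mu]_(x in setT) (\sum_(i < n) F i x) = \sum_(i < n) \int[mu]_(x in setT) F i x.
Proof.
elim: n F => [|n ih] F iF.
  rewrite big_ord0; have e : (fun x => \sum_(i < 0) F i x) = cst 0.
    by apply/funext => x; rewrite big_ord0.
  by rewrite e /Rintegral integral0.
have e : (fun x => \sum_(i < n.+1) F i x) =
    (fun x => \sum_(i < n) F (widen_ord (leqnSn n) i) x + F ord_max x).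
  by apply/funext => x; rewrite big_ord_recr.
have iF' : intble (fun x => \sum_(i < n) F (widen_ord (leqnSn n) i) x).
  exact: (@intble_sum _ _ (fun i => F (widen_ord (leqnSn n) i))).
by rewrite e (RintegralD measurableT iF' (iF ord_max)) big_ord_recr ih.
Qed.

Lemma dot_ge0 m (v : 'rV[R]_m) : 0 <= sqn v.
Proof. by apply: sumr_ge0 => i _; rewrite -expr2 sqr_ge0. Qed.

Lemma sqr_le_sqn m (v : 'rV[R]_m) i : v ord0 i ^+ 2 <= sqn v.
Proof.
rewrite /sqn /dot (bigD1 i)//= expr2 lerDl.
by apply: sumr_ge0 => j _; rewrite -expr2 sqr_ge0.
Qed.

Lemma measurable_sqn m (a : R -> 'rV[R]_m) :
  (forall i, measurable_fun setT (fun x => a x ord0 i)) ->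
  measurable_fun setT (fun x => sqn (a x)).
Proof.
move=> ma; rewrite /sqn /dot; apply: measurable_sum => i.
exact: measurable_funM.
Qed.

Lemma fourier_measurable m (f a b : R -> 'rV[R]_m) : fourier f a b ->
  (forall i, measurable_fun setT (fun x => a x ord0 i)) /\
  (forall i, measurable_fun setT (fun x => b x ord0 i)).
Proof.
by move=> h; split=> i; have [_ _ hab _] := h i; apply: measurable_away0 => r M r0;
  have [] := hab r M r0.
Qed.

Definition energy m (a b : R -> 'rV[R]_m) (xi : R) : R :=
  `|xi| * (sqn (a xi) + sqn (b xi)).

Lemma energy_ge0 m (a b : R -> 'rV[R]_m) xi : 0 <= energy a b xi.
Proof. by rewrite mulr_ge0// addr_ge0// dot_ge0. Qed.

Lemma measurable_energy m (f a b : R -> 'rV[R]_m) : fourier f a b ->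
  measurable_fun setT (energy a b).
Proof.
move=> /fourier_measurable[ma mb]; apply: measurable_funM.
  exact: normr_measurable.
by apply: measurable_funD; exact: measurable_sqn.
Qed.

Definition scales (rho : R) (j : nat) : R := rho * 2 ^+ j.

Definition multibump (rho : R) (J : nat) (xi : R) : R :=
  \sum_(j < J) xbumpr (scales rho j) xi.

Lemma scales_gt0 rho j : 0 < rho -> 0 < scales rho j.
Proof. by move=> r0; rewrite mulr_gt0// exprn_gt0. Qed.

Lemma scales_le rho i j : 0 < rho -> (i <= j)%N -> scales rho i <= scales rho j.
Proof. by move=> r0 ij; rewrite ler_pM2l// ler_weXn2l//; lra. Qed.

Lemma smooth_multibump rho J : smooth (multibump rho J).
Proof. by apply: smooth_sum => i; exact: smooth_xbumpr. Qed.

(** Each bump is nonzero only strictly between its scale and the next one, so at most one term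
    survives. *)
Lemma multibump_cases rho J xi : 0 < rho -> multibump rho J xi = 0 \/
  exists j : 'I_J, scales rho j < xi < 2 * scales rho j /\
    multibump rho J xi = xbumpr (scales rho j) xi.
Proof.
move=> r0; have [[j hj]|hn] := pselect (exists j : 'I_J, xbumpr (scales rho j) xi != 0).
  right; exists j; have /andP[j1 j2] := xbumpr_neq0 (scales_gt0 j r0) hj.
  split; first by rewrite j1.
  rewrite /multibump (bigD1 j)//= big1 ?addr0// => i ij.
  apply/eqP; apply: contraTT isT => hi; exfalso.
  have /andP[i1 i2] := xbumpr_neq0 (scales_gt0 i r0) hi.
  have : (i != j :> nat) by []; rewrite neq_ltn => /orP[] lt.
    have := scales_le r0 lt; rewrite /scales exprS; move: i2 j1; rewrite /scales.
    move: (2 ^+ i) (2 ^+ j) => p q; lra.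
  have := scales_le r0 lt; rewrite /scales exprS; move: i1 j2; rewrite /scales.
  by move: (2 ^+ i) (2 ^+ j) => p q; lra.
left; rewrite /multibump big1// => i _; apply/eqP.
by apply: contrapT => /negP hi; apply: hn; exists i.
Qed.

Lemma supported_multibump rho J : 0 < rho ->
  supported (multibump rho J) rho (scales rho J).
Proof.
move=> r0 xi; have [->|[j [/andP[j1 j2] _]] _] := multibump_cases J xi r0.
  by rewrite eqxx.
have h1 : rho <= scales rho j by have := scales_le r0 (leq0n j); rewrite {1}/scales expr0 mulr1.
have h2 := scales_le r0 (ltn_ord j).
have h3 : scales rho j.+1 = 2 * scales rho j by rewrite /scales exprS; ring.
by apply/andP; split; lra.
Qed.

Lemma osc_multibump rho J (y x : R) : 0 < rho ->
  osc (multibump rho J) (0 + pi / 2) (x - y) = \sum_(j < J) kern (scales rho j) y x.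
Proof.
move=> r0; rewrite /osc /multibump; under eq_Rintegral do rewrite mulr_suml.
rewrite Rintegral_sum// => j; apply: intble_wave.
apply: continuous_supported_intble (supported_xbumpr (scales_gt0 j r0)).
exact/smooth_continuous/smooth_xbumpr.
Qed.

(** Weighted Young inequality C |z| <= lam xi z^2 / 2 + C^2 / (2 lam xi) under the integral. The
    second part costs C^2 / lam per scale s, because 1 / xi <= 1 / s on an interval of length s. The
    weight lam stays free for later balancing. *)
Lemma multibump_upper : exists2 C : R, 0 < C &
  forall m (f a b : R -> 'rV[R]_m) (i : 'I_m) (rho lam y : R) (J : nat),
    fourier f a b -> 0 < rho -> 0 < lam -> intble (energy a b) ->
  `|\int[mu]_(x in setT) (f x ord0 i * osc (multibump rho J) (0 + pi / 2) (x - y))|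
   <= lam / 2 * \int[mu]_(xi in setT) energy a b xi + J%:R * C / lam.
Proof.
have [C C0 hC] := @osc_bumpr_bounds R.
exists (C ^+ 2); first by rewrite exprn_gt0.
move=> m f a b i rho lam y J fab r0 l0 iE.
have [ia ib ->] := fourier_pairing i y fab r0 (@smooth_multibump rho J)
  (supported_multibump (J := J) r0).
pose U xi := lam / 2 * energy a b xi + \sum_(j < J) C ^+ 2 / lam / scales rho j *
  \1_(`[scales rho j, 2 * scales rho j]%classic : set R) xi.
have iI j : intble (fun xi => C ^+ 2 / lam / scales rho j *
    \1_(`[scales rho j, 2 * scales rho j]%classic : set R) xi).
  by apply: intbleZ; exact: intble_indic.
have iU : intble U.
  by apply: intbleD; [exact: intbleZ|apply: intble_sum => j; exact: iI].
have UE : \int[mu]_(xi in setT) U xi =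
    lam / 2 * \int[mu]_(xi in setT) energy a b xi + J%:R * C ^+ 2 / lam.
  rewrite RintegralD//; [|exact: intbleZ|by apply: intble_sum => j; exact: iI].
  rewrite RintegralZl// Rintegral_sum//; congr (_ + _).
  rewrite (eq_bigr (fun=> C ^+ 2 / lam)).
    rewrite sumr_const card_ord -[LHS]mulr_natl.
    by rewrite mulrA.
  move=> j _; have s0 := scales_gt0 j r0.
  rewrite RintegralZl//; last exact: intble_indic.
  rewrite Rintegral_indic_itv; last lra.
  by field; rewrite !gt_eqF.
rewrite -UE; apply: (le_trans (le_normr_Rintegral measurableT (intbleD ia ib))).
apply: le_Rintegral => //; first exact: intble_norm (intbleD ia ib).
move=> xi _.
have U0 : 0 <= U xi.
  rewrite /U addr_ge0//.
    by rewrite mulr_ge0 ?energy_ge0// divr_ge0// ltW.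
  apply: sumr_ge0 => j _; have s0 := scales_gt0 j r0.
  by rewrite mulr_ge0 ?indicE ?ler0n// !divr_ge0 ?(ltW s0) ?(ltW l0) ?sqr_ge0.
rewrite /psic /psis; have [->|[j [/andP[j1 j2] ->]]] := multibump_cases J xi r0.
  by rewrite !mul0r !mulr0 addr0 normr0.
have s0 := scales_gt0 j r0.
have [_ hb _ _] := hC (scales rho j) 0 s0.
have xi0 : 0 < xi by exact: lt_trans j1.
set A := a xi ord0 i; set B := b xi ord0 i.
set p := xbumpr _ _.
have hp (c : R) : `|c| <= 1 -> forall z : R, `|z * (p * c)| <= `|z| * C.
  move=> c1 z; rewrite [leLHS]normrM ler_wpM2l// [leLHS]normrM -[C]mulr1 ler_pM//; exact: hb.
have cos1 (z : R) : `|cos z| <= 1 by rewrite ler_norml cos_geN1 cos_le1.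
have sin1 (z : R) : `|sin z| <= 1 by rewrite ler_norml sin_geN1 sin_le1.
apply: (le_trans (ler_normD _ _)).
apply: (le_trans (lerD (hp _ (cos1 _) _) (hp _ (sin1 _) _))).
have amgm (z : R) : `|z| * C <= lam / 2 * (xi * z ^+ 2) + C ^+ 2 / lam / xi / 2.
  rewrite -[z ^+ 2]ger0_norm ?sqr_ge0// normrX.
  move: (`|z|) => {}z; rewrite -subr_ge0.
  have -> : lam / 2 * (xi * z ^+ 2) + C ^+ 2 / lam / xi / 2 - z * C =
    (lam * xi * z - C) ^+ 2 / (2 * lam * xi) by field; rewrite !gt_eqF.
  by rewrite divr_ge0 ?sqr_ge0// !mulr_ge0// ltW.
apply: (le_trans (lerD (amgm A) (amgm B))).
have e1 : xi * A ^+ 2 + xi * B ^+ 2 <= energy a b xi.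
  rewrite /energy gtr0_norm// -mulrDr ler_pM2l//.
  by apply: lerD; exact: sqr_le_sqn.
have e2 : C ^+ 2 / lam / xi <= \sum_(j < J) C ^+ 2 / lam / scales rho j *
  \1_(`[scales rho j, 2 * scales rho j]%classic : set R) xi.
  rewrite (bigD1 j)//= indicE mem_set/=; last by rewrite in_itv/= !ltW.
  rewrite mulr1; apply: (@le_trans _ _ (C ^+ 2 / lam / scales rho j)).
    rewrite ler_wpM2l ?divr_ge0 ?sqr_ge0 ?(ltW l0)// lef_pV2 ?posrE//.
    exact: ltW.
  rewrite lerDl; apply: sumr_ge0 => k _; have sk := scales_gt0 k r0.
  by rewrite mulr_ge0 ?indicE ?ler0n// !divr_ge0 ?(ltW sk) ?(ltW l0) ?sqr_ge0.
have e3 : lam / 2 * (xi * A ^+ 2) + lam / 2 * (xi * B ^+ 2) <= lam / 2 * energy a b xi.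
  by rewrite -mulrDr ler_pM2l// divr_gt0.
rewrite /U; move: e2 e3; set S := \sum_(_ < _) _; set E := _ * energy _ _ _.
by move: (C ^+ 2 / lam / xi) (lam / 2 * (xi * A ^+ 2)) (lam / 2 * (xi * B ^+ 2)) S E
  => t u v S E h1 h2; lra.
Qed.

(* Test the transform against a sum of J bumps at dyadic frequencies between 1/d
   and 1/L, modulated to y. Each of them detects the jump, so the pairing is of
   size J h, whereas the dual weighted norm of the sum is of order sqrt J. *)
Lemma energy_edge : exists2 c : R, 0 < c &
  forall (h d : R) (J : nat), 0 < h -> 0 < d -> exists2 L0 : R, 0 < L0 &
  forall m (f a b : R -> 'rV[R]_m) (i : 'I_m) (y L P Q : R),
    0 < L <= L0 -> fourier f a b -> (forall x, `|f x ord0 i| <= 2) ->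
    edge (fun x => f x ord0 i) y L d P Q -> h <= `|Q - P| ->
    intble (energy a b) ->
  c * h ^+ 2 * J%:R <= \int[mu]_(xi in setT) energy a b xi.
Proof.
have [C1 C10 pairing] := @kern_pairing R.
have [kap kap0 hkap] := @osc_bumpr0_lower R.
have [C2 C20 upper] := multibump_upper.
exists (kap ^+ 2 / (8 * C2)); first by rewrite divr_gt0 ?mulr_gt0 ?exprn_gt0.
move=> h d J h0 d0.
(* Each scale pairs to at least h kap in size; this eta makes its error C1 (eta + eta) half of
   that. *)
pose eta := h * kap / 4 / C1.
have eta0 : 0 < eta by rewrite !divr_gt0// mulr_gt0.
(* The lowest scale then satisfies rho d >= 1 and (rho d)^-1 <= eta, and so do all higher ones. *)
pose rho := (1 + eta^-1) / d.
have ie0 : 0 < eta^-1 by rewrite invr_gt0.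
have rho0 : 0 < rho by rewrite divr_gt0//; lra.
(* Keeps the window invisible, with scale times L at most eta, up to the highest scale. *)
pose L0 := Num.min d (eta / scales rho J).
have sJ := scales_gt0 J rho0.
have L00 : 0 < L0 by rewrite /L0 lt_min d0 divr_gt0.
exists L0 => // m f a b i y L P Q /andP[L_gt0 LL0] fab f2 hedge hPQ iE.
have [mf _ _ _] := fab i.
move: LL0; rewrite le_min => /andP[Ld LJ].
have rhod : rho * d = 1 + eta^-1 by rewrite /rho divfK// gt_eqF.
(* The dual cost J C2 / lam becomes J h kap / 4, half of the lower bound J h kap / 2 of the pairing;
   the other half must come from the energy, which gives the constant kap^2 / (8 C2). *)
pose lam := 4 * C2 / (h * kap).
have hk0 : 0 < h * kap by rewrite mulr_gt0.
have lam0 : 0 < lam by rewrite divr_gt0// mulr_gt0.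
have := upper m f a b i rho lam y J fab rho0 lam0 iE.
have err (j : 'I_J) : intble (fun x => f x ord0 i * kern (scales rho j) y x) /\
    `|\int[mu]_(x in setT) (f x ord0 i * kern (scales rho j) y x) +
     (Q - P) * osc (bumpr (scales rho j)) 0 0| <= h * kap / 2.
  have sj := scales_gt0 j rho0.
  have rs : rho <= scales rho j.
    by have := scales_le rho0 (leq0n j); rewrite {1}/scales expr0 mulr1.
  have sd : rho * d <= scales rho j * d by rewrite ler_pM2r.
  have sd1 : 1 <= scales rho j * d by lra.
  have LLd : 0 < L <= d by rewrite L_gt0.
  have [? le1] := pairing _ _ _ _ _ _ _ mf f2 sj LLd sd1 hedge.
  split=> //; apply: (le_trans le1).
  have b1 : scales rho j * L <= eta.
    apply: (@le_trans _ _ (scales rho J * L)).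
      by rewrite ler_pM2r// scales_le// ltnW.
    by move: LJ; rewrite ler_pdivlMr// mulrC.
  have b2 : (scales rho j * d)^-1 <= eta.
    rewrite -[eta]invrK lef_pV2 ?posrE//; last exact: lt_le_trans sd1.
    by apply: le_trans sd; rewrite rhod lerDr.
  have -> : h * kap / 2 = C1 * (eta + eta) by rewrite /eta; field; rewrite gt_eqF.
  by rewrite ler_pM2l//; exact: lerD.
under eq_Rintegral do rewrite osc_multibump// mulr_sumr.
rewrite Rintegral_sum; last by move=> j; have [] := err j.
set S := \sum_(j < J) _ => hS.
have low : J%:R * (h * kap / 2) <= `|S|.
  pose K := \sum_(j < J) osc (bumpr (scales rho j)) 0 0.
  have hK : J%:R * kap <= K.
    rewrite (_ : J%:R * kap = \sum_(j < J) kap); last first.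
      by rewrite sumr_const card_ord -[RHS]mulr_natl.
    by apply: ler_sum => j _; exact/hkap/scales_gt0.
  have hSK : `|S + (Q - P) * K| <= J%:R * (h * kap / 2).
    rewrite /S /K mulr_sumr -big_split /=; apply: (le_trans (ler_norm_sum _ _ _)).
    rewrite (_ : J%:R * _ = \sum_(j < J) (h * kap / 2)); last first.
      by rewrite sumr_const card_ord -[RHS]mulr_natl.
    by apply: ler_sum => j _; have [] := err j.
  have K0 : 0 <= K by apply: le_trans hK; rewrite mulr_ge0// ltW.
  have h1 : J%:R * (h * kap) <= `|(Q - P) * K|.
    rewrite normrM (ger0_norm K0) mulrCA; apply: ler_pM => //; first exact: ltW.
    by rewrite mulr_ge0// ltW.
  have h2 : `|(Q - P) * K| <= `|S + (Q - P) * K| + `|S|.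
    have {1}-> : (Q - P) * K = S + (Q - P) * K - S by ring.
    exact: ler_normB.
  move: h1 h2 hSK; rewrite !mulrA.
  by move: (`|_ * K|) (`|S + _|) (`|S|) (J%:R * h * kap) => ? ? ? ?; lra.
have := le_trans low hS; set X := \int[mu]_(_ in _) _.
have -> : J%:R * C2 / lam = J%:R * (h * kap) / 4.
  by rewrite /lam; field; rewrite !gt_eqF.
have -> : J%:R * (h * kap / 2) = J%:R * (h * kap) / 2 by ring.
move=> h1; have h2 : J%:R * (h * kap) / 4 <= lam / 2 * X.
  by move: h1; move: (lam / 2 * X) (J%:R * (h * kap)) => u v; lra.
have -> : kap ^+ 2 / (8 * C2) * h ^+ 2 * J%:R = (J%:R * (h * kap) / 4) / (lam / 2).
  by rewrite /lam; field; rewrite !gt_eqF.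
by rewrite ler_pdivrMr; [rewrite [leRHS]mulrC|exact: divr_gt0].
Qed.

End EdgeLowerBound.

(** * The two norms: growth at a jump, and comparison over dyadic shells *)

Section NormComparison.
Context {R : realType}.
Notation mu := (@lebesgue_measure R).

(** The number J of dyadic scales is taken so that c h^2 J >= N^2; every admissible pair a, b is
    treated, since the norm is an infimum. Infinite energy leaves nothing to prove. *)
Lemma Hhalf_edge (h d N : R) : 0 < h -> 0 < d -> 0 < N -> exists2 L0 : R, 0 < L0 &
  forall m (f : R -> 'rV[R]_m) (i : 'I_m) (y L P Q : R),
    0 < L <= L0 -> (forall x, `|f x ord0 i| <= 2) ->
    edge (fun x => f x ord0 i) y L d P Q -> h <= `|Q - P| ->
  (N%:E <= Hhalf_norm f)%E.
Proof.
move=> h0 d0 N0; have [c c0 hc] := @energy_edge R.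
have ch0 : 0 < c * h ^+ 2 by rewrite mulr_gt0// exprn_gt0.
have [L0 L00 hL0] := hc h d (Num.truncn (N ^+ 2 / (c * h ^+ 2))).+1 h0 d0.
exists L0 => // m f i y L P Q LL0 f2 fe hPQ.
apply: le_ereal_inf_tmp => _ [a [b [fab ->]]].
have me := measurable_energy fab.
have e0 xi : (0 <= (energy a b xi)%:E)%E by rewrite lee_fin energy_ge0.
set X := (\int[mu]_(xi in setT) _)%E.
have XE : X = (\int[mu]_(xi in setT) (energy a b xi)%:E)%E by [].
have X0 : (0 <= X)%E by rewrite XE; apply: integral_ge0 => xi _.
suff NX : ((N ^+ 2)%:E <= X)%E.
  rewrite -[N]ger0_norm ?(ltW N0)// -sqrtr_sqr -powR12_sqrt ?sqr_ge0// -poweR_EFin.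
  apply: gt0_ler_poweR => //; rewrite in_itv/= ?leey ?andbT//.
  by rewrite lee_fin sqr_ge0.
have [Xoo|Xoo] := ltP X +oo%E; last by rewrite (le_trans _ Xoo)// leey.
have ie : intble (energy a b).
  apply/integrableP; split; first exact/measurable_EFinP.
  have -> : (fun x => `|(EFin \o energy a b) x|)%E = (fun x => (energy a b x)%:E).
    by apply/funext => xi; exact: gee0_abs (e0 xi).
  by rewrite -XE.
have := hL0 m f a b i y L P Q LL0 fab f2 fe hPQ ie.
have -> : X = (\int[mu]_(xi in setT) energy a b xi)%:E.
  by rewrite /Rintegral -XE fineK// ge0_fin_numE.
rewrite lee_fin; apply: le_trans.
rewrite -ler_pdivrMl//; apply: ltW.
by rewrite mulrC; exact: truncnS_gt.
Qed.

(** Enumerates 0, -1, 1, -2, ...: the first 2 J values fill the interval from - J to J - 1, which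
    later makes partial sums over shells telescope. *)
Definition int_of_nat (k : nat) : int := if odd k then Negz k./2 else Posz k./2.
Definition nat_of_int (j : int) : nat :=
  match j with Posz n => n.*2 | Negz n => n.*2.+1 end.

Lemma int_of_nat_bij : set_bij [set: nat] [set: int] int_of_nat.
Proof.
rewrite setTT_bijective; exists nat_of_int => [k|[n|n]] /=.
- by rewrite -[RHS]odd_double_half /int_of_nat; case: (odd k).
- by rewrite /int_of_nat odd_double doubleK.
- by rewrite /int_of_nat /= odd_double /= uphalf_double.
Qed.

Lemma esum_int (u : int -> \bar R) : (forall j, 0 <= u j)%E ->
  (esum [set: int] u = \sum_(k <oo) u (int_of_nat k))%E.
Proof.
by move=> u0; rewrite (reindex_esum _ _ _ _ int_of_nat_bij) nneseries_esumT.
Qed.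

Lemma measurable_shell (j : int) : measurable (dyadic_shell j : set R).
Proof.
have -> : dyadic_shell j = (fun x : R => `|x|) @^-1` `[(2 : R) ^ j, 2 ^ (j + 1)[%classic.
  by apply/seteqP; split=> x; rewrite /dyadic_shell /= in_itv.
rewrite -[X in measurable X]setTI.
by apply: normr_measurable => //; exact: measurable_itv.
Qed.

(** The index of the shell of x is the floor of the binary logarithm of |x|. *)
Lemma shell_bigcup : \bigcup_k dyadic_shell (int_of_nat k) = [set~ (0 : R)].
Proof.
have two0 (z : int) : (0 : R) < 2 ^ z by exact: exprz_gt0.
apply/seteqP; split=> x /=.
  move=> [k _] /andP[h _]; apply/eqP; rewrite -normr_gt0; exact: lt_le_trans h.
move=> /eqP x0; have nx : 0 < `|x| by rewrite normr_gt0.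
have l2 : (0 : R) < ln 2 by rewrite ln_gt0//; lra.
pose j := Num.floor (ln `|x| / ln 2).
have [_ _ surj] := int_of_nat_bij.
have [k _ kj] := surj j I; exists k => //; rewrite kj.
have xE : `|x| = 2 `^ (ln `|x| / ln 2).
  by rewrite /powR gt_eqF//= divfK ?gt_eqF// lnK// posrE.
rewrite /dyadic_shell /= -!powR_intmul// {1 2}xE.
have /andP[h1 h2] := floor_itv (ln `|x| / ln 2).
apply/andP; split; first by rewrite ler_powR//; lra.
rewrite [ltRHS]/powR [ltLHS]/powR gt_eqF//= ltr_expR ltr_pM2r//.
Qed.

Lemma shell_trivIset : trivIset setT (fun k => dyadic_shell (int_of_nat k) : set R).
Proof.
apply/trivIsetP => k l _ _ kl; apply/seteqP; split=> // x [/= /andP[a1 a2] /andP[b1 b2]].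
have inj : int_of_nat k != int_of_nat l.
  apply: contra kl => /eqP kl; apply/eqP; have [_ inj _] := int_of_nat_bij.
  by apply: inj kl; rewrite inE.
have mono (i j : int) : i < j -> (2 : R) ^ (i + 1) <= 2 ^ j.
  by move=> ij; rewrite ler_eXz2l ?ltr1n// lezD1.
move: inj; rewrite neq_lt => /orP[|] /mono h.
  by move: (lt_le_trans a2 (le_trans h b1)); rewrite ltxx.
by move: (lt_le_trans b2 (le_trans h a1)); rewrite ltxx.
Qed.

Lemma integral_shells (u : R -> R) : measurable_fun setT u -> (forall x, 0 <= u x) ->
  (\int[mu]_(x in setT) (u x)%:E =
   \sum_(k <oo) \int[mu]_(x in (dyadic_shell (int_of_nat k) : set R)) (u x)%:E)%E.
Proof.
move=> mu_ u0; rewrite -ge0_integral_bigcup//.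
- rewrite shell_bigcup -[in LHS](setvU [set (0 : R)]) ge0_integral_setU//=.
  + by rewrite integral_set1 adde0.
  + exact: measurableC.
  + by rewrite setvU; exact/measurable_EFinP.
  + by move=> x _; rewrite lee_fin.
  + by apply/disj_setPS => x /= [].
- by move=> k; exact: measurable_shell.
- by rewrite shell_bigcup; apply/measurable_EFinP/measurable_funTS.
- by move=> x _; rewrite lee_fin.
- exact: shell_trivIset.
Qed.

(** On shell j the weight |xi| is below 2^(j+1), so the energy there is at most 2 c_j^2 with c_j the
    Besov term. Each c_j is at most the sum S, hence the total is at most 2 S^2; the factor sqrt 2
    is rounded up to 2. *)
Lemma Hhalf_le_Bhalf m (f : R -> 'rV[R]_m) :
  ((2^-1)%:E * Hhalf_norm f <= Bhalf_norm f)%E.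
Proof.
apply: le_ereal_inf_tmp => _ [a [b [fab ->]]].
set c := (fun j : int => (_ * _)%E).
have c0 j : (0 <= c j)%E by rewrite /c mule_ge0// ?lee_fin ?powR_ge0// poweR_ge0.
set S := esum _ _.
have S0 : (0 <= S)%E by apply: esum_ge0 => j _; exact: c0.
have [Soo|Soo] := ltP S +oo%E; last by rewrite (le_trans _ Soo)// leey.
have HX : (Hhalf_norm f <= poweR (\int[mu]_(xi in setT) (energy a b xi)%:E) 2^-1)%E.
  by apply: ereal_inf_lbound; exists a, b.
have cS j : (c j <= S)%E.
  by apply: esum_ge; exists [set j]; rewrite ?fsbig_set1//; split.
have mab : measurable_fun setT (fun xi => sqn (a xi) + sqn (b xi)).
  have [ma mb] := fourier_measurable fab.
  by apply: measurable_funD; exact: measurable_sqn.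
have sq0 xi : 0 <= sqn (a xi) + sqn (b xi) by rewrite addr_ge0// dot_ge0.
pose I j := (\int[mu]_(x in (dyadic_shell j : set R)) (sqn (a x) + sqn (b x))%:E)%E.
have I0 j : (0 <= I j)%E by apply: integral_ge0 => x _; rewrite lee_fin.
have cc j : (c j * c j = (2 ^ j)%:E * I j)%E.
  rewrite /c -/(I j) muleACA -EFinM -powRD; last by apply/implyP; rewrite pnatr_eq0.
  rewrite -splitr powR_intmul//; congr (_ * _)%E.
  case: (I j) (I0 j) => [r|//|//].
    rewrite lee_fin => r0; rewrite poweR_EFin powR12_sqrt// -EFinM -expr2.
    by rewrite sqr_sqrtr.
  by rewrite poweRyr ?invr_eq0// mulyy.
have shell_le j : (\int[mu]_(x in (dyadic_shell j : set R)) (energy a b x)%:E <= 2%:E * (S * c j))%E.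
  have two0 (z : int) : (0 : R) < 2 ^ z by exact: exprz_gt0.
  apply: (@le_trans _ _ (\int[mu]_(x in (dyadic_shell j : set R))
      ((2 ^ (j + 1))%:E * (sqn (a x) + sqn (b x))%:E))%E).
    apply: ge0_le_integral => //.
    - exact: measurable_shell.
    - by move=> x _; rewrite lee_fin energy_ge0.
    - apply/measurable_EFinP; apply: measurable_funTS; exact: measurable_energy fab.
    - under eq_fun do rewrite -EFinM.
      apply/measurable_EFinP; apply: measurable_funTS.
      by apply: measurable_funM => //; exact: measurable_cst.
    - move=> x /andP[_ /ltW xj]; rewrite -EFinM lee_fin /energy.
      by rewrite ler_wpM2r.
  rewrite ge0_integralZl_EFin//; first last.
  - exact/ltW.
  - exact/measurable_EFinP/measurable_funTS.
  - by move=> x _; rewrite lee_fin.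
  - exact: measurable_shell.
  rewrite -/(I j) expfzDr ?pnatr_eq0// expr1z mulrC EFinM -muleA -cc.
  by rewrite lee_wpmul2l//; exact: lee_wpmul2r.
have XS : (\int[mu]_(xi in setT) (energy a b xi)%:E <= 2%:E * (S * S))%E.
  rewrite integral_shells; [|exact: measurable_energy fab|exact: energy_ge0].
  have SE : S = (\sum_(k <oo) c (int_of_nat k))%E by rewrite /S esum_int.
  rewrite [X in (_ <= _ * (_ * X))%E]SE.
  have Sfin : S = (fine S)%:E by rewrite fineK// ge0_fin_numE.
  rewrite Sfin muleA -EFinM -nneseriesZl//.
  apply: lee_nneseries => k _; first last.
    by rewrite EFinM -Sfin -muleA; exact: shell_le.
  by move=> _; apply: integral_ge0 => x _; rewrite lee_fin energy_ge0.
have Sfin : S = (fine S)%:E by rewrite fineK// ge0_fin_numE.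
have s0 : 0 <= fine S by rewrite fine_ge0.
have HS : (Hhalf_norm f <= (2 * fine S)%:E)%E.
  apply: (le_trans HX).
  rewrite -[2 * fine S]ger0_norm ?mulr_ge0// -sqrtr_sqr -powR12_sqrt ?sqr_ge0//.
  rewrite -poweR_EFin; apply: gt0_ler_poweR => //.
  - rewrite in_itv/= leey andbT; apply: integral_ge0 => x _.
    by rewrite lee_fin energy_ge0.
  - by rewrite in_itv/= leey andbT lee_fin sqr_ge0.
  apply: (le_trans XS); rewrite Sfin -!EFinM lee_fin.
  rewrite exprMn -expr2; have := sqr_ge0 (fine S); lra.
rewrite Sfin; have -> : (fine S)%:E = ((2^-1)%:E * (2 * fine S)%:E)%E.
  by rewrite -EFinM mulKf.
by apply: lee_wpmul2l => //; rewrite lee_fin.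
Qed.

End NormComparison.

(** * The Fourier transform of a bounded integrable function *)

Section FourierL1.
Context {R : realType}.
Notation mu := (@lebesgue_measure R).
Implicit Types (g psi : R -> R).

Lemma continuous_osc_L1 g k : intble g -> continuous (osc g k).
Proof.
move=> ig x.
have ox : x \in (`]x - 1, x + 1[%classic : set R) by rewrite inE /= in_itv/=; lra.
have h1 (z : R) : (`]x - 1, x + 1[%classic : set R) z ->
  mu.-integrable setT (EFin \o (fun y => g y * cos (z * y + k))).
  by move=> _; exact: intble_wave.
have h2 : {ae mu, forall y, [set: R] y ->
    {in (`]x - 1, x + 1[%classic : set R), continuous (fun z : R => g y * cos (z * y + k))}}.
  apply: aeW => y _ z _.
  have := smooth_continuous (smoothZ (c := g y) (smooth_comp smooth_cos (@smooth_affine _ y k))).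
  by under eq_fun do rewrite [y * _]mulrC; exact.
have h3 (z : R) : (`]x - 1, x + 1[%classic : set R) z ->
  {ae mu, forall y, [set: R] y -> `|g y * cos (z * y + k)| <= `|g y|}.
  move=> _; apply: aeW => y _; rewrite normrM -[leRHS]mulr1 ler_wpM2l//.
  by rewrite ler_norml cos_geN1 cos_le1.
exact: (@continuity_under_integral R _ _ mu (fun z y => g y * cos (z * y + k)) setT
  measurableT _ _ h1 h2 _ (intble_norm ig) h3 x ox).
Qed.

Lemma EFin_Rintegral g : intble g ->
  (\int[mu]_(x in setT) (g x)%:E = (\int[mu]_(x in setT) g x)%:E)%E.
Proof. by move=> ig; rewrite /Rintegral fineK//; exact: integrable_fin_num ig. Qed.

Lemma osc_L1_le g k x : intble g -> `|osc g k x| <= \int[mu]_(y in setT) `|g y|.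
Proof.
move=> ig; apply: (le_trans (le_normr_Rintegral measurableT (intble_wave k x ig))).
apply: le_Rintegral => //; [exact/intble_norm/intble_wave|exact: intble_norm|].
move=> y _; rewrite normrM -[leRHS]mulr1 ler_wpM2l//.
by rewrite ler_norml cos_geN1 cos_le1.
Qed.

(** Fubini: the kernel cos(x xi + k) is symmetric in x and xi, and the integrand is dominated by
    |g(x)| |psi(xi)|. *)
Lemma osc_duality g psi (k : R) : intble g -> intble psi ->
  \int[mu]_(xi in setT) (osc g k xi * psi xi) = \int[mu]_(x in setT) (g x * osc psi k x).
Proof.
move=> ig ip.
have mg := intble_measurable ig; have mp := intble_measurable ip.
pose f (z : R * R) := (g z.2 * cos (z.1 * z.2 + k) * psi z.1)%:E.
have mf : measurable_fun setT f.
  apply/measurable_EFinP; apply: measurable_funM; last first.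
    by apply: measurableT_comp => //; exact: measurable_fst.
  apply: measurable_funM.
    by apply: measurableT_comp => //; exact: measurable_snd.
  apply: measurableT_comp.
    exact: continuous_measurable_fun (smooth_continuous smooth_cos).
  apply: measurable_funD; last exact: measurable_cst.
  by apply: measurable_funM; [exact: measurable_fst|exact: measurable_snd].
have fi : (mu \x mu)%E.-integrable setT f.
  apply/integrable12ltyP => //.
  pose G := \int[mu]_(y in setT) `|g y|.
  apply: (@le_lt_trans _ _ (\int[mu]_x (G * `|psi x|)%:E)%E); last first.
    by rewrite EFin_Rintegral ?ltry//; exact/intbleZ/intble_norm.
  apply: ge0_le_integral => //.
  - by move=> x _; apply: integral_ge0.
  - apply: (@measurable_fun_fubini_tonelli_F _ _ _ _ _ mu (fun z => `|f z|%E)) => //.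
    exact: measurableT_comp.
  - apply/measurable_EFinP; apply: measurable_funM; first exact: measurable_cst.
    exact: measurableT_comp.
  - move=> x _; rewrite /G mulrC -RintegralZl//; last exact: intble_norm.
    rewrite -EFin_Rintegral; last exact/intbleZ/intble_norm.
    apply: ge0_le_integral => //.
    + have mfx : measurable_fun setT (fun y => g y * cos (x * y + k) * psi x).
        by apply: measurable_funM; [exact: intble_measurable (intble_wave k x ig)|
          exact: measurable_cst].
      have := measurableT_comp (@normr_measurable R setT) mfx.
      by move=> /measurable_EFinP.
    + apply/measurable_EFinP; apply: measurable_funM; first exact: measurable_cst.
      exact: measurableT_comp.
    + move=> y _; rewrite /f /= lee_fin normrM mulrC ler_wpM2l//.
      rewrite normrM -[leRHS]mulr1 ler_wpM2l//.
      by rewrite ler_norml cos_geN1 cos_le1.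
have := Fubini fi.
under eq_integral => xi _.
  rewrite /f /= EFin_Rintegral; last first.
    have -> : (fun y => g y * cos (xi * y + k) * psi xi) =
      (fun y => psi xi * (g y * cos (xi * y + k))) by apply/funext => y; rewrite mulrC.
    by apply: intbleZ; exact: intble_wave.
  rewrite RintegralZr//; last exact: intble_wave.
  over.
under [X in _ = X -> _]eq_integral => x _.
  have e : (fun xi => g x * cos (xi * x + k) * psi xi) =
      (fun xi => g x * (psi xi * cos (x * xi + k))).
    by apply/funext => xi; rewrite [x * _]mulrC; ring.
  rewrite /f /= EFin_Rintegral e; last by apply: intbleZ; exact: intble_wave.
  rewrite RintegralZl//; last exact: intble_wave.
  over.
by rewrite /Rintegral => ->.
Qed.

(** The phase pi / 2 gives - sin, the imaginary part of e^{- i x xi}; the duality of [fourier] is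
    then [osc_duality]. *)
Lemma fourier_L1 m (g : R -> 'rV[R]_m) (K : R) :
  (forall i, intble (fun x => g x ord0 i)) -> (forall x i, `|g x ord0 i| <= K) ->
  fourier g (fun xi => \row_i osc (fun x => g x ord0 i) 0 xi)
            (fun xi => \row_i osc (fun x => g x ord0 i) (pi / 2) xi).
Proof.
move=> ig gK mu_ i; rewrite {}/mu_; set gi := fun x => g x ord0 i.
have oi (k r M : R) : mu.-integrable [set xi | r <= `|xi| <= M] (EFin \o osc gi k).
  apply: measurable_bounded_integrable.
  - exact: measurable_annulus.
  - apply: (@le_lt_trans _ _ (mu `[- M, M])).
      apply: le_measure; rewrite ?inE; [exact: measurable_annulus|exact: measurable_itv|].
      by move=> x /andP[_]; rewrite ler_norml /= in_itv.
    by rewrite lebesgue_measure_itv/=; case: ifPn; rewrite ?ltry.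
  - apply: measurable_funTS; apply: continuous_measurable_fun.
    exact: continuous_osc_L1 (ig i).
  - exists (\int[mu]_(y in setT) `|gi y|); split; first exact: num_real.
    by move=> x Mx y _ /=; rewrite (le_trans _ (ltW Mx))//; exact: osc_L1_le (ig i).
split=> //.
- exact: intble_measurable (ig i).
- by exists K.
- move=> r M r0; split.
    rewrite (_ : (fun xi => _) = EFin \o osc gi 0); first exact: oi.
    by apply/funext => xi; rewrite mxE.
  rewrite (_ : (fun xi => _) = EFin \o osc gi (pi / 2)); first exact: oi.
  by apply/funext => xi; rewrite mxE.
move=> psi [sp [r [M [r0 hr]]]].
have pM : supported psi (- M) M.
  by move=> xi /hr /andP[_]; rewrite ler_norml.
have ip := continuous_supported_intble (smooth_continuous sp) pM.
split.
  transitivity (\int[mu]_(xi in setT) (osc gi 0 xi * psi xi)).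
    by apply: eq_Rintegral => xi _; rewrite mxE.
  rewrite (osc_duality 0 (ig i) ip); apply: eq_Rintegral => x _.
  by rewrite osc_cos.
transitivity (\int[mu]_(xi in setT) (osc gi (pi / 2) xi * psi xi)).
  by apply: eq_Rintegral => xi _; rewrite mxE.
rewrite (osc_duality _ (ig i) ip).
set q := fun x => gi x * \int[mu]_(xi in setT) (psi xi * sin (x * xi)).
have iq : intble q.
  have io := intble_osc (- (pi / 2)) sp pM.
  have -> : q = (fun x => osc psi (- (pi / 2)) x * gi x).
    by apply/funext => x; rewrite osc_sin mulrC.
  apply: (@intbleM_bounded _ _ _ K) => //.
    exact: intble_measurable (ig i).
  by move=> x; exact: gK.
rewrite -[RHS]mulN1r -(RintegralZl (-1) measurableT iq).
apply: eq_Rintegral => x _; rewrite mulN1r /q -mulrN; congr (_ * _).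
have iw : intble (fun xi => psi xi * sin (x * xi)).
  have -> : (fun xi => psi xi * sin (x * xi)) = (fun xi => psi xi * cos (x * xi + - (pi / 2))).
    by apply/funext => xi; rewrite -[in LHS](subrK (pi / 2) (x * xi)) sinDpihalf.
  exact: intble_wave.
rewrite -[RHS]mulN1r -RintegralZl//; apply: eq_Rintegral => xi _.
by rewrite cosDpihalf mulN1r mulrN.
Qed.

End FourierL1.

(** * A scale invariant upper bound for the Besov norm *)

Section BesovUpperBound.
Context {R : realType}.
Notation mu := (@lebesgue_measure R).

Definition sigm (y : R) : R := y / (1 + y).

(* The increments of [sigm] dominate the dyadic samples of [y / (1 + y^2)], so the
   sum over all shells telescopes. *)
Lemma sigm_incr (y : R) : 0 < y -> y / (1 + y ^+ 2) <= 7 / 2 * (sigm (2 * y) - sigm y).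
Proof.
move=> y0; rewrite /sigm.
have -> : 7 / 2 * (2 * y / (1 + 2 * y) - y / (1 + y)) =
  y * (7 / 2 / ((1 + 2 * y) * (1 + y))) by field; rewrite !gt_eqF//; lra.
have y2 := sqr_ge0 y; have y12 := sqr_ge0 (1 - y).
rewrite ler_pM2l// ler_pdivlMr ?mulr_gt0//; try lra.
rewrite mulrC ler_pdivrMr; last lra.
have -> : (1 + 2 * y) * (1 + y) = 1 + 3 * y + 2 * y ^+ 2 by ring.
have e : (1 - y) ^+ 2 = 1 - 2 * y + y ^+ 2 by ring.
rewrite e in y12; move: (y ^+ 2) y2 y12 => q q0 h; lra.
Qed.

(** Doubling the argument raises the exponent by one, and the enumeration adds at each step one
    exponent at the top and one at the bottom. *)
Lemma sigm_telescope (l : R) (J : nat) :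
  \sum_(k < J.*2) (sigm (2 * (l * 2 ^ int_of_nat k)) - sigm (l * 2 ^ int_of_nat k)) =
  sigm (l * 2 ^ J) - sigm (l * 2 ^ (- J%:Z)).
Proof.
have two0 : (2 : R) != 0 by rewrite pnatr_eq0.
elim: J => [|J ih]; first by rewrite big_ord0 oppr0 subrr.
rewrite doubleS !big_ord_recr /= ih.
have -> : int_of_nat J.*2 = J by rewrite /int_of_nat odd_double doubleK.
have -> : int_of_nat J.*2.+1 = Negz J.
  by rewrite /int_of_nat /= odd_double /= uphalf_double.
have e1 : 2 * (l * 2 ^ J) = l * 2 ^ J.+1%:Z :> R.
  by rewrite -[J.+1]addn1 PoszD expfzDr// expr1z; ring.
have e2 : 2 * (l * 2 ^ Negz J) = l * 2 ^ (- J%:Z) :> R.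
  have -> : - J%:Z = Negz J + 1 by rewrite NegzE -addn1 PoszD opprD subrK.
  by rewrite expfzDr// expr1z; ring.
by rewrite e1 e2 -NegzE; ring.
Qed.

Lemma sigm_ge0 (y : R) : 0 <= y -> 0 <= sigm y.
Proof. by move=> y0; rewrite divr_ge0//; lra. Qed.

Lemma sigm_le1 (y : R) : 0 <= y -> sigm y <= 1.
Proof. by move=> y0; rewrite ler_pdivrMr; lra. Qed.

Lemma sum_shells (l : R) (J : nat) : 0 < l ->
  \sum_(k < J.*2) (l * 2 ^ int_of_nat k) / (1 + (l * 2 ^ int_of_nat k) ^+ 2) <= 7 / 2.
Proof.
move=> l0; have two0 (z : int) : (0 : R) < 2 ^ z by exact: exprz_gt0.
apply: (@le_trans _ _ (7 / 2 *
  \sum_(k < J.*2) (sigm (2 * (l * 2 ^ int_of_nat k)) - sigm (l * 2 ^ int_of_nat k)))).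
  by rewrite mulr_sumr; apply: ler_sum => k _; apply: sigm_incr; rewrite mulr_gt0.
rewrite sigm_telescope -[leRHS]mulr1 ler_wpM2l//.
have a1 : sigm (l * 2 ^ J) <= 1 by rewrite sigm_le1// mulr_ge0// ltW.
have a2 : 0 <= sigm (l * 2 ^ (- J%:Z)) by rewrite sigm_ge0// mulr_ge0// ltW.
lra.
Qed.

Lemma shell_measure_le (j : int) :
  (mu (dyadic_shell j) <= (4 * 2 ^ j)%:E)%E.
Proof.
have two0 (z : int) : (0 : R) < 2 ^ z by exact: exprz_gt0.
apply: (@le_trans _ _ (mu `[- 2 ^ (j + 1), 2 ^ (j + 1)])).
  apply: le_measure; rewrite ?inE; [exact: measurable_shell|exact: measurable_itv|].
  by move=> x /andP[_ /ltW]; rewrite ler_norml /= in_itv.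
rewrite lebesgue_measure_itv/=; case: ifPn => _.
  rewrite -EFinB lee_fin expfzDr ?pnatr_eq0// expr1z.
  by move: (2 ^ j) => p; lra.
by rewrite lee_fin mulr_ge0// ltW.
Qed.

(** The shell has measure at most 4 * 2^j and the integrand is at most 2 m D^2; the square root of 8
    m is bounded by 3 (m + 1), and the two factors 2^(j/2) combine to 2^j. *)
Lemma shell_term_le m (a b : R -> 'rV[R]_m) (j : int) (D : R) : 0 <= D ->
  (forall xi i, 2 ^ j <= `|xi| -> `|a xi ord0 i| <= D /\ `|b xi ord0 i| <= D) ->
  measurable_fun setT (fun xi => sqn (a xi) + sqn (b xi)) ->
  ((2 `^ (j%:~R / 2))%:E *
     poweR (\int[mu]_(xi in (dyadic_shell j : set R)) (sqn (a xi) + sqn (b xi))%:E) 2^-1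
   <= (3 * m.+1%:R * (2 ^ j * D))%:E)%E.
Proof.
move=> D0 hD mab; have two0 (z : int) : (0 : R) < 2 ^ z by exact: exprz_gt0.
have sq_le (v : R -> 'rV[R]_m) xi : (forall i, `|v xi ord0 i| <= D) -> sqn (v xi) <= m%:R * D ^+ 2.
  move=> hv; rewrite /sqn /dot (_ : m%:R * _ = \sum_(i < m) D ^+ 2); last first.
    by rewrite sumr_const card_ord -[RHS]mulr_natl.
  apply: ler_sum => i _; rewrite -expr2 -[leLHS]ger0_norm ?sqr_ge0// normrX.
  by rewrite lerXn2r// nnegrE.
set p := 2 `^ (j%:~R / 2).
have p0 : 0 <= p by exact: powR_ge0.
have pp : p ^+ 2 = 2 ^ j.
  rewrite expr2 /p -powRD; last by apply/implyP; rewrite pnatr_eq0.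
  by rewrite -splitr powR_intmul.
have hI : (\int[mu]_(xi in (dyadic_shell j : set R)) (sqn (a xi) + sqn (b xi))%:E <=
    ((3 * m.+1%:R * (p * D)) ^+ 2)%:E)%E.
  apply: (@le_trans _ _ (\int[mu]_(xi in (dyadic_shell j : set R)) (2 * (m%:R * D ^+ 2))%:E)%E).
    apply: ge0_le_integral => //.
    - exact: measurable_shell.
    - by move=> xi _; rewrite lee_fin addr_ge0// dot_ge0.
    - by apply/measurable_EFinP; apply: measurable_funTS.
    - move=> xi /andP[jx _]; rewrite lee_fin mulr_natl mulr2n.
      by apply: lerD; apply: sq_le => i; have [] := hD xi i jx.
  rewrite integral_cst; last exact: measurable_shell.
  apply: (@le_trans _ _ ((2 * (m%:R * D ^+ 2))%:E * (4 * 2 ^ j)%:E)%E).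
    by apply: lee_wpmul2l; [rewrite lee_fin !mulr_ge0// sqr_ge0|exact: shell_measure_le].
  rewrite -EFinM lee_fin !exprMn pp.
  have -> : 2 * (m%:R * D ^+ 2) * (4 * 2 ^ j) = 8 * m%:R * (2 ^ j * D ^+ 2) by ring.
  apply: ler_wpM2r; first by rewrite mulr_ge0 ?sqr_ge0// ltW.
  have m0 : (0 : R) <= m%:R by rewrite ler0n.
  rewrite -[m.+1%:R]natr1; have := sqr_ge0 (m%:R : R).
  have -> : (m%:R + 1 : R) ^+ 2 = m%:R ^+ 2 + 2 * m%:R + 1 by ring.
  by move: (m%:R ^+ 2) => q q0; lra.
apply: (@le_trans _ _ (p%:E * (3 * m.+1%:R * (p * D))%:E)%E).
  apply: lee_wpmul2l; first by rewrite lee_fin.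
  rewrite -[3 * m.+1%:R * (p * D)]ger0_norm; last by rewrite !mulr_ge0.
  rewrite -sqrtr_sqr -powR12_sqrt ?sqr_ge0// -poweR_EFin.
  apply: gt0_ler_poweR => //.
  - rewrite in_itv/= leey andbT; apply: integral_ge0 => x _.
    by rewrite lee_fin addr_ge0// dot_ge0.
  - by rewrite in_itv/= leey andbT lee_fin sqr_ge0.
by rewrite -EFinM lee_fin -pp expr2 le_eqVlt; apply/orP; left; apply/eqP; ring.
Qed.

(** A piece of amplitude C n and length l n contributes, summed over all shells, at most a multiple
    of C n whatever its length. The tolerance e allows infinite superpositions: it is made small
    after the number of shells is fixed. *)
Lemma Bhalf_upper m (g : R -> 'rV[R]_m) (K Ctot : R) (C l : nat -> R) :
  (forall i, intble (fun x => g x ord0 i)) -> (forall x i, `|g x ord0 i| <= K) ->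
  0 < Ctot -> (forall n, 0 <= C n) -> (forall n, 0 < l n) ->
  (forall N, \sum_(n < N) C n <= Ctot) ->
  (forall e, 0 < e -> exists N, forall i k xi, `|osc (fun x => g x ord0 i) k xi| <=
     \sum_(n < N) C n * (l n / (1 + (l n * xi) ^+ 2)) + e) ->
  (Bhalf_norm g <= (11 * m.+1%:R * Ctot)%:E)%E.
Proof.
move=> ig gK C0 Cn0 l0 CN hosc.
have two0 (z : int) : (0 : R) < 2 ^ z by exact: exprz_gt0.
have fab := fourier_L1 ig gK.
set a := (fun xi => \row_i osc (fun x => g x ord0 i) 0 xi) in fab.
set b := (fun xi => \row_i osc (fun x => g x ord0 i) (pi / 2) xi) in fab.
apply: ge_ereal_inf; eexists; first by exists a, b; split; [exact: fab|reflexivity].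
have mab : measurable_fun setT (fun xi => sqn (a xi) + sqn (b xi)).
  have [ma mb] := fourier_measurable fab.
  by apply: measurable_funD; exact: measurable_sqn.
set c := (fun j : int => (_ * _)%E).
have c0 j : (0 <= c j)%E by rewrite /c mule_ge0// ?lee_fin ?powR_ge0// poweR_ge0.
rewrite esum_int//.
have part J : (\sum_(k < J.*2) c (int_of_nat k) <= (11 * m.+1%:R * Ctot)%:E)%E.
  pose M := \sum_(k < J.*2) (2 : R) ^ int_of_nat k.
  have M0 : 0 <= M by apply: sumr_ge0 => k _; exact: ltW.
  (* The total error M e is at most Ctot / 6, and 3 (7 / 2 + 1 / 6) = 11 is the final constant. *)
  have e0 : 0 < Ctot / 6 / (1 + M) by rewrite !divr_gt0// ltr_pwDl.
  have [N hN] := hosc _ e0; set e := Ctot / 6 / (1 + M) in e0 hN.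
  pose D j := \sum_(n < N) C n * (l n / (1 + (l n * 2 ^ j) ^+ 2)) + e.
  have D0 j : 0 <= D j.
    rewrite addr_ge0 ?(ltW e0)//; apply: sumr_ge0 => n _.
    by rewrite mulr_ge0// divr_ge0 ?(ltW (l0 n))// addr_ge0// sqr_ge0.
  have cD j : (c j <= (3 * m.+1%:R * (2 ^ j * D j))%:E)%E.
    apply: shell_term_le => // xi i jx.
    suff h k : `|osc (fun x => g x ord0 i) k xi| <= D j by rewrite !mxE.
    apply: (le_trans (hN i k xi)); rewrite lerD2r; apply: ler_sum => n _.
    rewrite ler_wpM2l// ler_wpM2l ?(ltW (l0 n))// lef_pV2 ?posrE ?ltr_pwDl ?sqr_ge0//.
    rewrite lerD2l -[leRHS]ger0_norm ?sqr_ge0// normrX normrM.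
    by rewrite lerXn2r ?nnegrE ?mulr_ge0 ?(ltW (two0 _)) ?(ltW (l0 n))// gtr0_norm// ler_wpM2l// ltW.
  apply: (@le_trans _ _ (\sum_(k < J.*2) (3 * m.+1%:R * (2 ^ int_of_nat k * D (int_of_nat k)))%:E)%E).
    by apply: lee_sum => k _; exact: cD.
  rewrite sumEFin lee_fin -mulr_sumr.
  have -> : 11 * m.+1%:R * Ctot = 3 * m.+1%:R * (11 / 3 * Ctot) by field.
  apply: ler_wpM2l; first by rewrite mulr_ge0.
  have -> : \sum_(k < J.*2) 2 ^ int_of_nat k * D (int_of_nat k) =
    \sum_(n < N) C n * (\sum_(k < J.*2) (l n * 2 ^ int_of_nat k) / (1 + (l n * 2 ^ int_of_nat k) ^+ 2))
    + M * e.
    under [in RHS]eq_bigr do rewrite mulr_sumr.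
    rewrite exchange_big /= /M mulr_suml -big_split /=; apply: eq_bigr => k _.
    rewrite /D mulrDr mulr_sumr; congr (_ + _); apply: eq_bigr => n _.
    by move: (2 ^ _) => z; ring.
  have h1 : \sum_(n < N) C n * (\sum_(k < J.*2) (l n * 2 ^ int_of_nat k) / (1 + (l n * 2 ^ int_of_nat k) ^+ 2)) <= 7 / 2 * Ctot.
    apply: (@le_trans _ _ (\sum_(n < N) C n * (7 / 2))).
      by apply: ler_sum => n _; rewrite ler_wpM2l// sum_shells.
    by rewrite -mulr_suml mulrC ler_wpM2l.
  have h2 : M * e <= Ctot / 6.
    apply: (@le_trans _ _ ((1 + M) * e)).
      by apply: ler_wpM2r; [exact: ltW|rewrite lerDr].
    by rewrite mulrC /e divfK// gt_eqF// ltr_pwDl.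
  by move: h1 h2; move: (\sum_(n < N) _) (M * e) => u v; lra.
apply: lime_le; first by apply: is_cvg_nneseries => k _ _; exact: c0.
(* Only partial sums of even length were bounded; the terms are nonnegative and n <= 2 n. *)
near=> n; apply: le_trans (part n).
rewrite -(big_mkord xpredT (fun k => c (int_of_nat k))).
by apply: lee_sum_nneg_natr => //; rewrite -addnn leq_addr.
Unshelve. all: by end_near. Qed.

End BesovUpperBound.

(** * Chain rule and symmetry of second derivatives on the strip *)

Section StripCalculus.
Context {R : realType}.
Implicit Types (f df : R -> R) (u : R -> R -> R).

(** An unordered interval, so that characteristics can be followed in both directions. *)
Definition btw (a b x : R) := a <= x <= b \/ b <= x <= a.

Lemma btw_dist (a b x : R) : btw a b x -> `|x - a| <= `|b - a|.
Proof.
case=> /andP[h1 h2].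
  by rewrite !ger0_norm ?subr_ge0 ?lerD2r// (le_trans h1).
by rewrite !ler0_norm ?subr_le0 ?lerN2 ?lerD2r// (le_trans h1).
Qed.

Lemma btw_norm (a b x T : R) : btw a b x -> `|a| < T -> `|b| < T -> `|x| < T.
Proof.
rewrite !ltr_norml => -[] /andP[h1 h2] /andP[a1 a2] /andP[b1 b2]; apply/andP; split; lra.
Qed.

Lemma mean_value f df (a b : R) : (forall x, btw a b x -> is_derive x 1 f (df x)) ->
  exists2 th, btw a b th & f b - f a = df th * (b - a).
Proof.
wlog ab : a b / a <= b => [H|] fd.
  have [ab|/ltW ba] := leP a b; first exact: H.
  have [|th h1 h2] := H b a ba; first by move=> x [h|h]; apply: fd; [right|left].
  exists th; first by case: h1; [right|left].
  by rewrite -[LHS]opprB h2 -mulrN opprB.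
have h1 x : x \in `]a, b[ -> is_derive x 1 f (df x).
  by rewrite in_itv/= => /andP[/ltW h /ltW h']; apply: fd; left; rewrite h.
have h2 : {within `[a, b], continuous f}.
  apply: derivable_within_continuous => x; rewrite in_itv/= => xab.
  by have [] : is_derive x 1 f (df x) by apply: fd; left.
have [c cab e] := MVT_segment ab h1 h2.
by exists c => //; left; move: cab; rewrite in_itv.
Qed.

Lemma is_derive_eps f (s a : R) :
  (forall e : R, 0 < e -> exists2 del : R, 0 < del & forall z, `|z - s| < del ->
     `|f z - f s - a * (z - s)| <= e * `|z - s|) ->
  is_derive s 1 f a.
Proof.
move=> H; apply/is_derive1_caratheodory.
exists (fun z => if z == s then a else (f z - f s) / (z - s)); split.
- move=> z; case: eqP => [->|/eqP zs]; first by rewrite !subrr mulr0.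
  by rewrite divfK// subr_eq0.
- rewrite /prop_for /continuous_at eqxx; apply/cvgrPdist_le => e e0.
  have [del del0 hd] := H e e0.
  exists del => // z zd; have {}zd : `|z - s| < del by rewrite distrC.
  case: eqP => [_|/eqP zs]; first by rewrite subrr normr0 ltW.
  have zs0 : 0 < `|z - s| by rewrite normr_gt0 subr_eq0.
  rewrite -(ler_pM2r zs0) -normrM mulrBl divfK ?subr_eq0// distrC.
  exact: hd.
- by rewrite eqxx.
Qed.

Lemma continuous2_eps (F : R -> R -> R) (t x : R) :
  {for (t, x), continuous (fun p : R * R => F p.1 p.2)} ->
  forall e : R, 0 < e -> exists2 del : R, 0 < del & forall s z, `|s - t| < del -> `|z - x| < del ->
    `|F s z - F t x| < e.
Proof.
move=> /cvgrPdist_lt cF e e0; have := cF e e0.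
case=> -[A B] /= [[d1 d10 h1] [d2 d20 h2]] AB.
exists (Num.min d1 d2); first by rewrite lt_min d10.
move=> s z; rewrite !lt_min => /andP[s1 _] /andP[_ z2].
rewrite distrC; apply: (AB (s, z)); split=> /=.
  by apply: h1; rewrite /ball_ /= distrC.
by apply: h2; rewrite /ball_ /= distrC.
Qed.

Lemma C1_strip_dt T u (t x : R) : C1_strip T u -> `|t| < T ->
  is_derive t 1 (fun s => u s x) (dt u t x).
Proof. by move=> h tT; have [d _ _ _] := h t x tT; rewrite /dt derive1E; apply/derivableP. Qed.

Lemma C1_strip_dx T u (t x : R) : C1_strip T u -> `|t| < T ->
  is_derive x 1 (u t) (dx u t x).
Proof. by move=> h tT; have [_ d _ _] := h t x tT; rewrite /dx derive1E; apply/derivableP. Qed.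

Lemma is_derive_line (a b s : R) : is_derive s 1 (fun z : R => b + a * z) a.
Proof.
apply: (is_derive_eq (is_deriveD (is_derive_cst b s 1) (is_deriveZ a (is_derive_id s 1)))).
by rewrite add0r /GRing.scale /= mulr1.
Qed.

(** Only partial derivatives are given. The t-increment is taken at a moving abscissa, turned by the
    mean value theorem into a nearby value of [dt u], and compared with the limit by joint
    continuity. *)
Lemma chain_strip T u (t0 x0 al be s : R) : C1_strip T u -> `|t0 + al * s| < T ->
  is_derive s 1 (fun z => u (t0 + al * z) (x0 + be * z))
    (al * dt u (t0 + al * s) (x0 + be * s) + be * dx u (t0 + al * s) (x0 + be * s)).
Proof.
move=> C1 tT; set t := t0 + al * s; set x := x0 + be * s.
pose F1 z := u (t0 + al * z) (x0 + be * z) - u t (x0 + be * z).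
pose F2 z := u t (x0 + be * z).
have d2 : is_derive s 1 F2 (be * dx u t x).
  rewrite mulrC; apply: is_derive1_comp (is_derive_line be x0 s).
  exact: C1_strip_dx C1 tT.
suff d1 : is_derive s 1 F1 (al * dt u t x).
  have -> : (fun z => u (t0 + al * z) (x0 + be * z)) = (fun z => F1 z + F2 z).
    by apply/funext => z; rewrite /F1 /F2 subrK.
  exact: is_deriveD d1 d2.
apply: is_derive_eps => e e0.
have [_ _ cdt _] := C1 t x tT.
have K0 : 0 < 1 + `|al| + `|be| by rewrite ltr_pwDl// ltr_pwDl.
have al0 := normr_ge0 al; have be0 := normr_ge0 be.
have [del del0 hdel] := continuous2_eps cdt (divr_gt0 e0 K0).
pose dd := Num.min (del / (1 + `|al| + `|be|)) ((T - `|t|) / (1 + `|al| + `|be|)).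
have dd0 : 0 < dd by rewrite lt_min !divr_gt0// subr_gt0.
exists dd => // z; rewrite lt_min !ltr_pdivlMr// => /andP[z1 z2].
have zs0 := normr_ge0 (z - s).
have tz : `|(t0 + al * z) - t| <= `|z - s| * (1 + `|al| + `|be|).
  have -> : t0 + al * z - t = (z - s) * al by rewrite /t; ring.
  by rewrite normrM ler_wpM2l//; lra.
have xz : `|(x0 + be * z) - x| <= `|z - s| * (1 + `|al| + `|be|).
  have -> : x0 + be * z - x = (z - s) * be by rewrite /x; ring.
  by rewrite normrM ler_wpM2l//; lra.
have tzT : `|t0 + al * z| < T.
  have := ler_normD (t0 + al * z - t) t; rewrite subrK.
  move: (`|t0 + al * z|) (`|t0 + al * z - t|) tz => p q tz h; lra.
have [th th1 th2] := @mean_value (fun r => u r (x0 + be * z)) (fun r => dt u r (x0 + be * z)) t (t0 + al * z)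
  (fun r hr => C1_strip_dt _ C1 (btw_norm hr tT tzT)).
have -> : F1 z - F1 s - al * dt u t x * (z - s) =
    (dt u th (x0 + be * z) - dt u t x) * (al * (z - s)).
  by rewrite /F1 th2 subrr subr0 /t; ring.
have h : `|dt u th (x0 + be * z) - dt u t x| < e / (1 + `|al| + `|be|).
  apply: hdel; last exact: le_lt_trans xz z1.
  exact: le_lt_trans (le_trans (btw_dist th1) tz) z1.
rewrite !normrM mulrA; apply: ler_wpM2r => //.
apply: (@le_trans _ _ (e / (1 + `|al| + `|be|) * `|al|)).
  by apply: ler_wpM2r => //; exact: ltW.
by rewrite mulrAC ler_pdivrMr// ler_pM2l//; lra.
Qed.

(** The second difference over a small square, expressed by two mean values in either order, equals
    h^2 times a value of each mixed derivative near (t, x). *)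
Lemma schwarz_strip T u (t x : R) : C2_strip T u -> `|t| < T ->
  dt (dx u) t x = dx (dt u) t x.
Proof.
move=> [C1 C1t C1x] tT.
have [_ _ _ cA] := C1t t x tT; have [_ _ cB _] := C1x t x tT.
set A := dx (dt u) in cA *; set B := dt (dx u) in cB *.
apply/eqP; rewrite -subr_eq0 -normr_le0; apply/ler_addgt0Pl => e e0; rewrite addr0.
have e2 : 0 < e / 2 by rewrite divr_gt0.
have [da da0 hA] := continuous2_eps cA e2.
have [db db0 hB] := continuous2_eps cB e2.
pose h := Num.min (Num.min (da / 2) (db / 2)) ((T - `|t|) / 2).
have h0 : 0 < h by rewrite !lt_min !divr_gt0// subr_gt0.
have [hda hdb hT] : [/\ h < da, h < db & h < T - `|t|].
  have : h <= Num.min (Num.min (da / 2) (db / 2)) ((T - `|t|) / 2) by [].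
  rewrite !le_min => /andP[/andP[]] ? ? ?; have : 0 < T - `|t| by rewrite subr_gt0.
  by split; lra.
have thT : `|t + h| < T by apply: (le_lt_trans (ler_normD _ _)); rewrite (gtr0_norm h0); lra.
have bT r : btw t (t + h) r -> `|r| < T by move=> hr; exact: btw_norm hr tT thT.
have near_t r : btw t (t + h) r -> `|r - t| <= h.
  by move=> /btw_dist; rewrite [t + h]addrC addrK (gtr0_norm h0).
have near_x r : btw x (x + h) r -> `|r - x| <= h.
  by move=> /btw_dist; rewrite [x + h]addrC addrK (gtr0_norm h0).
have [t1 t1b e1] := @mean_value (fun s => u s (x + h) - u s x) (fun s => dt u s (x + h) - dt u s x) t (t + h)
  (fun s hs => is_deriveB (C1_strip_dt (x + h) C1 (bT s hs)) (C1_strip_dt x C1 (bT s hs))).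
have [x1 x1b e1'] := @mean_value (dt u t1) (A t1) x (x + h)
  (fun z _ => C1_strip_dx z C1t (bT _ t1b)).
have [x2 x2b e2'] := @mean_value (fun z => u (t + h) z - u t z) (fun z => dx u (t + h) z - dx u t z) x (x + h)
  (fun z _ => is_deriveB (C1_strip_dx z C1 thT) (C1_strip_dx z C1 tT)).
have [t2 t2b e3] := @mean_value (fun s => dx u s x2) (fun s => B s x2) t (t + h)
  (fun s hs => C1_strip_dt x2 C1x (bT s hs)).
clearbody A B; have AB : A t1 x1 = B t2 x2.
  have hx : x + h - x = h by ring.
  have ht : t + h - t = h by ring.
  rewrite /= e1' hx ht in e1; rewrite /= e3 hx ht in e2'.
  have hn : h != 0 by rewrite gt_eqF.
  have ring4 (p q r s A' B' : R) : p - q - (r - s) = A' * h * h ->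
      p - r - (q - s) = B' * h * h -> A' = B'.
    move=> eA eB; apply: (mulIf hn); apply: (mulIf hn); rewrite -eA -eB; ring.
  exact: ring4 e1 e2'.
have h1 : `|A t1 x1 - A t x| < e / 2.
  apply: hA; first exact: le_lt_trans (near_t _ t1b) hda.
  exact: le_lt_trans (near_x _ x1b) hda.
have h2 : `|B t2 x2 - B t x| < e / 2.
  apply: hB; first exact: le_lt_trans (near_t _ t2b) hdb.
  exact: le_lt_trans (near_x _ x2b) hdb.
have ring3 (p q c : R) : p - q = (c - q) - (c - p) by ring.
rewrite (ring3 _ _ (A t1 x1)) [in X in _ - X]AB; apply: (le_trans (ler_normB _ _)).
have lra3 (p q : R) : p < e / 2 -> q < e / 2 -> p + q <= e by lra.
exact: lra3 h1 h2.
Qed.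

End StripCalculus.

(** * The wave map system in null coordinates *)

Section NullForm.
Context {R : realType}.

(* The system satisfied in null coordinates u, v on the strip |v - u| < 2T, with P
   and Q the derivatives of Phi along u and v. *)
Definition null_form m (T : R) (f : R -> 'rV[R]_m) (Phi P Q : R -> R -> 'I_m -> R) : Prop :=
  forall (u v : R) (i : 'I_m), `|v - u| < 2 * T ->
  [/\ is_derive v 1 (fun z : R => Phi u z i) (Q u v i),
      is_derive u 1 (fun z : R => Phi z v i) (P u v i),
      is_derive v 1 (fun z : R => P u z i) (- ((\sum_j P u v j * Q u v j) * Phi u v i)),
      is_derive u 1 (fun z : R => Q z v i) (- ((\sum_j P u v j * Q u v j) * Phi u v i)) &
      [/\ \sum_j Phi u v j ^+ 2 = 1, Phi u u i = f u ord0 i,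
          P u u i = derive1 (fun x => f x ord0 i) u / 2 &
          Q u u i = derive1 (fun x => f x ord0 i) u / 2]].

(* The sign sg selects the half plane t = sg (v - u) / 2 where v - u > 0. *)
Definition nullmap m (sg : R) (phi : R -> R -> 'rV[R]_m) (u v : R) (i : 'I_m) : R :=
  phi (sg * (v - u) / 2) ((u + v) / 2) ord0 i.
Definition nullP m (sg : R) (phi : R -> R -> 'rV[R]_m) (u v : R) (i : 'I_m) : R :=
  (dx (coordf phi i) (sg * (v - u) / 2) ((u + v) / 2) -
   sg * dt (coordf phi i) (sg * (v - u) / 2) ((u + v) / 2)) / 2.
Definition nullQ m (sg : R) (phi : R -> R -> 'rV[R]_m) (u v : R) (i : 'I_m) : R :=
  (dx (coordf phi i) (sg * (v - u) / 2) ((u + v) / 2) +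
   sg * dt (coordf phi i) (sg * (v - u) / 2) ((u + v) / 2)) / 2.

Lemma dtvE m (phi : R -> R -> 'rV[R]_m) t x i :
  dtv phi t x ord0 i = dt (coordf phi i) t x.
Proof. by rewrite mxE. Qed.

Lemma dxvE m (phi : R -> R -> 'rV[R]_m) t x i :
  dxv phi t x ord0 i = dx (coordf phi i) t x.
Proof. by rewrite mxE. Qed.

Lemma coordf_dtv m (phi : R -> R -> 'rV[R]_m) i : coordf (dtv phi) i = dt (coordf phi i).
Proof. by apply/funext => s; apply/funext => z; rewrite /coordf dtvE. Qed.

Lemma coordf_dxv m (phi : R -> R -> 'rV[R]_m) i : coordf (dxv phi) i = dx (coordf phi i).
Proof. by apply/funext => s; apply/funext => z; rewrite /coordf dxvE. Qed.

Lemma wave_coord m (A B D : 'rV[R]_m) (k a b : R) i : A ord0 i = a -> B ord0 i = b ->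
  - A + B + k *: D = 0 -> - a + b + k * D ord0 i = 0.
Proof.
by move=> <- <- /(congr1 (fun w : 'rV[R]_m => w ord0 i)); rewrite !mxE.
Qed.

Lemma sqn_dtv m (phi : R -> R -> 'rV[R]_m) t x :
  sqn (dtv phi t x) = \sum_j dt (coordf phi j) t x ^+ 2.
Proof. by apply: eq_bigr => j _; rewrite dtvE expr2. Qed.

Lemma sqn_dxv m (phi : R -> R -> 'rV[R]_m) t x :
  sqn (dxv phi t x) = \sum_j dx (coordf phi j) t x ^+ 2.
Proof. by apply: eq_bigr => j _; rewrite dxvE expr2. Qed.

Lemma dxE (w : R -> R -> R) t x : dx w t x = derive1 (w t) x.
Proof. by []. Qed.

#[local] Opaque dt dx dtv dxv.

Lemma is_derive_null_v T (w : R -> R -> R) (sg u v : R) : C1_strip T w ->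
  `|sg * (v - u) / 2| < T ->
  is_derive v 1 (fun z : R => w (sg * (z - u) / 2) ((u + z) / 2))
    ((dx w (sg * (v - u) / 2) ((u + v) / 2) + sg * dt w (sg * (v - u) / 2) ((u + v) / 2)) / 2).
Proof.
move=> C1 hT.
have et z : sg * (z - u) / 2 = (- (sg * u / 2)) + sg / 2 * z by ring.
have ex z : (u + z) / 2 = u / 2 + 2^-1 * z by ring.
rewrite et in hT; have := chain_strip (u / 2) 2^-1 C1 hT.
rewrite -et -ex.
have -> : (fun z : R => w (- (sg * u / 2) + sg / 2 * z) (u / 2 + 2^-1 * z)) =
    (fun z : R => w (sg * (z - u) / 2) ((u + z) / 2)).
  by apply/funext => z; rewrite -et -ex.
move=> h; apply: (is_derive_eq h).
by move: (dt w _ _) (dx w _ _) => p q; ring.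
Qed.

Lemma is_derive_null_u T (w : R -> R -> R) (sg u v : R) : C1_strip T w ->
  `|sg * (v - u) / 2| < T ->
  is_derive u 1 (fun z : R => w (sg * (v - z) / 2) ((z + v) / 2))
    ((dx w (sg * (v - u) / 2) ((u + v) / 2) - sg * dt w (sg * (v - u) / 2) ((u + v) / 2)) / 2).
Proof.
move=> C1 hT.
have et z : sg * (v - z) / 2 = sg * v / 2 + (- (sg / 2)) * z by ring.
have ex z : (z + v) / 2 = v / 2 + 2^-1 * z by ring.
rewrite et in hT; have := chain_strip (v / 2) 2^-1 C1 hT.
rewrite -et -ex.
have -> : (fun z : R => w (sg * v / 2 + (- (sg / 2)) * z) (v / 2 + 2^-1 * z)) =
    (fun z : R => w (sg * (v - z) / 2) ((z + v) / 2)).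
  by apply/funext => z; rewrite -et -ex.
move=> h; apply: (is_derive_eq h).
by move: (dt w _ _) (dx w _ _) => p q; ring.
Qed.

(** The mixed derivative along u and v is a quarter of d_xx - d_tt, the cross terms cancelling by
    symmetry, and the sum of P_j Q_j is a quarter of |phi_x|^2 - |phi_t|^2; both use sg^2 = 1. Zero
    velocity gives P = Q = f' / 2 on the diagonal. *)
Lemma wave_map_null m T f (phi : R -> R -> 'rV[R]_m) (sg : R) : sg ^+ 2 = 1 ->
  wave_map T f phi ->
  null_form T f (nullmap sg phi) (nullP sg phi) (nullQ sg phi).
Proof.
move=> sg2 [C2 sph wave phi0 vel0] u v i uvT.
have sgn : `|sg| = 1.
  by apply/eqP; rewrite -(@eqrXn2 _ 2)//= -normrX sg2 normr1 expr1n.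
have tT : `|sg * (v - u) / 2| < T.
  by rewrite !normrM sgn mul1r normfV (ger0_norm (ler0n _ 2)) ltr_pdivrMr// mulrC.
have [C1 C1t C1x] := C2 i.
set t := sg * (v - u) / 2; set x := (u + v) / 2.
set c := coordf phi i.
have sw : dt (dx c) t x = dx (dt c) t x by exact: (schwarz_strip x (C2 i) tT).
have box : (dx (dx c) t x - dt (dt c) t x) / 4 =
    - ((\sum_j nullP sg phi u v j * nullQ sg phi u v j) * nullmap sg phi u v i).
  have e1 : dtv (dtv phi) t x ord0 i = dt (dt c) t x.
    exact: etrans (dtvE _ _ _ _) (congr1 (fun w => dt w t x) (coordf_dtv phi i)).
  have e2 : dxv (dxv phi) t x ord0 i = dx (dx c) t x.
    exact: etrans (dxvE _ _ _ _) (congr1 (fun w => dx w t x) (coordf_dxv phi i)).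
  have h := wave_coord e1 e2 (wave t x tT).
  have eS : \sum_j nullP sg phi u v j * nullQ sg phi u v j =
     (sqn (dxv phi t x) - sqn (dtv phi t x)) / 4.
    rewrite sqn_dtv sqn_dxv -sumrB mulr_suml; apply: eq_bigr => j _.
    have alg (p q : R) : (p - sg * q) / 2 * ((p + sg * q) / 2) = (p ^+ 2 - q ^+ 2) / 4.
      have -> : (p - sg * q) / 2 * ((p + sg * q) / 2) = (p ^+ 2 - sg ^+ 2 * q ^+ 2) / 4 by field.
      by rewrite sg2 mul1r.
    exact: alg.
  rewrite eS.
  have alg (p q r s : R) : - p + q + r * s = 0 -> (q - p) / 4 = - (r / 4 * s).
    move=> e; have -> : q = p - r * s by apply/eqP; rewrite -subr_eq0 -e; apply/eqP; ring.
    by field.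
  exact: alg h.
have dPz (w w' : R -> R -> R) (z k : R) (dw dw' : R) (F F' : R -> R) :
    is_derive z 1 F dw -> is_derive z 1 F' dw' ->
    is_derive z 1 (fun y : R => (F y + k * F' y) / 2) ((dw + k * dw') / 2).
  move=> h h'.
  have h2 := is_deriveZ (2^-1) (is_deriveD h (is_deriveZ k h')).
  have -> : (fun y : R => (F y + k * F' y) / 2) = (2^-1 \*: (F + k \*: F')).
    by apply/funext => y; rewrite mulrC.
  by apply: (is_derive_eq h2); rewrite /GRing.scale /= mulrC.
split.
- exact: (is_derive_null_v C1 tT).
- exact: (is_derive_null_u C1 tT).
- rewrite -box.
  have h1 := is_derive_null_v C1x tT; have h2 := is_derive_null_v C1t tT.
  have := dPz c c _ (- sg) _ _ _ _ h1 h2; rewrite -/t -/x -/c sw.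
  have -> : (fun y : R => (dx c (sg * (y - u) / 2) ((u + y) / 2) +
       - sg * dt c (sg * (y - u) / 2) ((u + y) / 2)) / 2) = (fun z : R => nullP sg phi u z i).
    by apply/funext => y; rewrite /nullP mulNr.
  move=> h; apply: (is_derive_eq h).
  move: (dx (dx c) t x) (dx (dt c) t x) (dt (dt c) t x) => p q r.
  have -> : ((p + sg * q) / 2 + - sg * ((q + sg * r) / 2)) / 2 = (p - sg ^+ 2 * r) / 4 by field.
  by rewrite sg2 mul1r.
- rewrite -box.
  have h1 := is_derive_null_u C1x tT; have h2 := is_derive_null_u C1t tT.
  have := dPz c c _ sg _ _ _ _ h1 h2; rewrite -/t -/x -/c sw.
  move=> h; apply: (is_derive_eq h).
  move: (dx (dx c) t x) (dx (dt c) t x) (dt (dt c) t x) => p q r.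
  have -> : ((p - sg * q) / 2 + sg * ((q - sg * r) / 2)) / 2 = (p - sg ^+ 2 * r) / 4 by field.
  by rewrite sg2 mul1r.
have t0 : sg * (u - u) / 2 = 0 by rewrite subrr mulr0 mul0r.
have x0 : (u + u) / 2 = u by field.
have T0 : `|0 : R| < T by rewrite normr0 (le_lt_trans _ tT).
have v0 : dt (coordf phi i) 0 u = 0.
  by have := congr1 (fun w : 'rV[R]_m => w ord0 i) (vel0 u); rewrite dtvE mxE.
have dx0 : dx (coordf phi i) 0 u = derive1 (fun x => f x ord0 i) u.
  rewrite dxE; congr (derive1 _ u); apply/funext => z.
  by rewrite /coordf phi0.
split.
- rewrite -(sph t x tT) /sqn /dot; apply: eq_bigr => j _.
  by rewrite /nullmap -/t -/x expr2.
- by rewrite /nullmap t0 x0 phi0.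
- by rewrite /nullP t0 x0 v0 mulr0 subr0 dx0.
- by rewrite /nullQ t0 x0 v0 mulr0 addr0 dx0.
Qed.

End NullForm.

(** * Conserved lengths and propagation along characteristics *)

Section NullEstimates.
Context {R : realType}.

(** Both k A - F and k A + F are nondecreasing. With A a primitive of a speed bound, this plays the
    part of integrating the bound on F'. *)
Lemma majorant (F dF A dA : R -> R) (k a b : R) : a <= b ->
  (forall z, a <= z <= b -> is_derive z 1 F (dF z)) ->
  (forall z, a <= z <= b -> is_derive z 1 A (dA z)) ->
  (forall z, a <= z <= b -> `|dF z| <= k * dA z) ->
  `|F b - F a| <= k * (A b - A a).
Proof.
move=> ab hF hA hk; have tobtw z : btw a b z -> a <= z <= b.
  by case=> // /andP[h1 h2]; rewrite (le_trans ab h1) (le_trans h2 ab).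
have kA z : btw a b z -> is_derive z 1 (fun x => k * A x) (k * dA z).
  by move=> hz; exact: (is_deriveZ k (hA _ (tobtw _ hz))).
have [c1 hc1 e1] := @mean_value R (fun x => k * A x - F x) (fun x => k * dA x - dF x) a b
  (fun z hz => is_deriveB (kA z hz) (hF _ (tobtw _ hz))).
have [c2 hc2 e2] := @mean_value R (fun x => k * A x + F x) (fun x => k * dA x + dF x) a b
  (fun z hz => is_deriveD (kA z hz) (hF _ (tobtw _ hz))).
have := hk c1 (tobtw _ hc1); rewrite ler_norml => /andP[_ h1].
have := hk c2 (tobtw _ hc2); rewrite ler_norml => /andP[h2 _].
have p1 : 0 <= k * A b - F b - (k * A a - F a).
  by rewrite e1 mulr_ge0 ?subr_ge0.
have p2 : 0 <= k * A b + F b - (k * A a + F a).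
  by rewrite e2 mulr_ge0 ?subr_ge0// -[k * _]opprK addrC subr_ge0.
rewrite ler_norml mulrBr; move: (k * A a) (k * A b) (F a) (F b) p1 p2 => p q r s p1 p2.
by apply/andP; split; lra.
Qed.

Lemma is_derive_fsum n (F : 'I_n -> R -> R) (dF : 'I_n -> R) (x : R) :
  (forall i, is_derive x 1 (F i) (dF i)) ->
  is_derive x 1 (fun z => \sum_i F i z) (\sum_i dF i).
Proof.
move=> h; have := @is_derive_sum _ _ _ n F x 1 dF h.
by have -> : \sum_(i < n) F i = (fun z => \sum_i F i z) by apply/funext => z; rewrite fct_sumE.
Qed.

Lemma is_derive_sqr (F : R -> R) (x a : R) : is_derive x 1 F a ->
  is_derive x 1 (fun z => F z ^+ 2) (2 * F x * a).
Proof.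
move=> h; have := is_deriveX 2 h; rewrite exprfctE => h2.
by apply: (is_derive_eq h2); rewrite /GRing.scale /= expr1.
Qed.

Lemma near_strip (T u v : R) : `|v - u| < 2 * T -> \forall z \near v, `|z - u| < 2 * T.
Proof.
move=> h; have c : (fun z : R => `|z - u|) @ v --> `|v - u|.
  by apply: cvg_norm; apply: cvgB; [exact: cvg_id|exact: cvg_cst].
exact: (c _ (lt_nbhsl h)).
Qed.

Section Fixed.
Variables (m : nat) (T : R) (f : R -> 'rV[R]_m) (Phi P Q : R -> R -> 'I_m -> R).
Hypothesis nf : null_form T f Phi P Q.
Variable df : 'I_m -> R -> R.
Hypothesis fd : forall i (x : R), is_derive x 1 (fun z => f z ord0 i) (df i x).

Let dfE i (x : R) : derive1 (fun z => f z ord0 i) x = df i x.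
Proof. by rewrite derive1E; exact: (@derive_val _ _ _ _ _ _ _ (fd i x)). Qed.

(** The index i is there because [null_form] delivers its equations, this scalar one included, index
    by index. *)
Lemma null_norm (i : 'I_m) u v : `|v - u| < 2 * T -> \sum_j Phi u v j ^+ 2 = 1.
Proof. by move=> uv; have [_ _ _ _ []] := nf i uv. Qed.

Lemma null_le1 u v i : `|v - u| < 2 * T -> `|Phi u v i| <= 1.
Proof.
move=> uv; rewrite -(@ler_pXn2r _ 2)// ?nnegrE// expr1n -normrX ger0_norm ?sqr_ge0//.
rewrite -(null_norm i uv) (bigD1 i)//= lerDl.
by apply: sumr_ge0 => j _; exact: sqr_ge0.
Qed.

Lemma null_PPhi (i : 'I_m) u v : `|v - u| < 2 * T -> \sum_j Phi u v j * P u v j = 0.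
Proof.
move=> uv.
have d : is_derive u 1 (fun z => \sum_j Phi z v j ^+ 2) (\sum_j 2 * Phi u v j * P u v j).
  by apply: is_derive_fsum => j; apply: is_derive_sqr; have [_ + _ _ _] := nf j uv.
have c : is_derive u 1 (fun z => \sum_j Phi z v j ^+ 2) 0.
  apply: (@near_eq_is_derive R R R (cst 1) (fun z => \sum_j Phi z v j ^+ 2)).
  have vu : `|u - v| < 2 * T by rewrite distrC.
  apply: filterS (near_strip vu) => z; rewrite distrC => zv.
  by rewrite (null_norm i zv).
have : \sum_j 2 * Phi u v j * P u v j = 0.
  by rewrite -(@derive_val _ _ _ _ _ _ _ d) (@derive_val _ _ _ _ _ _ _ c).
under eq_bigr do rewrite -mulrA.
by rewrite -mulr_sumr => /eqP; rewrite mulf_eq0 pnatr_eq0 /= => /eqP.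
Qed.

Lemma null_QPhi (i : 'I_m) u v : `|v - u| < 2 * T -> \sum_j Phi u v j * Q u v j = 0.
Proof.
move=> uv.
have d : is_derive v 1 (fun z => \sum_j Phi u z j ^+ 2) (\sum_j 2 * Phi u v j * Q u v j).
  by apply: is_derive_fsum => j; apply: is_derive_sqr; have [+ _ _ _ _] := nf j uv.
have c : is_derive v 1 (fun z => \sum_j Phi u z j ^+ 2) 0.
  apply: (@near_eq_is_derive R R R (cst 1) (fun z => \sum_j Phi u z j ^+ 2)).
  by apply: filterS (near_strip uv) => z zv; rewrite (null_norm i zv).
have : \sum_j 2 * Phi u v j * Q u v j = 0.
  by rewrite -(@derive_val _ _ _ _ _ _ _ d) (@derive_val _ _ _ _ _ _ _ c).
under eq_bigr do rewrite -mulrA.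
by rewrite -mulr_sumr => /eqP; rewrite mulf_eq0 pnatr_eq0 /= => /eqP.
Qed.

Let seg_strip u v z : `|v - u| < 2 * T -> btw u v z -> `|z - u| < 2 * T.
Proof. by move=> uv /btw_dist h; exact: le_lt_trans uv. Qed.

(* The u-derivative of Phi has a length that does not depend on v, because its
   v-derivative is parallel to Phi and hence orthogonal to it. *)
Lemma null_sqP (i : 'I_m) u v : `|v - u| < 2 * T ->
  \sum_j P u v j ^+ 2 = (\sum_j df j u ^+ 2) / 4.
Proof.
move=> uv.
have d z : btw u v z -> is_derive z 1 (fun y => \sum_j P u y j ^+ 2) 0.
  move=> hz; have uz := seg_strip uv hz.
  have e : \sum_j 2 * P u z j * (- ((\sum_j P u z j * Q u z j) * Phi u z j)) = 0.
    under eq_bigr => j _.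
      have -> : 2 * P u z j * (- ((\sum_j P u z j * Q u z j) * Phi u z j)) =
        - 2 * (\sum_j P u z j * Q u z j) * (Phi u z j * P u z j) by ring.
      over.
    by rewrite -mulr_sumr (null_PPhi i uz) mulr0.
  have d' : is_derive z 1 (fun y => \sum_j P u y j ^+ 2)
      (\sum_j 2 * P u z j * (- ((\sum_j P u z j * Q u z j) * Phi u z j))).
    apply: is_derive_fsum => j; apply: is_derive_sqr.
    by have [_ _ + _ _] := nf j uz.
  exact: (is_derive_eq d' e).
have [c _ h] := @mean_value R (fun y => \sum_j P u y j ^+ 2) (cst 0) u v d.
have -> : \sum_j P u v j ^+ 2 = \sum_j P u u j ^+ 2.
  by apply/eqP; rewrite -subr_eq0 h mul0r.
rewrite mulr_suml; apply: eq_bigr => j _.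
have uu : `|u - u| < 2 * T by rewrite subrr normr0 (le_lt_trans _ uv).
have [_ _ _ _ [_ _ -> _]] := nf j uu.
by rewrite dfE; field.
Qed.

Lemma null_sqQ (i : 'I_m) u v : `|v - u| < 2 * T ->
  \sum_j Q u v j ^+ 2 = (\sum_j df j v ^+ 2) / 4.
Proof.
move=> uv; have vu : `|u - v| < 2 * T by rewrite distrC.
have d z : btw v u z -> is_derive z 1 (fun y => \sum_j Q y v j ^+ 2) 0.
  move=> hz; have vz := seg_strip vu hz; rewrite distrC in vz.
  have e : \sum_j 2 * Q z v j * (- ((\sum_j P z v j * Q z v j) * Phi z v j)) = 0.
    under eq_bigr => j _.
      have -> : 2 * Q z v j * (- ((\sum_j P z v j * Q z v j) * Phi z v j)) =
        - 2 * (\sum_j P z v j * Q z v j) * (Phi z v j * Q z v j) by ring.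
      over.
    by rewrite -mulr_sumr (null_QPhi i vz) mulr0.
  have d' : is_derive z 1 (fun y => \sum_j Q y v j ^+ 2)
      (\sum_j 2 * Q z v j * (- ((\sum_j P z v j * Q z v j) * Phi z v j))).
    apply: is_derive_fsum => j; apply: is_derive_sqr.
    by have [_ _ _ + _] := nf j vz.
  exact: (is_derive_eq d' e).
have [c _ h] := @mean_value R (fun y => \sum_j Q y v j ^+ 2) (cst 0) v u d.
have -> : \sum_j Q u v j ^+ 2 = \sum_j Q v v j ^+ 2.
  by apply/eqP; rewrite -subr_eq0 h mul0r.
rewrite mulr_suml; apply: eq_bigr => j _.
have vv : `|v - v| < 2 * T by rewrite subrr normr0 (le_lt_trans _ uv).
have [_ _ _ _ [_ _ _ ->]] := nf j vv.
by rewrite dfE; field.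
Qed.

Let sum_sq_le (w : 'I_m -> R) (c : R) i : 0 <= c -> \sum_j w j ^+ 2 <= c ^+ 2 -> `|w i| <= c.
Proof.
move=> c0 h; rewrite -(@ler_pXn2r _ 2)// ?nnegrE// -normrX ger0_norm ?sqr_ge0//.
apply: le_trans h; rewrite (bigD1 i)//= lerDl.
by apply: sumr_ge0 => j _; exact: sqr_ge0.
Qed.

Lemma null_P_le u v i (c : R) : `|v - u| < 2 * T -> 0 <= c ->
  \sum_j df j u ^+ 2 <= c ^+ 2 -> `|P u v i| <= c / 2.
Proof.
move=> uv c0 h; apply: sum_sq_le; first by rewrite divr_ge0.
rewrite (null_sqP i uv) expr_div_n -[2 ^+ 2]natrX ler_pM2r//.
Qed.

Lemma null_Q_le u v i (c : R) : `|v - u| < 2 * T -> 0 <= c ->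
  \sum_j df j v ^+ 2 <= c ^+ 2 -> `|Q u v i| <= c / 2.
Proof.
move=> uv c0 h; apply: sum_sq_le; first by rewrite divr_ge0.
rewrite (null_sqQ i uv) expr_div_n -[2 ^+ 2]natrX ler_pM2r//.
Qed.

(** The length of P is |f'(u)| / 2 for every v, so P vanishes where f' does: constancy of the data
    is carried along characteristics. *)
Lemma null_cst_u u1 u2 v i : `|v - u1| < 2 * T -> `|v - u2| < 2 * T ->
  (forall z j, btw u1 u2 z -> df j z = 0) -> Phi u1 v i = Phi u2 v i.
Proof.
move=> uv1 uv2 d0.
have strip z : btw u1 u2 z -> `|v - z| < 2 * T.
  move: uv1 uv2; rewrite !ltr_norml => /andP[a1 a2] /andP[b1 b2].
  by case=> /andP[? ?]; apply/andP; split; lra.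
have d z : btw u1 u2 z -> is_derive z 1 (fun y => Phi y v i) 0.
  move=> hz; have zs := strip z hz.
  have p0 : P z v i = 0.
    apply/eqP; rewrite -normr_le0 -(mul0r (2^-1)); apply: null_P_le => //.
    by rewrite expr0n /= big1// => j _; rewrite d0// expr0n.
  by rewrite -p0; have [_ + _ _ _] := nf i zs.
have [c _ h] := @mean_value R (fun y => Phi y v i) (cst 0) u1 u2 d.
by apply/eqP; rewrite eq_sym -subr_eq0 h mul0r.
Qed.

Lemma null_cst_v u v1 v2 i : `|v1 - u| < 2 * T -> `|v2 - u| < 2 * T ->
  (forall z j, btw v1 v2 z -> df j z = 0) -> Phi u v1 i = Phi u v2 i.
Proof.
move=> uv1 uv2 d0.
have strip z : btw v1 v2 z -> `|z - u| < 2 * T.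
  move: uv1 uv2; rewrite !ltr_norml => /andP[a1 a2] /andP[b1 b2].
  by case=> /andP[? ?]; apply/andP; split; lra.
have d z : btw v1 v2 z -> is_derive z 1 (fun y => Phi u y i) 0.
  move=> hz; have zs := strip z hz.
  have q0 : Q u z i = 0.
    apply/eqP; rewrite -normr_le0 -(mul0r (2^-1)); apply: null_Q_le => //.
    by rewrite expr0n /= big1// => j _; rewrite d0// expr0n.
  by rewrite -q0; have [+ _ _ _ _] := nf i zs.
have [c _ h] := @mean_value R (fun y => Phi u y i) (cst 0) v1 v2 d.
by apply/eqP; rewrite eq_sym -subr_eq0 h mul0r.
Qed.

End Fixed.
End NullEstimates.

(** * Approximate solution with quartic error *)

Section Ansatz.
Context {R : realType}.

Lemma norm_sum_le n (x : 'I_n -> R) (c : R) : (forall j, `|x j| <= c) ->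
  `|\sum_j x j| <= n%:R * c.
Proof.
move=> h; apply: (le_trans (ler_norm_sum _ _ _)).
rewrite (_ : n%:R * c = \sum_(j < n) c); last by rewrite sumr_const card_ord -[RHS]mulr_natl.
exact: ler_sum.
Qed.

Lemma norm_prod_le (x y a b : R) : `|x| <= a -> `|y| <= b -> `|x * y| <= a * b.
Proof. by move=> h1 h2; rewrite normrM ler_pM. Qed.

Variables (m : nat) (T : R) (f : R -> 'rV[R]_m) (Phi P Q : R -> R -> 'I_m -> R).
Hypothesis nf : null_form T f Phi P Q.
Variable df : 'I_m -> R -> R.
Hypothesis fd : forall i (x : R), is_derive x 1 (fun z => f z ord0 i) (df i x).
(** In the application w is e3, A is [major] and B is [area]; the component fw is itself of order V,
    which is what makes the correction cubic. *)
Variables (al om V : R) (A dA : R -> R) (w : 'I_m -> R) (B : 'I_m -> R -> R).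
Let fw x := \sum_j w j * f x ord0 j.
Let dfw x := \sum_j w j * df j x.
Hypothesis region : om - al < 2 * T.
Hypothesis dAd : forall z, al <= z <= om ->
  [/\ is_derive z 1 A (dA z), 0 <= dA z & \sum_j df j z ^+ 2 <= dA z ^+ 2].
Hypothesis AV : forall u v, al <= u -> u <= v -> v <= om -> A v - A u <= V.
Hypothesis V01 : 0 <= V <= 1.
Hypothesis w1 : forall j, `|w j| <= 1.
Hypothesis fwV : forall z, al <= z <= om -> `|fw z| <= V.
Hypothesis Bd : forall j z, al <= z <= om -> is_derive z 1 (B j) (df j z * fw z).

Let M : R := m%:R.
Let M0 : 0 <= M. Proof. exact: ler0n. Qed.
Let V0 : 0 <= V. Proof. by case/andP: V01. Qed.

Let strip u v : al <= u -> u <= v -> v <= om -> `|v - u| < 2 * T.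
Proof.
move=> h1 h2 h3; rewrite ger0_norm ?subr_ge0//.
by apply: le_lt_trans region; exact: lerB.
Qed.

Let dA0 z : al <= z <= om -> 0 <= dA z.
Proof. by move=> /dAd[]. Qed.

Let df_le i z : al <= z <= om -> `|df i z| <= dA z.
Proof.
move=> hz; have [_ d0 h] := dAd hz.
rewrite -(@ler_pXn2r _ 2)// ?nnegrE// -normrX ger0_norm ?sqr_ge0//.
apply: le_trans h; rewrite (bigD1 i)//= lerDl.
by apply: sumr_ge0 => j _; exact: sqr_ge0.
Qed.

Let P_le u v i : al <= u -> u <= v -> v <= om -> `|P u v i| <= dA u / 2.
Proof.
move=> h1 h2 h3; have [_ d0 h] : [/\ is_derive u 1 A (dA u), 0 <= dA u & \sum_j df j u ^+ 2 <= dA u ^+ 2].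
  by apply: dAd; rewrite h1 (le_trans h2).
exact: (null_P_le nf fd i (strip h1 h2 h3) d0 h).
Qed.

Let Q_le u v i : al <= u -> u <= v -> v <= om -> `|Q u v i| <= dA v / 2.
Proof.
move=> h1 h2 h3; have [_ d0 h] : [/\ is_derive v 1 A (dA v), 0 <= dA v & \sum_j df j v ^+ 2 <= dA v ^+ 2].
  by apply: dAd; rewrite h3 (le_trans h1).
exact: (null_Q_le nf fd i (strip h1 h2 h3) d0 h).
Qed.

Let PQ u v := \sum_j P u v j * Q u v j.

Let PQ_le u v : al <= u -> u <= v -> v <= om -> `|PQ u v| <= M / 4 * dA u * dA v.
Proof.
move=> h1 h2 h3; have -> : M / 4 * dA u * dA v = M * (dA u / 2 * (dA v / 2)) by field.
by apply: norm_sum_le => j; apply: norm_prod_le; [exact: P_le|exact: Q_le].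
Qed.

(** Integrates the v-derivative of P from the diagonal, where P = f' / 2; [PQ_le] supplies the
    product of speeds, and one of them integrates to V. *)
Let P_close u v i : al <= u -> u <= v -> v <= om ->
  `|P u v i - df i u / 2| <= M / 4 * dA u * V.
Proof.
move=> h1 h2 h3; have hu : al <= u <= om by rewrite h1 (le_trans h2).
have k0 : 0 <= M / 4 * dA u by rewrite mulr_ge0 ?divr_ge0// dA0.
have -> : df i u / 2 = P u u i.
  have [_ _ _ _ [_ _ -> _]] := nf i (strip h1 (lexx u) (le_trans h2 h3)).
  by rewrite derive1E (@derive_val _ _ _ _ _ _ _ (fd i u)).
apply: (le_trans (@majorant _ (fun z => P u z i) (fun z => - (PQ u z * Phi u z i)) A dA
  (M / 4 * dA u) u v h2 _ _ _)).
- move=> z /andP[z1 z2].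
  by have [_ _ + _ _] := nf i (strip h1 z1 (le_trans z2 h3)).
- by move=> z /andP[z1 z2]; have [] := @dAd z; rewrite ?(le_trans h1 z1) ?(le_trans z2 h3).
- move=> z /andP[z1 z2]; rewrite normrN -[leRHS]mulr1; apply: norm_prod_le.
    exact: PQ_le (le_trans z2 h3).
  exact: (null_le1 nf i (strip h1 z1 (le_trans z2 h3))).
- by rewrite ler_wpM2l// AV.
Qed.

Let Q_close u v i : al <= u -> u <= v -> v <= om ->
  `|Q u v i - df i v / 2| <= M / 4 * dA v * V.
Proof.
move=> h1 h2 h3; have hv : al <= v <= om by rewrite h3 (le_trans h1).
have k0 : 0 <= M / 4 * dA v by rewrite mulr_ge0 ?divr_ge0// dA0.
have -> : df i v / 2 = Q v v i.
  have [_ _ _ _ [_ _ _ ->]] := nf i (strip (le_trans h1 h2) (lexx v) h3).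
  by rewrite derive1E (@derive_val _ _ _ _ _ _ _ (fd i v)).
rewrite distrC.
apply: (le_trans (@majorant _ (fun z => Q z v i) (fun z => - (PQ z v * Phi z v i)) A dA
  (M / 4 * dA v) u v h2 _ _ _)).
- move=> z /andP[z1 z2].
  by have [_ _ _ + _] := nf i (strip (le_trans h1 z1) z2 h3).
- by move=> z /andP[z1 z2]; have [] := @dAd z; rewrite ?(le_trans h1 z1) ?(le_trans z2 h3).
- move=> z /andP[z1 z2]; rewrite normrN -[leRHS]mulr1; apply: norm_prod_le.
    rewrite mulrAC; exact: PQ_le (le_trans h1 z1) z2 h3.
  exact: (null_le1 nf i (strip (le_trans h1 z1) z2 h3)).
- by rewrite ler_wpM2l// AV.
Qed.

Let Phiw u v := \sum_j w j * Phi u v j.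
Let Qw u v := \sum_j w j * Q u v j.

Let fw_d (z : R) : is_derive z 1 fw (dfw z).
Proof. by apply: is_derive_fsum => j; exact: (is_deriveZ (w j) (fd j z)). Qed.

Let Phiw_dv (u v : R) : `|v - u| < 2 * T -> is_derive v 1 (fun z => Phiw u z) (Qw u v).
Proof.
move=> uv; apply: is_derive_fsum => j; have [h _ _ _ _] := nf j uv.
exact: (is_deriveZ (w j) h).
Qed.

Let Qw_du (u v : R) : `|v - u| < 2 * T ->
  is_derive u 1 (fun z => Qw z v) (- (PQ u v * Phiw u v)).
Proof.
move=> uv; have -> : - (PQ u v * Phiw u v) = \sum_j w j * (- (PQ u v * Phi u v j)).
  by rewrite /Phiw mulr_sumr -sumrN; apply: eq_bigr => j _; ring.
apply: is_derive_fsum => j; have [_ _ _ h _] := nf j uv.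
exact: (is_deriveZ (w j) h).
Qed.

Let Phiw_diag u : al <= u <= om -> Phiw u u = fw u.
Proof.
move=> /andP[h1 h2]; apply: eq_bigr => j _.
by have [_ _ _ _ [_ -> _ _]] := nf j (strip h1 (lexx u) h2).
Qed.

Let Qw_diag u : al <= u <= om -> Qw u u = dfw u / 2.
Proof.
move=> /andP[h1 h2]; rewrite /dfw mulr_suml; apply: eq_bigr => j _.
have [_ _ _ _ [_ _ _ ->]] := nf j (strip h1 (lexx u) h2).
by rewrite derive1E (@derive_val _ _ _ _ _ _ _ (fd j u)) mulrA.
Qed.

(** The v-derivative of the difference is w paired with Q - f' / 2, which [Q_close] bounds; one more
    integration gives V^2. *)
Let Phiw_close u v : al <= u -> u <= v -> v <= om ->
  `|Phiw u v - (fw u + fw v) / 2| <= M ^+ 2 / 4 * V ^+ 2.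
Proof.
move=> h1 h2 h3; have hu : al <= u <= om by rewrite h1 (le_trans h2).
have k0 : 0 <= M ^+ 2 / 4 * V by rewrite mulr_ge0// divr_ge0// sqr_ge0.
have -> : Phiw u v - (fw u + fw v) / 2 = (Phiw u v - 2^-1 * fw v) - (Phiw u u - 2^-1 * fw u).
  by rewrite Phiw_diag//; field.
apply: (le_trans (@majorant _ (fun z => Phiw u z - 2^-1 * fw z) (fun z => Qw u z - 2^-1 * dfw z) A dA
  (M ^+ 2 / 4 * V) u v h2 _ _ _)).
- move=> z /andP[z1 z2].
  exact: (is_deriveB (Phiw_dv (strip h1 z1 (le_trans z2 h3))) (is_deriveZ 2^-1 (fw_d z))).
- by move=> z /andP[z1 z2]; have [] := @dAd z; rewrite ?(le_trans h1 z1) ?(le_trans z2 h3).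
- move=> z /andP[z1 z2].
  have -> : Qw u z - 2^-1 * dfw z = \sum_j w j * (Q u z j - df j z / 2).
    by rewrite /Qw /dfw mulr_sumr -sumrB; apply: eq_bigr => j _; ring.
  have -> : M ^+ 2 / 4 * V * dA z = M * (1 * (M / 4 * dA z * V)) by field.
  apply: norm_sum_le => j; apply: norm_prod_le => //.
  exact: Q_close (le_trans z2 h3).
- by rewrite [V ^+ 2]expr2 mulrA ler_wpM2l// AV.
Qed.

(* The free wave with data fw, plus the leading nonlinear correction; B j is a
   primitive of f_j' fw. The error is quartic in the variation V of the data. *)
Definition ansatz u v := (fw u + fw v) / 2 +
  (\sum_j (f v ord0 j - f u ord0 j) * (B j v - B j u)) / 8.

(** The v-derivative of Phiw - ansatz. *)
Let S u v := Qw u v - dfw v / 2 -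
  (\sum_j (df j v * (B j v - B j u) + (f v ord0 j - f u ord0 j) * (df j v * fw v))) / 8.

(** M^2 / 4 bounds the error of P . Q and 1 + M^2 / 4 the size of Phiw; M / 4 bounds f'(u) . f'(v) /
    4 and M^2 / 4 the error of Phiw, whence M^3 / 16. *)
Definition cansatz : R := M ^+ 2 / 4 * (1 + M ^+ 2 / 4) + M ^+ 3 / 16.

(** S vanishes on the diagonal. The correction is built so that its mixed derivative is - f'(u) .
    f'(v) (fw(u) + fw(v)) / 8, which is the nonlinearity with P . Q and Phiw at their leading
    values; the remainder gains a factor V. *)
Let S_le u v : al <= u -> u <= v -> v <= om -> `|S u v| <= cansatz * V ^+ 2 * dA v * V.
Proof.
move=> h1 h2 h3; have hv : al <= v <= om by rewrite h3 (le_trans h1).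
have c0 : 0 <= cansatz.
  have M2 := sqr_ge0 M; have M3 : 0 <= M ^+ 3 by exact: exprn_ge0.
  by rewrite /cansatz addr_ge0 ?divr_ge0// mulr_ge0 ?divr_ge0// addr_ge0 ?divr_ge0.
have k0 : 0 <= cansatz * V ^+ 2 * dA v by rewrite !mulr_ge0 ?sqr_ge0 ?dA0.
have Svv : S v v = 0.
  rewrite /S Qw_diag// subrr sub0r big1 ?mul0r ?oppr0// => j _.
  by rewrite !subrr mulr0 mul0r addr0.
pose dS z := - (PQ z v * Phiw z v) +
  (\sum_j df j z * df j v) * (fw z + fw v) / 8.
have Sd (z : R) : al <= z -> z <= v -> is_derive z 1 (fun y => S y v) (dS z).
  move=> z1 z2; have hz : al <= z <= om by rewrite z1 (le_trans z2).
  have d1 := Qw_du (strip z1 z2 h3).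
  have d2 : is_derive z 1 (fun y => \sum_j (df j v * (B j v - B j y) + (f v ord0 j - f y ord0 j) * (df j v * fw v)))
      (\sum_j - (df j z * df j v * (fw z + fw v))).
    apply: is_derive_fsum => j.
    have e1 := is_deriveZ (df j v) (is_deriveB (is_derive_cst (B j v) z 1) (Bd j hz)).
    have e2 := is_deriveZ (df j v * fw v) (is_deriveB (is_derive_cst (f v ord0 j) z 1) (fd j z)).
    have e3 := is_deriveD e1 e2.
    have -> : (fun y => df j v * (B j v - B j y) + (f v ord0 j - f y ord0 j) * (df j v * fw v)) =
      (df j v \*: (cst (B j v) - B j) + (df j v * fw v) \*: (cst (f v ord0 j) - (fun y => f y ord0 j))).
      by apply/funext => y; rewrite [X in _ + X]mulrC.
    apply: (is_derive_eq e3); rewrite /GRing.scale /=.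
    by move: (fw z) (fw v) => p q; ring.
  have d3 := is_deriveB (is_deriveB d1 (is_derive_cst (dfw v / 2) z 1)) (is_deriveZ (8^-1) d2).
  have -> : (fun y => S y v) = ((fun y => Qw y v) - cst (dfw v / 2) -
     8^-1 \*: (fun y => \sum_j (df j v * (B j v - B j y) + (f v ord0 j - f y ord0 j) * (df j v * fw v)))).
    by apply/funext => y; rewrite /S [X in _ - X]mulrC.
  apply: (is_derive_eq d3); rewrite /GRing.scale /= /dS subr0 sumrN -mulr_suml.
  by rewrite mulrN opprK [8^-1 * _]mulrC.
have h := @majorant _ (fun y => S y v) dS A dA (cansatz * V ^+ 2 * dA v) u v h2 _ _ _.
rewrite -[S u v]opprK normrN -[- S u v]add0r -Svv.
apply: (le_trans (h _ _ _)).
- by move=> z /andP[z1 z2]; apply: Sd => //; exact: le_trans h1 z1.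
- by move=> z /andP[z1 z2]; have [] := @dAd z; rewrite ?(le_trans h1 z1) ?(le_trans z2 h3).
- move=> z /andP[uz zv]; have alz := le_trans h1 uz.
  have hz : al <= z <= om by rewrite alz (le_trans zv).
  have dz0 := dA0 hz; have dv0 := dA0 hv.
  pose FF := \sum_j df j z * df j v.
  (* Replaces first P . Q by its leading value, then Phiw by the free wave. *)
  have e : dS z = - ((PQ z v - FF / 4) * Phiw z v + FF / 4 * (Phiw z v - (fw z + fw v) / 2)).
    have alg (a b c p q : R) : - (a * b) + c * (p + q) / 8 =
      - ((a - c / 4) * b + c / 4 * (b - (p + q) / 2)) by field.
    exact: alg.
  rewrite e normrN.
  have b1 : `|PQ z v - FF / 4| <= M ^+ 2 / 4 * V * (dA z * dA v).
    have -> : PQ z v - FF / 4 = \sum_j ((P z v j - df j z / 2) * Q z v j + (df j z / 2) * (Q z v j - df j v / 2)).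
      by rewrite /PQ /FF mulr_suml -sumrB; apply: eq_bigr => j _; field.
    have -> : M ^+ 2 / 4 * V * (dA z * dA v) =
      M * ((M / 4 * dA z * V) * (dA v / 2) + dA z / 2 * (M / 4 * dA v * V)) by field.
    apply: norm_sum_le => j; apply: (le_trans (ler_normD _ _)); apply: lerD.
      by apply: norm_prod_le; [exact: P_close|exact: Q_le].
    apply: norm_prod_le; last exact: Q_close.
    by rewrite normrM normfV (ger0_norm (ler0n _ 2)) ler_pM2r// df_le.
  have b2 : `|Phiw z v - (fw z + fw v) / 2| <= M ^+ 2 / 4 * V ^+ 2 by exact: Phiw_close.
  have b3 : `|Phiw z v| <= (1 + M ^+ 2 / 4) * V.
    have -> : Phiw z v = (Phiw z v - (fw z + fw v) / 2) + (fw z + fw v) / 2 by rewrite subrK.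
    apply: (le_trans (ler_normD _ _)).
    have t1 : `|(fw z + fw v) / 2| <= V.
      rewrite normrM normfV (ger0_norm (ler0n _ 2)) ler_pdivrMr//.
      apply: (le_trans (ler_normD _ _)); have := lerD (fwV hz) (fwV hv).
      by move=> t; apply: (le_trans t); lra.
    have t2 : M ^+ 2 / 4 * V ^+ 2 <= M ^+ 2 / 4 * V.
      rewrite ler_wpM2l ?divr_ge0 ?sqr_ge0// expr2 ler_piMl//.
      by case/andP: V01.
    rewrite [leRHS]mulrDl mul1r addrC; apply: lerD => //; exact: le_trans t2.
  have b4 : `|FF / 4| <= M / 4 * (dA z * dA v).
    have -> : M / 4 * (dA z * dA v) = M * (dA z * dA v) / 4 by ring.
    rewrite normrM normfV (ger0_norm (ler0n _ 4)) ler_pM2r ?invr_gt0//.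
    by apply: norm_sum_le => j; apply: norm_prod_le; exact: df_le.
  apply: (le_trans (ler_normD _ _)).
  apply: (le_trans (lerD (norm_prod_le b1 b3) (norm_prod_le b4 b2))).
  rewrite le_eqVlt; apply/orP; left; apply/eqP; rewrite /cansatz.
  by move: (dA z) (dA v) M V => a b M' V'; field.
- by rewrite ler_wpM2l// AV.
Qed.

(** Integrates the bound on S in v from the diagonal, where the ansatz is exact; this yields the
    fourth factor V. *)
Lemma ansatz_close u v : al <= u -> u <= v -> v <= om ->
  `|\sum_j w j * Phi u v j - ansatz u v| <= cansatz * V ^+ 4.
Proof.
move=> h1 h2 h3; have hu : al <= u <= om by rewrite h1 (le_trans h2).
have c0 : 0 <= cansatz.
  have M2 := sqr_ge0 M; have M3 : 0 <= M ^+ 3 by exact: exprn_ge0.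
  by rewrite /cansatz addr_ge0 ?divr_ge0// mulr_ge0 ?divr_ge0// addr_ge0 ?divr_ge0.
have k0 : 0 <= cansatz * V ^+ 3 by rewrite mulr_ge0// exprn_ge0.
have D0 : Phiw u u - ansatz u u = 0.
  rewrite Phiw_diag// /ansatz big1 ?mul0r ?addr0; first by field.
  by move=> j _; rewrite !subrr mul0r.
have -> : \sum_j w j * Phi u v j - ansatz u v =
  (Phiw u v - ansatz u v) - (Phiw u u - ansatz u u) by rewrite D0 subr0.
apply: (le_trans (@majorant _ (fun z => Phiw u z - ansatz u z) (fun z => S u z) A dA
  (cansatz * V ^+ 3) u v h2 _ _ _)).
- move=> z /andP[z1 z2]; have hz : al <= z <= om by rewrite (le_trans h1)// (le_trans z2).
  have d1 := Phiw_dv (strip h1 z1 (le_trans z2 h3)).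
  have d2 : is_derive z 1 (fun y => \sum_j (f y ord0 j - f u ord0 j) * (B j y - B j u))
     (\sum_j (df j z * (B j z - B j u) + (f z ord0 j - f u ord0 j) * (df j z * fw z))).
    apply: is_derive_fsum => j.
    have e1 := is_deriveB (fd j z) (is_derive_cst (f u ord0 j) z 1).
    have e2 := is_deriveB (Bd j hz) (is_derive_cst (B j u) z 1).
    apply: (is_derive_eq (is_deriveM e1 e2)); rewrite /GRing.scale /= !subr0.
    by rewrite addrC [(B j z - _) * _]mulrC.
  have d3 := is_deriveB d1 (is_deriveD (is_deriveZ (2^-1) (is_deriveD (is_derive_cst (fw u) z 1) (fw_d z)))
     (is_deriveZ (8^-1) d2)).
  have -> : (fun y => Phiw u y - ansatz u y) = ((fun y => Phiw u y) - (2^-1 \*: (cst (fw u) + fw) +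
    8^-1 \*: (fun y => \sum_j (f y ord0 j - f u ord0 j) * (B j y - B j u)))).
    by apply/funext => y; rewrite /ansatz ![_ / _]mulrC.
  apply: (is_derive_eq d3); rewrite /GRing.scale /= add0r /S.
  by rewrite opprD addrA ![_^-1 * _]mulrC.
- by move=> z /andP[z1 z2]; have [] := @dAd z; rewrite ?(le_trans h1 z1) ?(le_trans z2 h3).
- move=> z /andP[z1 z2]; apply: (le_trans (S_le h1 z1 (le_trans z2 h3))).
  by rewrite le_eqVlt; apply/orP; left; apply/eqP; move: (dA z) V cansatz => a V' c; ring.
- by rewrite [V ^+ 4]exprSr mulrA ler_wpM2l// AV.
Qed.

End Ansatz.

(** * The shape of a single bubble *)

Section Profile.
Context {R : realType}.

Lemma sin_bounds (a : R) : 0 <= a -> a <= 1 / 2 -> a / 2 <= sin a <= a.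
Proof.
move=> a0 a2.
have h (b : R) : 0 <= b -> `|sin b - sin 0| <= 1 * (b - 0).
  move=> b0; apply: (@majorant R sin cos id (cst 1) 1 0 b b0) => z _.
  by rewrite mulr1 ler_norml cos_geN1 cos_le1.
have hc (b : R) : 0 <= b -> `|cos b - cos 0| <= 1 * (b - 0).
  move=> b0; apply: (@majorant R cos (fun x => - sin x) id (cst 1) 1 0 b b0) => z _.
  by rewrite mulr1 normrN ler_norml sin_geN1 sin_le1.
apply/andP; split; last first.
  by have := h a a0; rewrite sin0 !subr0 mul1r; apply: le_trans; exact: ler_norm.
have [c cab e] := @mean_value R sin cos 0 a (fun z _ => is_derive_sin z).
rewrite sin0 !subr0 in e; rewrite e mulrC; apply: ler_wpM2r => //.
have c0 : 0 <= c by case: cab => /andP[h1 h2] //; exact: le_trans a0 h1.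
have ca : c <= a by case: cab => /andP[h1 h2] //; rewrite (le_trans h2).
have := hc c c0; rewrite cos0 !subr0 mul1r ler_norml => /andP[h1 _].
by move: h1; move: (cos c) => q h1; lra.
Qed.

Lemma sqrD_le (a b p q : R) : `|a| <= p -> `|b| <= q -> a ^+ 2 + b ^+ 2 <= (p + q) ^+ 2.
Proof. by rewrite !ler_norml => /andP[a1 a2] /andP[b1 b2]; nra. Qed.

Lemma dotC m (u v : 'rV[R]_m) : dot u v = dot v u.
Proof. by apply: eq_bigr => i _; rewrite mulrC. Qed.

Lemma dotDl m (u v w : 'rV[R]_m) : dot (u + v) w = dot u w + dot v w.
Proof. by rewrite /dot -big_split; apply: eq_bigr => i _; rewrite mxE mulrDl. Qed.

Lemma dotZl m (a : R) (u w : 'rV[R]_m) : dot (a *: u) w = a * dot u w.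
Proof. by rewrite /dot mulr_sumr; apply: eq_bigr => i _; rewrite mxE mulrA. Qed.

Lemma dotDr m (u v w : 'rV[R]_m) : dot w (u + v) = dot w u + dot w v.
Proof. by rewrite dotC dotDl !(dotC _ w). Qed.

Lemma dotZr m (a : R) (u w : 'rV[R]_m) : dot w (a *: u) = a * dot w u.
Proof. by rewrite dotC dotZl dotC. Qed.

Definition orthonormal3 m (e1 e2 e3 : 'rV[R]_m) : Prop :=
  [/\ dot e1 e1 = 1, dot e2 e2 = 1 & dot e3 e3 = 1] /\
  [/\ dot e1 e2 = 0, dot e1 e3 = 0 & dot e2 e3 = 0].

Lemma sqn_frame m (e1 e2 e3 : 'rV[R]_m) (a b c : R) : orthonormal3 e1 e2 e3 ->
  sqn (a *: e1 + b *: e2 + c *: e3) = a ^+ 2 + b ^+ 2 + c ^+ 2.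
Proof.
move=> [[h1 h2 h3] [h12 h13 h23]].
rewrite /sqn !(dotDl, dotDr, dotZl, dotZr) h1 h2 h3 h12 h13 h23.
rewrite (dotC e2 e1) (dotC e3 e1) (dotC e3 e2) h12 h13 h23; ring.
Qed.

Lemma frame_le1 m (v : 'rV[R]_m) i : dot v v = 1 -> `|v ord0 i| <= 1.
Proof.
move=> v1; rewrite -(@ler_pXn2r _ 2)// ?nnegrE// expr1n -normrX ger0_norm ?sqr_ge0//.
by rewrite -v1; exact: sqr_le_sqn.
Qed.

Lemma is_derive_step_affine (a b x : R) :
  is_derive x 1 (fun z : R => step (a * z + b)) (a * derive1 step (a * x + b)).
Proof.
have h := smooth_is_derive x (smooth_rescale (a := a) (b := b) (@smooth_step R)).
by rewrite (@derive1_affine R step a b smooth_step) in h.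
Qed.

Variables (eps d L y : R).

(* The profile leaves e1 by the angle eps towards e2, stays there on [y - d, y + d],
   and comes back. Within [y - L, y + L] it makes one full turn around the axis e1,
   which changes none of its values elsewhere. *)
Definition rise x : R := step (d^-1 * x + (2 - y / d)).
Definition fall x : R := step (d^-1 * x + (-1 - y / d)).
Definition turn x : R := step ((2 * L)^-1 * x + (1 / 2 - y / (2 * L))).
Definition height x : R := eps * (rise x - fall x).
Definition angle x : R := (pi *+ 2) * turn x.

Definition drise x : R := d^-1 * derive1 step (d^-1 * x + (2 - y / d)).
Definition dfall x : R := d^-1 * derive1 step (d^-1 * x + (-1 - y / d)).
Definition dturn x : R := (2 * L)^-1 * derive1 step ((2 * L)^-1 * x + (1 / 2 - y / (2 * L))).
Definition dheight x : R := eps * (drise x - dfall x).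
Definition dangle x : R := (pi *+ 2) * dturn x.

Lemma is_derive_height (x : R) : is_derive x 1 height (dheight x).
Proof.
exact: (is_deriveZ eps (is_deriveB (is_derive_step_affine _ _ x) (is_derive_step_affine _ _ x))).
Qed.

Lemma is_derive_angle (x : R) : is_derive x 1 angle (dangle x).
Proof. exact: (is_deriveZ (pi *+ 2) (is_derive_step_affine _ _ x)). Qed.

Lemma smooth_height : smooth height.
Proof.
exact: (smoothZ (smoothB (smooth_rescale smooth_step) (smooth_rescale smooth_step))).
Qed.

Lemma smooth_angle : smooth angle.
Proof. exact: (smoothZ (smooth_rescale smooth_step)). Qed.

Hypothesis d0 : 0 < d.
Hypothesis L0 : 0 < L.

Let arg (l c x : R) : 0 < l -> l^-1 * x + (c - y / l) = (x - y) / l + c.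
Proof. by move=> l0; field; rewrite gt_eqF. Qed.

Lemma height_plateau x : y - d <= x <= y + d -> height x = eps /\ dheight x = 0.
Proof.
move=> /andP[x1 x2].
have a1 : 1 <= d^-1 * x + (2 - y / d).
  by rewrite arg// -lerBlDr ler_pdivlMr//; lra.
have a2 : d^-1 * x + (-1 - y / d) <= 0.
  by rewrite arg// -lerBrDr ler_pdivrMr//; lra.
rewrite /height /dheight /rise /fall /drise /dfall step_eq1// step_eq0//.
rewrite !derive1_step_eq0; [|by left|by right].
by rewrite !mulr0 !subr0 mulr1 mulr0.
Qed.

Lemma height_out x : x <= y - 2 * d \/ y + 2 * d <= x -> height x = 0 /\ dheight x = 0.
Proof.
case=> hx.
  have a1 : d^-1 * x + (2 - y / d) <= 0.
    by rewrite arg// -lerBrDr ler_pdivrMr//; move: d0 hx; lra.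
  have a2 : d^-1 * x + (-1 - y / d) <= 0.
    by rewrite arg// -lerBrDr ler_pdivrMr//; move: d0 hx; lra.
  rewrite /height /dheight /rise /fall /drise /dfall !step_eq0//.
  rewrite !derive1_step_eq0; [|by left..].
  by rewrite !mulr0 !subr0 mulr0.
have a1 : 1 <= d^-1 * x + (2 - y / d).
  by rewrite arg// -lerBlDr ler_pdivlMr//; move: d0 hx; lra.
have a2 : 1 <= d^-1 * x + (-1 - y / d).
  by rewrite arg// -lerBlDr ler_pdivlMr//; move: d0 hx; lra.
rewrite /height /dheight /rise /fall /drise /dfall !step_eq1//.
rewrite !derive1_step_eq0; [|by right..].
by rewrite subrr !mulr0 subrr mulr0.
Qed.

Lemma angle_left x : x <= y - L -> angle x = 0 /\ dangle x = 0.
Proof.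
move=> hx; have a1 : (2 * L)^-1 * x + (1 / 2 - y / (2 * L)) <= 0.
  by rewrite arg ?mulr_gt0// -lerBrDr ler_pdivrMr ?mulr_gt0//; lra.
by rewrite /angle /dangle /turn /dturn step_eq0// derive1_step_eq0 ?mulr0//; left.
Qed.

Lemma angle_right x : y + L <= x -> angle x = pi *+ 2 /\ dangle x = 0.
Proof.
move=> hx; have a1 : 1 <= (2 * L)^-1 * x + (1 / 2 - y / (2 * L)).
  by rewrite arg ?mulr_gt0// -lerBlDr ler_pdivlMr ?mulr_gt0//; lra.
by rewrite /angle /dangle /turn /dturn step_eq1// derive1_step_eq0 ?mulr0 ?mulr1//; right.
Qed.

Lemma angle_out x : x <= y - L \/ y + L <= x ->
  [/\ sin (angle x) = 0, cos (angle x) = 1 & dangle x = 0].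
Proof.
case=> hx; first by have [-> ->] := angle_left hx; rewrite sin0 cos0.
by have [-> ->] := angle_right hx; rewrite sin2pi cos2pi.
Qed.

Hypothesis Ld : L < d.

(** Because L < d the turn takes place within the plateau: at each point the height or the angle is
    at rest. *)
Lemma profile_cases x :
  (height x = eps /\ dheight x = 0) \/
  [/\ sin (angle x) = 0, cos (angle x) = 1 & dangle x = 0].
Proof.
have [h|h] := boolP (y - d <= x <= y + d); first by left; exact: height_plateau.
right; apply: angle_out; move: h; rewrite negb_and -!ltNge => /orP[h|h]; [left|right]; move: Ld h; lra.
Qed.

(* A primitive of a bound for the speed of the profile. *)
Definition major x : R := eps * (rise x + fall x) + eps * angle x.
Definition dmajor x : R := eps * (drise x + dfall x) + eps * dangle x.

Lemma is_derive_major (x : R) : is_derive x 1 major (dmajor x).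
Proof.
exact: (is_deriveD (is_deriveZ eps (is_deriveD (is_derive_step_affine _ _ x)
  (is_derive_step_affine _ _ x))) (is_deriveZ eps (is_derive_angle x))).
Qed.

Hypothesis eps0 : 0 < eps.

Let pi2 : (0 : R) <= pi *+ 2. Proof. by rewrite mulrn_wge0// pi_ge0. Qed.
Let pi4 : (pi *+ 2 : R) <= 8.
Proof. by have h := @pihalf_lt2 R; rewrite -mulr_natr; lra. Qed.

Lemma drise_ge0 x : 0 <= drise x.
Proof. by rewrite mulr_ge0 ?derive1_step_ge0// invr_ge0 ltW. Qed.
Lemma dfall_ge0 x : 0 <= dfall x.
Proof. by rewrite mulr_ge0 ?derive1_step_ge0// invr_ge0 ltW. Qed.
Lemma dangle_ge0 x : 0 <= dangle x.
Proof.
by rewrite mulr_ge0// mulr_ge0 ?derive1_step_ge0// invr_ge0 mulr_ge0// ltW.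
Qed.

Lemma dmajor_ge0 x : 0 <= dmajor x.
Proof.
have e0 := ltW eps0.
exact: addr_ge0 (mulr_ge0 e0 (addr_ge0 (drise_ge0 x) (dfall_ge0 x))) (mulr_ge0 e0 (dangle_ge0 x)).
Qed.

(** The rise and the fall count 1 each and the turn 2 pi <= 8, whence 10. *)
Lemma major_bounds x : 0 <= major x <= 10 * eps.
Proof.
have r0 : 0 <= rise x by exact: step_ge0.
have r1 : rise x <= 1 by exact: step_le1.
have f0 : 0 <= fall x by exact: step_ge0.
have f1 : fall x <= 1 by exact: step_le1.
have t0 : 0 <= turn x by exact: step_ge0.
have t1 : turn x <= 1 by exact: step_le1.
have a0 : 0 <= angle x by rewrite mulr_ge0.
have a8 : angle x <= 8.
  by apply: le_trans pi4; rewrite -[leRHS]mulr1 ler_wpM2l.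
rewrite /major -mulrDr; apply/andP; split.
  by rewrite mulr_ge0 ?(ltW eps0)// addr_ge0// addr_ge0.
rewrite mulrC ler_pM2r//.
by move: (rise x) (fall x) (angle x) r0 r1 f0 f1 a0 a8 => p q r *; lra.
Qed.

Hypothesis eps2 : eps <= 1 / 2.

Let sin_eps : eps / 2 <= sin eps <= eps.
Proof. by apply: sin_bounds => //; exact: ltW. Qed.

Lemma dprofile_le x :
  dheight x ^+ 2 + (sin (height x) * dangle x) ^+ 2 <= dmajor x ^+ 2.
Proof.
have h1 := drise_ge0 x; have h2 := dfall_ge0 x; have h3 := dangle_ge0 x.
have b1 : `|dheight x| <= eps * (drise x + dfall x).
  apply: norm_prod_le; first by rewrite (gtr0_norm eps0).
  rewrite ler_norml; move: (drise x) (dfall x) h1 h2 => p q p0 q0.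
  by apply/andP; split; lra.
have b2 : `|sin (height x) * dangle x| <= eps * dangle x.
  have [[-> _]|[_ _ ->]] := profile_cases x; last by rewrite !mulr0 normr0.
  rewrite normrM (ger0_norm h3) ler_wpM2r//.
  case/andP: sin_eps => s1 s2; rewrite ger0_norm//.
  by apply: le_trans s1; rewrite divr_ge0// ltW.
rewrite /dmajor; exact: (sqrD_le b1 b2).
Qed.

Variables (m : nat) (e1 e2 e3 : 'rV[R]_m).
Hypothesis fr : orthonormal3 e1 e2 e3.

(** Spherical coordinates with polar axis e1, polar angle [height] and azimuth [angle]. *)
Definition profile x : 'rV[R]_m :=
  cos (height x) *: e1 + (sin (height x) * cos (angle x)) *: e2 +
  (sin (height x) * sin (angle x)) *: e3.

Lemma profileE x j : profile x ord0 j = e1 ord0 j * cos (height x) +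
  e2 ord0 j * (sin (height x) * cos (angle x)) + e3 ord0 j * (sin (height x) * sin (angle x)).
Proof. by rewrite !mxE; ring. Qed.

Definition dprofile x j : R := e1 ord0 j * (- sin (height x) * dheight x) +
  e2 ord0 j * (cos (height x) * dheight x * cos (angle x) - sin (height x) * (sin (angle x) * dangle x)) +
  e3 ord0 j * (cos (height x) * dheight x * sin (angle x) + sin (height x) * (cos (angle x) * dangle x)).

Let dsin h dh (x : R) : is_derive x 1 h dh -> is_derive x 1 (fun z => sin (h z)) (cos (h x) * dh).
Proof. by move=> hd; exact: (@is_derive1_comp _ sin h _ _ _ (is_derive_sin _) hd). Qed.
Let dcos h dh (x : R) : is_derive x 1 h dh -> is_derive x 1 (fun z => cos (h z)) (- sin (h x) * dh).
Proof. by move=> hd; exact: (@is_derive1_comp _ cos h _ _ _ (is_derive_cos _) hd). Qed.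
Let dmul (f g : R -> R) (df dg x : R) : is_derive x 1 f df -> is_derive x 1 g dg ->
  is_derive x 1 (fun z => f z * g z) (df * g x + f x * dg).
Proof.
move=> h1 h2; apply: (is_derive_eq (is_deriveM h1 h2)).
by rewrite /GRing.scale /= addrC [g x * _]mulrC.
Qed.

Lemma is_derive_profile (x : R) j :
  is_derive x 1 (fun z => profile z ord0 j) (dprofile x j).
Proof.
have hh := is_derive_height x; have ha := is_derive_angle x.
have -> : (fun z => profile z ord0 j) = (fun z => e1 ord0 j * cos (height z) +
  e2 ord0 j * (sin (height z) * cos (angle z)) + e3 ord0 j * (sin (height z) * sin (angle z))).
  by apply/funext => z; exact: profileE.
have h := is_deriveD (is_deriveD (is_deriveZ (e1 ord0 j) (dcos hh))
  (is_deriveZ (e2 ord0 j) (dmul (dsin hh) (dcos ha))))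
  (is_deriveZ (e3 ord0 j) (dmul (dsin hh) (dsin ha))).
apply: (is_derive_eq h); rewrite /GRing.scale /= /dprofile.
move: (dheight x) (dangle x) (cos (height x)) (sin (height x)) (cos (angle x)) (sin (angle x)).
by move=> a b C S c s; ring.
Qed.

Lemma sum_dprofile x : \sum_j dprofile x j ^+ 2 =
  dheight x ^+ 2 + (sin (height x) * dangle x) ^+ 2.
Proof.
have h := sqn_frame (- sin (height x) * dheight x)
  (cos (height x) * dheight x * cos (angle x) - sin (height x) * (sin (angle x) * dangle x))
  (cos (height x) * dheight x * sin (angle x) + sin (height x) * (cos (angle x) * dangle x)) fr.
transitivity (sqn ((- sin (height x) * dheight x) *: e1 +
  (cos (height x) * dheight x * cos (angle x) - sin (height x) * (sin (angle x) * dangle x)) *: e2 +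
  (cos (height x) * dheight x * sin (angle x) + sin (height x) * (cos (angle x) * dangle x)) *: e3)).
  by apply: eq_bigr => j _; rewrite !mxE /dprofile expr2; congr (_ * _); ring.
rewrite h.
have c1 := cos2Dsin2 (height x); have c2 := cos2Dsin2 (angle x).
move: (cos (height x)) (sin (height x)) (cos (angle x)) (sin (angle x)) (dheight x) (dangle x) c1 c2.
move=> C S c s a b c1 c2.
have -> : (- S * a) ^+ 2 + (C * a * c - S * (s * b)) ^+ 2 + (C * a * s + S * (c * b)) ^+ 2 =
  a ^+ 2 * (S ^+ 2 + C ^+ 2 * (c ^+ 2 + s ^+ 2)) + (S * b) ^+ 2 * (c ^+ 2 + s ^+ 2) by ring.
by rewrite c2 !mulr1 [S ^+ 2 + _]addrC c1 mulr1.
Qed.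

Lemma dot_profile_e3 x : dot e3 (profile x) = sin (height x) * sin (angle x).
Proof.
case: fr => [[h1 h2 h3] [h12 h13 h23]].
rewrite /profile !(dotDr, dotZr) h3 (dotC e3 e1) (dotC e3 e2) h13 h23; ring.
Qed.

(** Primitive of the j-th derivative times the e3 component. On the plateau the e2 part integrates -
    sin^2 eps sin^2(angle) and the e3 part is half a square; off the plateau the e3 component
    vanishes and [area] is locally at rest. *)
Definition area x j : R :=
  e2 ord0 j * (- sin eps ^+ 2 * (2^-1 * (angle x - sin (angle x) * cos (angle x)))) +
  e3 ord0 j * (2^-1 * ((sin (height x) * sin (angle x)) * (sin (height x) * sin (angle x)))).

Lemma is_derive_area (x : R) j :
  is_derive x 1 (fun z => area z j) (dprofile x j * (sin (height x) * sin (angle x))).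
Proof.
have hh := is_derive_height x; have ha := is_derive_angle x.
have hs := dmul (dsin hh) (dsin ha).
have h := is_deriveD (is_deriveZ (e2 ord0 j) (is_deriveZ (- sin eps ^+ 2)
   (is_deriveZ 2^-1 (is_deriveB ha (dmul (dsin ha) (dcos ha))))))
  (is_deriveZ (e3 ord0 j) (is_deriveZ 2^-1 (dmul hs hs))).
apply: (is_derive_eq h); rewrite /GRing.scale /= /dprofile.
have c2 := cos2Dsin2 (angle x).
have [[-> ->]|[-> -> ->]] := profile_cases x; last by ring.
move: (cos eps) (sin eps) (cos (angle x)) (sin (angle x)) (dangle x) c2 => C S c s b c2.
have e : b - (c * b * c + s * (- s * b)) = 2 * s ^+ 2 * b.
  have -> : b - (c * b * c + s * (- s * b)) = b * (1 - c ^+ 2 + s ^+ 2) by ring.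
  by have -> : 1 - c ^+ 2 = s ^+ 2; [rewrite -c2; ring|ring].
by rewrite e; field.
Qed.

(** Across the window the angle gains 2 pi while its sine vanishes at both ends, so only half of 2
    pi is left. *)
Lemma area_jump (u1 u2 : R) j : u1 <= y - L -> y + L <= u2 ->
  area u2 j - area u1 j = - (e2 ord0 j * (sin eps ^+ 2 * pi)).
Proof.
move=> h1 h2; have [a1 _] := angle_left h1; have [a2 _] := angle_right h2.
have [s1 c1 _] := angle_out (or_introl h1); have [s2 c2 _] := angle_out (or_intror h2).
rewrite /area s1 c1 s2 c2 a1 a2 -[pi *+ 2]mulr_natr; by field.
Qed.

End Profile.

(** * The jump of the solution created by one bubble *)

Section Jump.
Context {R : realType}.
Variables (m : nat) (e1 e2 e3 : 'rV[R]_m).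
Hypothesis fr : orthonormal3 e1 e2 e3.
Variables (eps d L y : R).
Hypotheses (d0 : 0 < d) (L0 : 0 < L) (Ld : L < d).
Hypotheses (eps0 : 0 < eps) (eps1 : eps <= 1 / 10).

Let eps2 : eps <= 1 / 2. Proof. by move: eps1; lra. Qed.

Lemma dprofile_eq0 x j : dheight eps d y x = 0 -> dangle L y x = 0 ->
  dprofile eps d L y e1 e2 e3 x j = 0.
Proof. by rewrite /dprofile => -> ->; rewrite !(mulr0, mul0r, subrr, addr0). Qed.

Lemma dprofile_plateau x j : y - d <= x <= y - L \/ y + L <= x <= y + d ->
  dprofile eps d L y e1 e2 e3 x j = 0.
Proof.
move=> hx; have [] : y - d <= x <= y + d /\ (x <= y - L \/ y + L <= x).
  by case: hx => /andP[a b]; split; [|by left| |by right]; apply/andP; split; move: Ld L0; lra.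
move=> /(height_plateau eps d0) [_ h] /(angle_out L0) [_ _ h']; exact: dprofile_eq0.
Qed.

Lemma dprofile_out x j : y + 2 * d <= x -> dprofile eps d L y e1 e2 e3 x j = 0.
Proof.
move=> hx; have [_ h] := height_out eps d0 (or_intror hx).
have hx' : y + L <= x by move: d0 Ld hx; lra.
by have [_ _ h'] := angle_out L0 (or_intror hx'); exact: dprofile_eq0.
Qed.

Lemma profile_bend x j : y - d <= x <= y - L \/ y + L <= x <= y + d ->
  profile eps d L y e1 e2 e3 x ord0 j = e1 ord0 j * cos eps + e2 ord0 j * sin eps.
Proof.
move=> hx; have [] : y - d <= x <= y + d /\ (x <= y - L \/ y + L <= x).
  by case: hx => /andP[a b]; split; [|by left| |by right]; apply/andP; split; move: Ld L0; lra.
move=> /(height_plateau eps d0) [h _] /(angle_out L0) [h1 h2 _].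
by rewrite profileE h h1 h2 !mulr0 mulr1 addr0.
Qed.

Lemma profile_out x : x <= y - 2 * d \/ y + 2 * d <= x ->
  profile eps d L y e1 e2 e3 x = e1.
Proof.
move=> hx; have [h _] := height_out eps d0 hx.
by rewrite /profile h sin0 cos0 !mul0r !scale0r scale1r !addr0.
Qed.

Lemma profile_e3_le x : `|sin (height eps d y x) * sin (angle L y x)| <= 10 * eps.
Proof.
have [[-> _]|[-> _ _]] := profile_cases eps y d0 L0 Ld x; last first.
  by rewrite mulr0 normr0 mulr_ge0// ltW.
have /andP[s1 s2] := sin_bounds (ltW eps0) eps2.
have s0 : 0 <= sin eps by apply: le_trans s1; rewrite divr_ge0// ltW.
have h : `|sin eps * sin (angle L y x)| <= eps * 1.
  apply: norm_prod_le; first by rewrite ger0_norm.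
  by rewrite ler_norml sin_geN1 sin_le1.
by apply: (le_trans h); move: eps0; lra.
Qed.

Variables (T : R) (f : R -> 'rV[R]_m) (phi : R -> R -> 'rV[R]_m) (t : R).
Hypotheses (sf : smoothv f) (wm : wave_map T f phi) (t0 : t != 0) (tT : `|t| < T).
(** The first condition puts the right end x + |t| of the backward cone beyond the bubble when the
    left end x - |t| lies on its plateau. The second keeps the interval from [al] to [om], of length
    3 d + 2 |t|, inside the strip. *)
Hypotheses (dt : 3 * d <= 2 * `|t|) (dT : 3 * d + 2 * `|t| < 2 * T).
Hypothesis fp : forall x, y - 3 * d < x < y + 2 * d + 2 * `|t| ->
  f x = profile eps d L y e1 e2 e3 x.
(** With V = 10 eps this says that the ansatz error is at most eps^3 / 128. *)
Hypothesis small : 128 * 10 ^+ 4 * cansatz m * eps <= 1.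

Let s := `|t|.
Let sg := Num.sg t.
Let sg2 : sg ^+ 2 = 1. Proof. by rewrite sqr_sg t0. Qed.
Let nf := wave_map_null sg2 wm.
Let df i := derive1 (fun z => f z ord0 i).
Let fd i (x : R) : is_derive x 1 (fun z => f z ord0 i) (df i x).
Proof. by apply: smooth_is_derive; exact: sf. Qed.
Let Phi := nullmap sg phi.
Let al := y - 2 * d.
Let om := y + d + 2 * s.

Let dfE i z : al <= z <= om -> df i z = dprofile eps d L y e1 e2 e3 z i.
Proof.
move=> /andP[z1 z2].
have hz : \forall x \near z, f x ord0 i = profile eps d L y e1 e2 e3 x ord0 i.
  have h : z \in `]y - 3 * d, y + 2 * d + 2 * s[.
    by rewrite in_itv /=; apply/andP; split; move: z1 z2 d0; rewrite /al /om; lra.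
  by apply: filterS (near_in_itvoo h) => x; rewrite in_itv /= => /fp ->.
have h := is_derive_profile eps d L y e1 e2 e3 z i.
have h' : is_derive z 1 (fun x => f x ord0 i) (dprofile eps d L y e1 e2 e3 z i).
  apply: (@near_eq_is_derive R R R (fun x => profile eps d L y e1 e2 e3 x ord0 i)).
  by apply: filterS hz => x ->.
by rewrite /df derive1E; exact: (@derive_val _ _ _ _ _ _ _ h').
Qed.

Let phiE x i : phi t x ord0 i = Phi (x - s) (x + s) i.
Proof.
rewrite /Phi /nullmap; congr (phi _ _ ord0 i); last by field.
by rewrite [in LHS](numEsg t) -/sg -/s; field.
Qed.

(** The foot x - s lies on a half plateau and x + s in the region where f = e1. Constancy in v moves
    the latter to [om], constancy in u moves the former to the edge of the window; only the side of
    the window matters. *)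
Let Phi_plateau x u1 i :
  (y + s - d <= x <= y + s - L /\ u1 = y - L) \/ (y + s + L <= x <= y + s + d /\ u1 = y + L) ->
  phi t x ord0 i = Phi u1 om i.
Proof.
move=> hx; rewrite phiE.
have [a1 a2 a3] : [/\ y - d <= x - s <= y + d, y - L <= u1 <= y + L & y + 2 * s - d <= x + s <= om].
  rewrite /om; case: hx => -[/andP[h1 h2] ->]; split; apply/andP; split; move: L0 Ld d0; lra.
have s1 : 3 * d <= 2 * s by exact: dt.
have s2 : 3 * d + 2 * s < 2 * T by exact: dT.
transitivity (Phi u1 (x + s) i); last first.
  apply: (@null_cst_v R m T f _ _ _ nf df fd u1 (x + s) om i).
  + by case/andP: a2; case/andP: a3; rewrite /om ltr_norml => *; apply/andP; split; move: L0 Ld d0; lra.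
  + by case/andP: a2; rewrite /om ltr_norml => *; apply/andP; split; move: L0 Ld d0; lra.
  + move=> z j hz; have [z1 z2] : y + 2 * d <= z /\ z <= om.
      by case/andP: a3 => h1 h2; case: hz => /andP[h3 h4]; split; move: h1 h2 h3 h4 s1; rewrite /om; lra.
    rewrite dfE; first exact: dprofile_out.
    by rewrite z2 andbT (le_trans _ z1)// /al; move: d0; lra.
apply: (@null_cst_u R m T f _ _ _ nf df fd (x - s) u1 (x + s) i).
- by rewrite ltr_norml; apply/andP; split; move: tT s2 d0 s1; rewrite -/s; lra.
- by case: hx => -[/andP[h1 h2] ->]; rewrite ltr_norml; apply/andP; split; move: s2 s1 L0 Ld d0; lra.
- move=> z j hz; rewrite dfE.
    apply: dprofile_plateau.
    by case: hx => -[/andP[h1 h2] e]; [left|right]; rewrite e in hz; case: hz => /andP[h3 h4]; apply/andP; split; move: h1 h2 h3 h4; lra.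
  case/andP: a1 => h1 h2; case/andP: a2 => h3 h4.
  by rewrite /al /om; case: hz => /andP[h5 h6]; apply/andP; split; move: h1 h2 h3 h4 h5 h6 s1 d0 L0 Ld; lra.
Qed.

Let w j := e3 ord0 j.
Let B j z := area eps d L y e2 e3 z j.
Let V := 10 * eps.

Let fwE z : al <= z <= om -> \sum_j w j * f z ord0 j = sin (height eps d y z) * sin (angle L y z).
Proof.
move=> /andP[z1 z2]; rewrite -(dot_profile_e3 eps d L y fr z) -fp//.
by rewrite -/s; apply/andP; split; move: z1 z2 d0; rewrite /al /om; lra.
Qed.

Let close u : al <= u -> u <= om ->
  `|\sum_j w j * Phi u om j - ansatz f w B u om| <= cansatz m * V ^+ 4.
Proof.
move=> h1 h2; have [[_ _ e33] _] := fr.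
have region : om - al < 2 * T by rewrite /al /om; have : 3 * d + 2 * s < 2 * T by []; lra.
have dAd z : al <= z <= om -> [/\ is_derive z 1 (major eps d L y) (dmajor eps d L y z),
    0 <= dmajor eps d L y z & \sum_j df j z ^+ 2 <= dmajor eps d L y z ^+ 2].
  move=> hz; split; [exact: is_derive_major|exact: dmajor_ge0|].
  under eq_bigr => j _ do rewrite dfE//.
  rewrite (sum_dprofile eps d L y fr); exact: dprofile_le.
have AV u' v' : al <= u' -> u' <= v' -> v' <= om -> major eps d L y v' - major eps d L y u' <= V.
  move=> _ _ _; have /andP[p1 p2] := major_bounds d L y eps0 u'.
  have /andP[q1 q2] := major_bounds d L y eps0 v'.
  by rewrite /V; move: p1 p2 q1 q2; move: (major _ _ _ _ _) (major _ _ _ _ _) => p q; lra.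
have V01 : 0 <= V <= 1 by rewrite /V; apply/andP; split; move: eps0 eps1; lra.
have w1 j : `|w j| <= 1 by exact: frame_le1.
have fwV z : al <= z <= om -> `|\sum_j w j * f z ord0 j| <= V.
  by move=> hz; rewrite fwE//; exact: profile_e3_le.
have Bd j z : al <= z <= om -> is_derive z 1 (B j) (df j z * \sum_j w j * f z ord0 j).
  move=> hz; rewrite (fwE hz) (dfE j hz).
  exact: (is_derive_area eps y d0 L0 Ld e1 e2 e3 z j).
exact: (ansatz_close nf fd region dAd AV V01 w1 fwV Bd h1 h2 (lexx om)).
Qed.

(* The turn sweeps the area pi sin^2 eps, which the correction term records. *)
Let ansatz_jump :
  ansatz f w B (y - L) om - ansatz f w B (y + L) om = pi * sin eps ^+ 3 / 8.
Proof.
have s1 : 3 * d <= 2 * s by exact: dt.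
have i1 : al <= y - L <= om by rewrite /al /om; apply/andP; split; move: s1 d0 L0 Ld; lra.
have i2 : al <= y + L <= om by rewrite /al /om; apply/andP; split; move: s1 d0 L0 Ld; lra.
have i3 : al <= om <= om by rewrite /al /om; apply/andP; split; move: s1 d0 L0 Ld; lra.
have [a1 _ _] := angle_out L0 (or_introl (lexx (y - L))).
have [a2 _ _] := angle_out L0 (or_intror (lexx (y + L))).
have fin z : al <= z <= om -> f z = profile eps d L y e1 e2 e3 z.
  move=> /andP[z1 z2]; apply: fp.
  by rewrite -/s; apply/andP; split; move: z1 z2 d0; rewrite /al /om; lra.
have fu1 j : f (y - L) ord0 j = e1 ord0 j * cos eps + e2 ord0 j * sin eps.
  rewrite fin//; apply: profile_bend; left; rewrite lexx andbT; move: Ld; lra.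
have fu2 j : f (y + L) ord0 j = e1 ord0 j * cos eps + e2 ord0 j * sin eps.
  rewrite fin//; apply: profile_bend; right; rewrite lexx /=; move: Ld; lra.
have fo j : f om ord0 j = e1 ord0 j.
  by rewrite fin// profile_out//; right; rewrite /om; move: s1 d0; lra.
rewrite /ansatz !fwE// a1 a2 !mulr0.
set q := sin (height _ _ _ om) * _; rewrite add0r opprD addrACA subrr add0r -mulrBl -sumrB.
(* The displacement from the plateau to f(om) = e1 is (1 - cos eps) e1 - sin eps e2; against an area
   along e2, orthogonality leaves the sine. *)
congr (_ / 8); transitivity (\sum_j (pi * sin eps ^+ 2) * (e2 ord0 j * sin eps * e2 ord0 j - (1 - cos eps) * (e1 ord0 j * e2 ord0 j))).
  apply: eq_bigr => j _.
  have h := @area_jump R eps d L y L0 m e2 e3 (y - L) (y + L) j (lexx _) (lexx _).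
  rewrite fu1 fu2 fo -/(B j _) -/(B j _) in h *.
  rewrite -mulrBr (_ : B j om - B j (y - L) - (B j om - B j (y + L)) = B j (y + L) - B j (y - L)); last by ring.
  rewrite h; ring.
have [[_ h22 _] [h12 _ _]] := fr.
rewrite -mulr_sumr sumrB -mulr_sumr -/(dot e1 e2) h12 mulr0 subr0.
under eq_bigr do rewrite mulrAC.
rewrite -mulr_suml -/(dot e2 e2) h22; ring.
Qed.

(** As sin eps >= eps / 2 and pi >= 2, the ansatz jumps by at least eps^3 / 32; two errors of eps^3
    / 128 leave eps^3 / 64 for the e3 component. *)
Lemma local_jump : exists i P Q,
  edge (fun x => (phi t x - e1) ord0 i) (y + s) L d P Q /\ eps ^+ 3 / (128 * m%:R) <= `|Q - P|.
Proof.
have s1 : 3 * d <= 2 * s by exact: dt.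
pose J j := Phi (y - L) om j - Phi (y + L) om j.
have [i hi] : exists i, eps ^+ 3 / (128 * m%:R) <= `|J i|.
  (* Were all m coordinates to jump by less than eps^3 / (128 m), the e3 component, whose
     coefficients are at most 1, would jump by at most eps^3 / 128. *)
  apply: contrapT => no.
  have Jle j : `|w j * J j| <= eps ^+ 3 / (128 * m%:R).
    rewrite -[leRHS]mul1r; apply: norm_prod_le; first by have [[_ _ ?] _] := fr; exact: frame_le1.
    by rewrite leNgt; apply/negP => h; apply: no; exists j; exact: ltW.
  have e3_ge0 : 0 <= eps ^+ 3 by rewrite exprn_ge0// ltW.
  have up : `|\sum_j w j * J j| <= eps ^+ 3 / 128.
    apply: (le_trans (norm_sum_le Jle)).
    case: (posnP m) => [->|m0]; first by rewrite mul0r divr_ge0.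
    rewrite le_eqVlt; apply/orP; left; apply/eqP; field.
    by rewrite pnatr_eq0 -lt0n m0.
  have c1 : `|\sum_j w j * Phi (y - L) om j - ansatz f w B (y - L) om| <= cansatz m * V ^+ 4.
    by apply: close; rewrite /al /om; move: s1 d0 L0 Ld; lra.
  have c2 : `|\sum_j w j * Phi (y + L) om j - ansatz f w B (y + L) om| <= cansatz m * V ^+ 4.
    by apply: close; rewrite /al /om; move: s1 d0 L0 Ld; lra.
  have je := ansatz_jump.
  have low : eps ^+ 3 / 32 <= pi * sin eps ^+ 3 / 8.
    have /andP[b1 b2] := sin_bounds (ltW eps0) eps2.
    have h3 : (eps / 2) ^+ 3 <= sin eps ^+ 3.
      have e20 : 0 <= eps / 2 by rewrite divr_ge0// ltW.
      by rewrite lerXn2r ?nnegrE//; exact: le_trans b1.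
    have p2 := @pi_ge2 R.
    have h4 : 2 * (eps / 2) ^+ 3 <= pi * sin eps ^+ 3.
      by apply: ler_pM => //; rewrite exprn_ge0// divr_ge0// ltW.
    rewrite (_ : eps ^+ 3 / 32 = 2 * (eps / 2) ^+ 3 / 8); last by field.
    by rewrite ler_pM2r.
  have sm : cansatz m * V ^+ 4 <= eps ^+ 3 / 128.
    have -> : cansatz m * V ^+ 4 = (128 * 10 ^+ 4 * cansatz m * eps) * (eps ^+ 3 / 128).
      by rewrite /V; move: (cansatz m) => c; field.
    by rewrite ler_piMl// divr_ge0.
  have Js : \sum_j w j * J j = \sum_j w j * Phi (y - L) om j - \sum_j w j * Phi (y + L) om j.
    by rewrite -sumrB; apply: eq_bigr => j _; rewrite mulrBr.
  have e3_gt0 : 0 < eps ^+ 3 by rewrite exprn_gt0.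
  move: up c1 c2 je low sm e3_gt0; rewrite Js.
  move: (\sum_j _) (\sum_j _) (ansatz _ _ _ _ _) (ansatz _ _ _ _ _) (pi * _ / 8) (cansatz m * _) (eps ^+ 3).
  move=> p q a b c k e; rewrite !ler_norml => /andP[? ?] /andP[? ?] /andP[? ?]; lra.
exists i, (Phi (y - L) om i - e1 ord0 i), (Phi (y + L) om i - e1 ord0 i); split.
  by split=> x hx; rewrite !mxE; congr (_ - _); apply: Phi_plateau; [left|right].
by rewrite opprB addrA subrK distrC.
Qed.

End Jump.

(** * Transforms of the two shapes that make up a bubble *)

Section OscProfile.
Context {R : realType}.
Implicit Types f g h : R -> R.

Lemma oscD f g (k x : R) : intble f -> intble g ->
  osc (fun z => f z + g z) k x = osc f k x + osc g k x.
Proof.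
move=> fi gi; rewrite /osc -(RintegralD measurableT (intble_wave k x fi) (intble_wave k x gi)).
by apply: eq_Rintegral => z _; rewrite mulrDl.
Qed.

Lemma oscZ f (c k x : R) : intble f -> osc (fun z => c * f z) k x = c * osc f k x.
Proof.
move=> fi; rewrite /osc -RintegralZl//; last exact: intble_wave.
by apply: eq_Rintegral => z _; rewrite mulrA.
Qed.

(** Adds the trivial bound and the one from two integrations by parts; the support has length 4 l,
    whence 8 K in total. *)
Lemma osc_rescale h (K l b k x : R) : smooth h -> supported h (-2) 2 ->
  (forall z, `|h z| <= K) -> (forall z, `|derive1 (derive1 h) z| <= K) -> 0 < l ->
  `|osc (fun z => h (l^-1 * z + b)) k x| <= 8 * K * (l / (1 + (l * x) ^+ 2)).
Proof.
move=> sh hs hK hK2 l0; set g := (fun z => h (l^-1 * z + b)).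
have K0 : 0 <= K by exact: le_trans (hK 0).
have sg : smooth g := smooth_rescale sh.
have gs : supported g (l * (-2 - b)) (l * (2 - b)).
  move=> z /hs /andP[z1 z2]; have -> : z = l * ((l^-1 * z + b) - b) by field; rewrite gt_eqF.
  by rewrite !ler_pM2l// !lerB.
have ab : l * (-2 - b) <= l * (2 - b) by rewrite ler_pM2l//; lra.
have b1 := osc_le k x ab (smooth_continuous sg) gs (fun z => hK (l^-1 * z + b)).
have g2 z : `|derive1 (derive1 g) z| <= l^-1 ^+ 2 * K.
  have -> : g = (fun z => 1 * h (l^-1 * z + b)) by apply/funext => t; rewrite mul1r.
  rewrite derive2_rescale// mul1r normrM ger0_norm ?sqr_ge0//.
  by rewrite ler_wpM2l// sqr_ge0.
have b2 := osc_decay k x ab sg gs g2.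
have d0 : 0 < 1 + (l * x) ^+ 2 by rewrite ltr_pwDl// sqr_ge0.
rewrite mulrA ler_pdivlMr// mulrDr mulr1.
have -> : 8 * K * l = 4 * l * K + 4 * l * K by ring.
apply: lerD.
  by apply: (le_trans b1); rewrite le_eqVlt; apply/orP; left; apply/eqP; ring.
rewrite (_ : `|osc g k x| * (l * x) ^+ 2 = l ^+ 2 * (x ^+ 2 * `|osc g k x|)); last by ring.
have -> : 4 * l * K = l ^+ 2 * ((l * (2 - b) - l * (-2 - b)) * (l^-1 ^+ 2 * K)).
  by field; rewrite gt_eqF.
by rewrite ler_wpM2l// sqr_ge0.
Qed.

(** What matters is linearity in e: the size comes from |F z| <= z, and the e^2 term of the second
    derivative is absorbed by e <= 1. Used for sin and cos - 1. *)
Lemma comp_bounds (F F1 F2 h : R -> R) (M e : R) :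
  (forall z : R, is_derive z 1 F (F1 z)) -> (forall z : R, is_derive z 1 F1 (F2 z)) ->
  (forall z, 0 <= z -> `|F z| <= z) -> (forall z, `|F1 z| <= 1) -> (forall z, `|F2 z| <= 1) ->
  smooth h -> (forall z, 0 <= h z <= 1) -> (forall z, `|derive1 h z| <= M) ->
  (forall z, `|derive1 (derive1 h) z| <= M) -> 0 <= e -> e <= 1 ->
  (forall z, `|F (e * h z)| <= (1 + M + M ^+ 2) * e) /\
  (forall z, `|derive1 (derive1 (fun x => F (e * h x))) z| <= (1 + M + M ^+ 2) * e).
Proof.
move=> dF dF1 Fz F1b F2b sh h01 hM h2M e0 e1.
have M0 : 0 <= M by exact: le_trans (hM 0).
have dh (x : R) : is_derive x 1 (fun z => e * h z) (e * derive1 h x).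
  exact: (is_deriveZ e (smooth_is_derive x sh)).
have d1 (x : R) : is_derive x 1 (fun z => F (e * h z)) (F1 (e * h x) * (e * derive1 h x)).
  exact: (@is_derive1_comp _ F (fun z => e * h z) _ _ _ (dF _) (dh x)).
have d2 (x : R) : is_derive x 1 (fun z => F1 (e * h z) * (e * derive1 h z))
    (F1 (e * h x) * (e * derive1 (derive1 h) x) + (e * derive1 h x) * (F2 (e * h x) * (e * derive1 h x))).
  have a1 := @is_derive1_comp _ F1 (fun z => e * h z) _ _ _ (dF1 _) (dh x).
  have a2 := is_deriveZ e (smooth_is_derive x (smooth_derive1 sh)).
  exact: (is_deriveM a1 a2).
split=> z.
  have /andP[z0 z1] := h01 z.
  apply: (le_trans (Fz _ (mulr_ge0 e0 z0))); rewrite mulrC ler_wpM2r//.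
  by apply: (le_trans z1); rewrite -addrA lerDl addr_ge0// sqr_ge0.
rewrite (derive1E_is_derive d1) (derive1E_is_derive d2).
apply: (le_trans (ler_normD _ _)).
have n1 : `|e * derive1 h z| <= e * M.
  by apply: norm_prod_le => //; rewrite ger0_norm.
have n2 : `|e * derive1 (derive1 h) z| <= e * M.
  by apply: norm_prod_le => //; rewrite ger0_norm.
apply: (le_trans (lerD (norm_prod_le (F1b (e * h z)) n2) (norm_prod_le n1 (norm_prod_le (F2b (e * h z)) n1)))).
have : e * (e * M ^+ 2) <= e * (1 * M ^+ 2).
  by rewrite ler_wpM2l// ler_wpM2r// sqr_ge0.
by move: e0; clear; nra.
Qed.

(** The shape of [height] at unit scale and amplitude; [spin] below is that of [angle]. *)
Definition plateau (z : R) : R := step (1 * z + 2) - step (1 * z + -1).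

Lemma smooth_plateau : smooth plateau.
Proof. exact: (smoothB (smooth_rescale smooth_step) (smooth_rescale smooth_step)). Qed.

Lemma supported_plateau : supported plateau (-2) 2.
Proof.
move=> z; apply: contraNT; rewrite negb_and -!ltNge => h; apply/eqP; rewrite /plateau !mul1r.
case/orP: h => h; first by rewrite !step_eq0 ?subrr//; lra.
by rewrite !step_eq1 ?subrr//; lra.
Qed.

Lemma plateau01 z : 0 <= plateau z <= 1.
Proof.
rewrite /plateau !mul1r; have [h|h] := leP z 1.
  by rewrite (@step_eq0 _ (z + -1)) ?subr0 ?step_ge0 ?step_le1//; lra.
rewrite (@step_eq1 _ (z + 2)); last by lra.
by rewrite subr_ge0 step_le1 gerBl step_ge0.
Qed.

Definition spin (z : R) : R := (pi *+ 2) * step (1 * z + 1 / 2).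

Lemma smooth_spin : smooth spin.
Proof. exact: (smoothZ (smooth_rescale smooth_step)). Qed.

Lemma spin_out z : ~~ (-2 <= z <= 2) -> sin (spin z) = 0 /\ cos (spin z) = 1.
Proof.
rewrite negb_and -!ltNge /spin => /orP[h|h].
  by rewrite step_eq0 ?mulr0 ?sin0 ?cos0//; lra.
by rewrite step_eq1 ?mulr1 ?sin2pi ?cos2pi//; lra.
Qed.

Lemma cosB1_le (z : R) : 0 <= z -> `|cos z - 1| <= z.
Proof.
move=> z0; rewrite -[X in _ - X](@cos0 R) -[leRHS]mul1r -[X in 1 * X]subr0.
apply: (@majorant R cos (fun x => - sin x) id (cst 1) 1 0 z z0) => y _.
by rewrite mulr1 normrN ler_norml sin_geN1 sin_le1.
Qed.

Lemma sin_le (z : R) : 0 <= z -> `|sin z| <= z.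
Proof.
move=> z0; rewrite -[X in `|X|]subr0 -[X in _ - X](@sin0 R) -[leRHS]mul1r -[X in 1 * X]subr0.
apply: (@majorant R sin cos id (cst 1) 1 0 z z0) => y _.
by rewrite mulr1 ler_norml cos_geN1 cos_le1.
Qed.

Lemma sup_bounded2 h : smooth h -> supported h (-2) 2 -> exists2 K, 0 < K &
  [/\ forall z, `|h z| <= K, forall z, `|derive1 h z| <= K & forall z, `|derive1 (derive1 h) z| <= K].
Proof.
move=> sh hs; have sh1 := smooth_derive1 sh; have sh2 := smooth_derive1 sh1.
have [A A0 hA] := supported_bounded (smooth_continuous sh) hs.
have [B B0 hB] := supported_bounded (smooth_continuous sh1) (supported_derive1 hs).
have [C C0 hC] := supported_bounded (smooth_continuous sh2) (supported_derive1 (supported_derive1 hs)).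
exists (1 + A + B + C); first by move: A0 B0 C0; lra.
split=> z; [apply: (le_trans (hA z))|apply: (le_trans (hB z))|apply: (le_trans (hC z))]; move: A0 B0 C0; lra.
Qed.

Let sinN1 (z : R) : `|sin z| <= 1. Proof. by rewrite ler_norml sin_geN1 sin_le1. Qed.
Let cosN1 (z : R) : `|cos z| <= 1. Proof. by rewrite ler_norml cos_geN1 cos_le1. Qed.

Let NsinN1 (z : R) : `|- sin z| <= 1. Proof. by rewrite normrN. Qed.
Let NcosN1 (z : R) : `|- cos z| <= 1. Proof. by rewrite normrN. Qed.

Let cosB1_derive (z : R) : is_derive z 1 (fun x : R => cos x - 1) (- sin z).
Proof.
have h := is_deriveB (is_derive_cos z) (is_derive_cst (1 : R) z 1).
by rewrite subr0 in h.
Qed.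

Lemma osc_height : exists2 K : R, 0 < K & forall eps d b k x : R, 0 <= eps -> eps <= 1 -> 0 < d ->
  `|osc (fun z => sin (eps * plateau (d^-1 * z + b))) k x| <= K * eps * (d / (1 + (d * x) ^+ 2)) /\
  `|osc (fun z => cos (eps * plateau (d^-1 * z + b)) - 1) k x| <= K * eps * (d / (1 + (d * x) ^+ 2)).
Proof.
have [M M0 [_ hM1 hM2]] := sup_bounded2 smooth_plateau supported_plateau.
have p0 : 0 < 1 + M + M ^+ 2 by move: M0; nra.
exists (8 * (1 + M + M ^+ 2)); first by rewrite mulr_gt0.
move=> eps d b k x e0 e1 d0.
have sm := smoothZ (c := eps) smooth_plateau.
have z0 z : plateau z = 0 -> eps * plateau z = 0 by move=> ->; rewrite mulr0.
split; rewrite -[8 * _ * eps]mulrA.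
  have [c1 c2] := comp_bounds (@is_derive_sin R) (@is_derive_cos R) sin_le cosN1
    NsinN1 smooth_plateau plateau01 hM1 hM2 e0 e1.
  apply: (@osc_rescale (fun z => sin (eps * plateau z)) _ _ _ _ _ (smooth_comp smooth_sin sm) _ c1 c2 d0).
  move=> z; apply: contraR => /(supported_eq0 supported_plateau)/z0 ->.
  by rewrite sin0.
have [c1 c2] := comp_bounds cosB1_derive (fun z => is_deriveN (is_derive_sin z)) cosB1_le
    NsinN1 
    NcosN1 smooth_plateau plateau01 hM1 hM2 e0 e1.
apply: (@osc_rescale (fun z => cos (eps * plateau z) - 1) _ _ _ _ _
  (smoothB (smooth_comp smooth_cos sm) (@smooth_cst R 1)) _ c1 c2 d0).
move=> z; apply: contraR => /(supported_eq0 supported_plateau)/z0 ->.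
by rewrite cos0 subrr.
Qed.

Lemma osc_spin : exists2 K : R, 0 < K & forall l b k x : R, 0 < l ->
  `|osc (fun z => sin (spin (l^-1 * z + b))) k x| <= K * (l / (1 + (l * x) ^+ 2)) /\
  `|osc (fun z => cos (spin (l^-1 * z + b)) - 1) k x| <= K * (l / (1 + (l * x) ^+ 2)).
Proof.
have ss : smooth (fun z => sin (spin z)) := smooth_comp smooth_sin smooth_spin.
have sc : smooth (fun z => cos (spin z) - 1) := smoothB (smooth_comp smooth_cos smooth_spin) (@smooth_cst R 1).
have us : supported (fun z => sin (spin z)) (-2) 2.
  by move=> z; apply: contraR => /spin_out[-> _].
have uc : supported (fun z => cos (spin z) - 1) (-2) 2.
  by move=> z; apply: contraR => /spin_out[_ ->]; rewrite subrr.
have [A A0 [a1 _ a2]] := sup_bounded2 ss us.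
have [B B0 [b1 _ b2]] := sup_bounded2 sc uc.
have AB : A <= A + B /\ B <= A + B by move: A0 B0; lra.
exists (8 * (A + B)); first by rewrite mulr_gt0// addr_gt0.
move=> l b k x l0; split.
  apply: (@osc_rescale (fun z => sin (spin z))) => // z; [apply: (le_trans (a1 z))|apply: (le_trans (a2 z))]; exact: AB.1.
apply: (@osc_rescale (fun z => cos (spin z) - 1)) => // z; [apply: (le_trans (b1 z))|apply: (le_trans (b2 z))]; exact: AB.2.
Qed.

End OscProfile.

(** * One bubble as a sum of two scales *)

Section Piece.
Context {R : realType}.
Variables (m : nat) (e1 e2 e3 : 'rV[R]_m).
Hypothesis fr : orthonormal3 e1 e2 e3.

Lemma heightE (eps d y x : R) : height eps d y x = eps * plateau (d^-1 * x + - (y / d)).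
Proof.
rewrite /height /rise /fall /plateau !mul1r.
by congr (_ * (step _ - step _)); rewrite addrA addrAC.
Qed.

Lemma angleE (L y x : R) : angle L y x = spin ((2 * L)^-1 * x + - (y / (2 * L))).
Proof. by rewrite /angle /turn /spin !mul1r; congr (_ * step _); rewrite addrA addrAC. Qed.

Lemma smooth_profile (eps d L y : R) : smoothv (profile eps d L y e1 e2 e3).
Proof.
move=> j; have sh := @smooth_height R eps d y; have sa := @smooth_angle R L y.
have -> : (fun x => profile eps d L y e1 e2 e3 x ord0 j) = (fun x =>
    e1 ord0 j * cos (height eps d y x) + e2 ord0 j * (sin (height eps d y x) * cos (angle L y x)) +
    e3 ord0 j * (sin (height eps d y x) * sin (angle L y x))).
  by apply/funext => x; exact: profileE.
have ssh := smooth_comp smooth_sin sh; have sch := smooth_comp smooth_cos sh.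
have ssa := smooth_comp smooth_sin sa; have sca := smooth_comp smooth_cos sa.
exact: (smoothD (smoothD (smoothZ sch) (smoothZ (smoothM ssh sca))) (smoothZ (smoothM ssh ssa))).
Qed.

Lemma sqn_profile (eps d L y x : R) : sqn (profile eps d L y e1 e2 e3 x) = 1.
Proof.
rewrite /profile (sqn_frame _ _ _ fr).
have c1 := cos2Dsin2 (height eps d y x); have c2 := cos2Dsin2 (angle L y x).
by rewrite !exprMn -addrA -mulrDr c2 mulr1.
Qed.

Variables (eps d L y : R).
Hypotheses (d0 : 0 < d) (L0 : 0 < L) (Ld : L < d) (eps0 : 0 < eps) (eps2 : eps <= 1 / 2).
Let P := profile eps d L y e1 e2 e3.

(** Where the angle moves, the height is eps, so the departure from e1 is exactly an unturned bubble
    at scale d plus a turn at fixed height at scale L. This additivity lets the Besov norm ignore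
    the ratio d / L. *)
Lemma piece_split x j : P x ord0 j - e1 ord0 j =
  (e1 ord0 j * (cos (height eps d y x) - 1) + e2 ord0 j * sin (height eps d y x)) +
  (e2 ord0 j * sin eps * (cos (angle L y x) - 1) + e3 ord0 j * sin eps * sin (angle L y x)).
Proof.
rewrite /P profileE.
by have [[-> _]|[-> -> _]] := profile_cases eps y d0 L0 Ld x; ring.
Qed.

Let h01 x : 0 <= height eps d y x /\ height eps d y x <= eps.
Proof.
rewrite heightE; have /andP[p0 p1] := plateau01 (d^-1 * x + - (y / d)).
split; first by rewrite mulr_ge0// ltW.
by rewrite -[leRHS]mulr1 ler_wpM2l// ltW.
Qed.

Let sin01 : 0 <= sin eps /\ sin eps <= eps.
Proof.
have /andP[s1 s2] := sin_bounds (ltW eps0) eps2; split => //.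
by apply: le_trans s1; rewrite divr_ge0// ltW.
Qed.

Let ej : [/\ forall j, `|e1 ord0 j| <= 1, forall j, `|e2 ord0 j| <= 1 & forall j, `|e3 ord0 j| <= 1].
Proof. by have [[? ? ?] _] := fr; split=> j; exact: frame_le1. Qed.

(** The four terms of [piece_split] count 1, 1, 2 and 1 times eps. *)
Lemma piece_le x j : `|P x ord0 j - e1 ord0 j| <= 5 * eps.
Proof.
have [b1 b2 b3] := ej; have [h0 h1] := h01 x; have [s0 s1] := sin01.
rewrite piece_split.
have t1 : `|e1 ord0 j * (cos (height eps d y x) - 1)| <= 1 * eps.
  by apply: norm_prod_le => //; apply: le_trans (cosB1_le h0) h1.
have t2 : `|e2 ord0 j * sin (height eps d y x)| <= 1 * eps.
  by apply: norm_prod_le => //; apply: le_trans (sin_le h0) h1.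
have se : `|sin eps| <= eps by rewrite ger0_norm.
have t3 : `|e2 ord0 j * sin eps * (cos (angle L y x) - 1)| <= 1 * eps * 2.
  apply: norm_prod_le; first exact: norm_prod_le.
  rewrite ler_norml; apply/andP; split; have := @cos_geN1 R (angle L y x);
    have := @cos_le1 R (angle L y x); lra.
have t4 : `|e3 ord0 j * sin eps * sin (angle L y x)| <= 1 * eps * 1.
  apply: norm_prod_le; first exact: norm_prod_le.
  by rewrite ler_norml sin_geN1 sin_le1.
apply: (le_trans (ler_normD _ _)).
apply: (le_trans (lerD (le_trans (ler_normD _ _) (lerD t1 t2)) (le_trans (ler_normD _ _) (lerD t3 t4)))).
by rewrite le_eqVlt; apply/orP; left; apply/eqP; ring.
Qed.

Lemma piece_out x : 2 * d <= `|x - y| -> P x = e1.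
Proof.
by move=> h; rewrite /P profile_out//; move: h; rewrite ler_normr => /orP[h|h]; [right|left]; lra.
Qed.

Lemma osc_piece (K1 K2 : R) j k x : 0 < K1 -> 0 < K2 ->
  (forall eps d b k x : R, 0 <= eps -> eps <= 1 -> 0 < d ->
    `|osc (fun z => sin (eps * plateau (d^-1 * z + b))) k x| <= K1 * eps * (d / (1 + (d * x) ^+ 2)) /\
    `|osc (fun z => cos (eps * plateau (d^-1 * z + b)) - 1) k x| <= K1 * eps * (d / (1 + (d * x) ^+ 2))) ->
  (forall l b k x : R, 0 < l ->
    `|osc (fun z => sin (spin (l^-1 * z + b))) k x| <= K2 * (l / (1 + (l * x) ^+ 2)) /\
    `|osc (fun z => cos (spin (l^-1 * z + b)) - 1) k x| <= K2 * (l / (1 + (l * x) ^+ 2))) ->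
  `|osc (fun x => P x ord0 j - e1 ord0 j) k x| <=
    2 * (K1 + K2) * eps * (d / (1 + (d * x) ^+ 2)) +
    2 * (K1 + K2) * eps * (2 * L / (1 + (2 * L * x) ^+ 2)).
Proof.
move=> K1p K2p H1 H2; have [b1 b2 b3] := ej; have [s0 s1] := sin01.
pose ch z := cos (height eps d y z) - 1; pose sh z := sin (height eps d y z).
pose ca z := cos (angle L y z) - 1; pose sa z := sin (angle L y z).
have hout z : ~~ (y - 2 * d <= z <= y + 2 * d) -> height eps d y z = 0.
  move=> hz; have h : z <= y - 2 * d \/ y + 2 * d <= z.
    by move: hz; rewrite negb_and -!ltNge => /orP[/ltW|/ltW] ?; [left|right].
  by have [] := height_out eps d0 h.
have aout z : ~~ (y - L <= z <= y + L) -> sin (angle L y z) = 0 /\ cos (angle L y z) = 1.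
  move=> hz; have h : z <= y - L \/ y + L <= z.
    by move: hz; rewrite negb_and -!ltNge => /orP[/ltW|/ltW] ?; [left|right].
  by have [h1 h2 _] := angle_out L0 h.
have ich : intble ch.
  apply: (@continuous_supported_intble _ _ (y - 2 * d) (y + 2 * d)).
    exact/smooth_continuous/(smoothB (smooth_comp smooth_cos (@smooth_height R eps d y)) (@smooth_cst R 1)).
  by move=> z; apply: contraR => /hout; rewrite /ch => ->; rewrite cos0 subrr.
have ish : intble sh.
  apply: (@continuous_supported_intble _ _ (y - 2 * d) (y + 2 * d)).
    exact/smooth_continuous/(smooth_comp smooth_sin (@smooth_height R eps d y)).
  by move=> z; apply: contraR => /hout; rewrite /sh => ->; rewrite sin0.
have ica : intble ca.
  apply: (@continuous_supported_intble _ _ (y - L) (y + L)).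
    exact/smooth_continuous/(smoothB (smooth_comp smooth_cos (@smooth_angle R L y)) (@smooth_cst R 1)).
  by move=> z; apply: contraR => hz; have [_ h] := aout z hz; rewrite /ca h subrr.
have isa : intble sa.
  apply: (@continuous_supported_intble _ _ (y - L) (y + L)).
    exact/smooth_continuous/(smooth_comp smooth_sin (@smooth_angle R L y)).
  by move=> z; apply: contraR => hz; have [h _] := aout z hz; rewrite /sa h.
have eps1 : eps <= 1 by move: eps2; lra.
have [w1 w2] := H1 eps d (- (y / d)) k x (ltW eps0) eps1 d0.
have L2 : 0 < 2 * L by rewrite mulr_gt0.
have [w3 w4] := H2 (2 * L) (- (y / (2 * L))) k x L2.
have -> : (fun x => P x ord0 j - e1 ord0 j) = (fun z : R =>
   (e1 ord0 j * ch z + e2 ord0 j * sh z) + (e2 ord0 j * sin eps * ca z + e3 ord0 j * sin eps * sa z)).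
  by apply/funext => z; rewrite piece_split.
rewrite oscD; [|by apply: intbleD; exact: intbleZ..].
rewrite oscD; [|exact: intbleZ..].
rewrite oscD; [|exact: intbleZ..].
rewrite !oscZ//.
have shE : sh = (fun z => sin (eps * plateau (d^-1 * z + - (y / d)))).
  by apply/funext => z; rewrite /sh heightE.
have chE : ch = (fun z => cos (eps * plateau (d^-1 * z + - (y / d))) - 1).
  by apply/funext => z; rewrite /ch heightE.
have saE : sa = (fun z => sin (spin ((2 * L)^-1 * z + - (y / (2 * L))))).
  by apply/funext => z; rewrite /sa angleE.
have caE : ca = (fun z => cos (spin ((2 * L)^-1 * z + - (y / (2 * L)))) - 1).
  by apply/funext => z; rewrite /ca angleE.
rewrite -shE -chE -saE -caE in w1 w2 w3 w4.
have se : `|sin eps| <= eps by rewrite ger0_norm.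
have t1 := norm_prod_le (b1 j) w2; have t2 := norm_prod_le (b2 j) w1.
have t3 := norm_prod_le (norm_prod_le (b2 j) se) w4.
have t4 := norm_prod_le (norm_prod_le (b3 j) se) w3.
apply: (le_trans (ler_normD _ _)).
apply: (le_trans (lerD (le_trans (ler_normD _ _) (lerD t1 t2)) (le_trans (ler_normD _ _) (lerD t3 t4)))).
have q1 : 0 <= eps * (d / (1 + (d * x) ^+ 2)).
  by rewrite mulr_ge0 ?(ltW eps0)// divr_ge0 ?(ltW d0)// addr_ge0// sqr_ge0.
have q2 : 0 <= eps * (2 * L / (1 + (2 * L * x) ^+ 2)).
  by rewrite mulr_ge0 ?(ltW eps0)// divr_ge0 ?(ltW L2)// addr_ge0// sqr_ge0.
move: q1 q2; set p := d / _; set q := 2 * L / _ => q1 q2.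
have r1 := mulr_ge0 (ltW K2p) q1; have r2 := mulr_ge0 (ltW K1p) q2.
rewrite -subr_ge0 (_ : _ - _ = 2 * (K2 * (eps * p)) + 2 * (K1 * (eps * q))); last by ring.
by rewrite addr_ge0// mulr_ge0.
Qed.

End Piece.

(** * Superposition of bubbles at distant anchors *)

Section Family.
Context {R : realType}.
Notation mu := (@lebesgue_measure R).
Variables (m : nat) (e1 e2 e3 : 'rV[R]_m).
Hypothesis fr : orthonormal3 e1 e2 e3.
Variables (eps d L : nat -> R) (b : nat -> bool).

(* The gaps grow, so that at any fixed time all but finitely many bubbles do not
   yet interact. *)
Definition anchor k : R := 4 * (k%:R + 1) ^+ 2.

(** The switch b lets the same family provide all bubbles, a single one, or the constant datum. *)
Definition bend k x : 'rV[R]_m :=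
  if b k then profile (eps k) (d k) (L k) (anchor k) e1 e2 e3 x - e1 else 0.

(* All terms with k >= |x| vanish at x. *)
Definition bubble_sum x : 'rV[R]_m := \sum_(k < Num.bound `|x|) bend k x.

Hypotheses (d0 : forall k, 0 < d k) (d1 : forall k, d k <= 1) (L0 : forall k, 0 < L k).
Hypotheses (Ld : forall k, L k < d k) (eps0 : forall k, 0 < eps k) (eps2 : forall k, eps k <= 1 / 2).
Variable C : R.
(** The amplitudes beat the fourth power of the position: one factor 1 + x^2 gives integrability of
    the sum, the other makes its tail small. *)
Hypothesis decay : forall k, eps k * (1 + (anchor k + 2) ^+ 2) ^+ 2 <= C.

Lemma bend_far k x : 2 <= `|x - anchor k| -> bend k x = 0.
Proof.
move=> h; rewrite /bend; case: (b k) => //; rewrite piece_out ?subrr//.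
by apply: le_trans h; move: (d1 k); lra.
Qed.

Lemma anchor_ge k (N : nat) : (N <= k)%N -> N%:R + 2 <= anchor k.
Proof.
move=> Nk; have h : (N%:R : R) <= k%:R by rewrite ler_nat.
have k0 : (0 : R) <= k%:R by []; rewrite /anchor.
by move: h k0; move: (k%:R : R) (N%:R : R) => p q; nra.
Qed.

Lemma bend_large k N x : `|x| <= N%:R -> (N <= k)%N -> bend k x = 0.
Proof.
move=> xN /anchor_ge h; apply: bend_far; rewrite distrC ler_normr; apply/orP; left.
by move: xN h; rewrite ler_norml => /andP[_ h1] h2; lra.
Qed.

(** The anchors next to the k-th are at distance 8 k + 4 and 8 k + 12, which leaves 2 beyond the
    radius 8 k + 2. *)
Lemma anchors_apart j k x : `|x - anchor k| <= 8 * k%:R + 2 -> j != k -> 2 <= `|x - anchor j|.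
Proof.
rewrite neq_ltn ler_norml => /andP[h1 h2] /orP[jk|kj].
  have e : (k%:R : R) = j%:R + 1 + (k - j.+1)%:R by rewrite natrB// mulrS; ring.
  rewrite ler_normr; apply/orP; left; move: h1; rewrite /anchor e.
  have : (0 : R) <= j%:R by []; have : (0 : R) <= (k - j.+1)%:R by [].
  by move: (j%:R : R) ((k - j.+1)%:R : R) => q p p0 q0; nra.
have e : (j%:R : R) = k%:R + 1 + (j - k.+1)%:R by rewrite natrB// mulrS; ring.
rewrite ler_normr; apply/orP; right; move: h2; rewrite /anchor e.
have : (0 : R) <= k%:R by []; have : (0 : R) <= (j - k.+1)%:R by [].
by move: (k%:R : R) ((j - k.+1)%:R : R) => q p p0 q0; nra.
Qed.

Lemma bubble_sumE (N : nat) x : `|x| <= N%:R -> bubble_sum x = \sum_(k < N) bend k x.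
Proof.
have S (M p : nat) : `|x| <= M%:R -> \sum_(k < M + p) bend k x = \sum_(k < M) bend k x.
  move=> xM; elim: p => [|p ih]; first by rewrite addn0.
  by rewrite addnS big_ord_recr /= ih (bend_large xM) ?addr0// leq_addr.
move=> xN; rewrite /bubble_sum -(S _ (Num.bound `|x|) xN) addnC S//.
by apply/ltW/archi_boundP.
Qed.

Lemma sum_bend_near k N x : `|x - anchor k| <= 8 * k%:R + 2 ->
  \sum_(j < N) bend j x = if (k < N)%N then bend k x else 0.
Proof.
move=> h; case: ifPn => [kN|kN].
  rewrite (bigD1 (Ordinal kN))//= big1 ?addr0// => j jk.
  by apply/bend_far/(anchors_apart h).
apply: big1 => j _; apply/bend_far/(anchors_apart h).
by apply: contraNneq kN => <-.
Qed.

Lemma bubble_sum_near k x : `|x - anchor k| <= 8 * k%:R + 2 -> bubble_sum x = bend k x.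
Proof.
move=> h; rewrite (@bubble_sumE (k + Num.bound `|x|).+1); last first.
  rewrite (le_trans (ltW (archi_boundP _)))// ler_nat; exact/leqW/leq_addl.
by rewrite (sum_bend_near _ h) ltnS leq_addr.
Qed.

Lemma bubble_sum_cases x : (exists2 k, `|x - anchor k| < 2 & bubble_sum x = bend k x) \/
  (forall k, bend k x = 0) /\ bubble_sum x = 0.
Proof.
have [[k hk]|no] := pselect (exists k, `|x - anchor k| < 2).
  left; exists k => //; apply: bubble_sum_near.
  by apply: (le_trans (ltW hk)); rewrite lerDr mulr_ge0.
have z k : bend k x = 0.
  by apply: bend_far; rewrite leNgt; apply/negP => h; apply: no; exists k.
by right; split => //; rewrite /bubble_sum big1.
Qed.

Lemma smooth_bend k : smoothv (bend k).
Proof.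
move=> j; rewrite /bend; case: (b k); last first.
  have -> : (fun x : R => (0 : 'rV[R]_m) ord0 j) = cst 0 by apply/funext => x; rewrite mxE.
  exact: smooth_cst.
have -> : (fun x => (profile (eps k) (d k) (L k) (anchor k) e1 e2 e3 x - e1) ord0 j) =
  (fun x => profile (eps k) (d k) (L k) (anchor k) e1 e2 e3 x ord0 j - cst (e1 ord0 j) x).
  by apply/funext => x; rewrite mxE [X in _ + X]mxE.
exact: (smoothB (@smooth_profile R m e1 e2 e3 _ _ _ _ j) (@smooth_cst R _)).
Qed.

Lemma smooth_bubble_sum : smoothv bubble_sum.
Proof.
move=> j; apply: smooth_local => a; exists (fun x => \sum_(k < Num.bound (`|a| + 1)) bend k x ord0 j).
  by apply: smooth_sum => k; exact: smooth_bend.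
have h : a \in `]a - 1, a + 1[ by rewrite in_itv /=; apply/andP; split; lra.
apply: filterS (near_in_itvoo h) => x; rewrite in_itv /= => /andP[h1 h2].
rewrite (@bubble_sumE (Num.bound (`|a| + 1))) ?summxE//.
apply: (le_trans _ (ltW (archi_boundP _))); last by rewrite addr_ge0.
rewrite -lerBlDl; apply: (le_trans (lerB_dist _ _)); rewrite ler_norml; apply/andP; split; lra.
Qed.

Lemma sqn_bubble_sum x : sqn (e1 + bubble_sum x) = 1.
Proof.
have [[? _ _] _] := fr.
have [[k _ ->]|[_ ->]] := bubble_sum_cases x; last by rewrite addr0.
rewrite /bend; case: (b k); last by rewrite addr0.
by rewrite addrC subrK (sqn_profile fr).
Qed.

Let C0 : 0 <= C.
Proof. by apply: le_trans (decay 0); rewrite mulr_ge0 ?(ltW (eps0 _))// exprn_ge0// addr_ge0// sqr_ge0. Qed.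

Lemma bend_decay k x j : `|bend k x ord0 j| * (1 + x ^+ 2) ^+ 2 <= 5 * C.
Proof.
have [h|h] := leP 2 `|x - anchor k|; first by rewrite bend_far// mxE normr0 mul0r mulr_ge0.
have q0 (z : R) : 0 <= 1 + z ^+ 2 by rewrite addr_ge0// sqr_ge0.
have b1 : `|bend k x ord0 j| <= 5 * eps k.
  rewrite /bend; case: (b k); last by rewrite mxE normr0 mulr_ge0// ltW.
  by rewrite mxE [X in _ + X]mxE; exact: (piece_le fr).
have b2 : (1 + x ^+ 2) ^+ 2 <= (1 + (anchor k + 2) ^+ 2) ^+ 2.
  rewrite lerXn2r ?nnegrE// lerD2l.
  have c0 := @anchor_ge k 0 (leq0n k).
  by move: h c0; rewrite mulr0n add0r ltr_norml => /andP[h1 h2]; move: (anchor k) h1 h2 => c h1 h2 c0; nra.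
apply: le_trans (ler_wpM2l (ler0n _ 5) (decay k)); rewrite [leRHS]mulrA.
exact: (ler_pM (normr_ge0 _) (exprn_ge0 2 (q0 x)) b1 b2).
Qed.

Lemma bubble_sum_decay x j : `|bubble_sum x ord0 j| * (1 + x ^+ 2) ^+ 2 <= 5 * C.
Proof.
have [[k _ ->]|[_ ->]] := bubble_sum_cases x; first exact: bend_decay.
by rewrite mxE normr0 mul0r mulr_ge0.
Qed.

Let sq1 (x : R) : 1 <= (1 + x ^+ 2) ^+ 2 /\ x ^+ 2 <= (1 + x ^+ 2) ^+ 2.
Proof. by have := sqr_ge0 x; move: (x ^+ 2) => q q0; split; nra. Qed.

Lemma intble_decay2 (h : R -> R) M : smooth h ->
  (forall x, `|h x| * (1 + x ^+ 2) ^+ 2 <= M) -> intble h.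
Proof.
move=> sh hM; have mh := continuous_measurable_fun (smooth_continuous sh).
apply: (@intble_decay _ h M mh) => x; apply: le_trans (hM x).
  by rewrite -[leLHS]mulr1 ler_wpM2l//; have [] := sq1 x.
by rewrite mulrC ler_wpM2l//; have [] := sq1 x.
Qed.

Lemma bubble_sum_le x j : `|bubble_sum x ord0 j| <= 5 * C.
Proof.
apply: le_trans (bubble_sum_decay x j).
by rewrite -[leLHS]mulr1 ler_wpM2l//; have [] := sq1 x.
Qed.

Lemma intble_bubble_sum j : intble (fun x => bubble_sum x ord0 j).
Proof. exact: (@intble_decay2 (fun x => bubble_sum x ord0 j) (5 * C) (@smooth_bubble_sum j) (fun x => bubble_sum_decay x j)). Qed.

Lemma intble_bend k j : intble (fun x => bend k x ord0 j).
Proof. exact: (@intble_decay2 (fun x => bend k x ord0 j) (5 * C) (@smooth_bend k j) (fun x => bend_decay k x j)). Qed.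

(** The decay confines each superlevel set to a bounded interval. *)
Lemma vanishes_bubble_sum : vanishes_at_infinity bubble_sum.
Proof.
move=> a a0; pose D := 5 * C.
have D0 : 0 <= D by rewrite mulr_ge0.
(* On the superlevel set x^2 is at most q = m D^2 / a, and then |x| <= 1 + q. *)
pose M := 1 + m%:R * D ^+ 2 / a.
have msq : measurable_fun setT (fun x => sqn (bubble_sum x)).
  by apply: measurable_sqn => j; exact: intble_measurable (intble_bubble_sum j).
have sub : [set x : R | (a <= sqn (bubble_sum x))%R] `<=` `[- M, M]%classic.
  move=> x /= hx; rewrite in_itv /= -ler_norml.
  have q : sqn (bubble_sum x) * (1 + x ^+ 2) <= m%:R * D ^+ 2.
    have [s1 _] := sq1 x.
    rewrite /sqn /dot mulr_suml (_ : m%:R * D ^+ 2 = \sum_(i < m) D ^+ 2); last first.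
      by rewrite sumr_const card_ord -[RHS]mulr_natl.
    apply: ler_sum => i _; have hd := bubble_sum_decay x i.
    rewrite -expr2 -[bubble_sum x ord0 i ^+ 2]ger0_norm ?sqr_ge0// normrX.
    have p0 : 0 <= x ^+ 2 := sqr_ge0 x.
    apply: (@le_trans _ _ ((`|bubble_sum x ord0 i| * (1 + x ^+ 2) ^+ 2) ^+ 2)); last first.
      by rewrite lerXn2r ?nnegrE// mulr_ge0// exprn_ge0// addr_ge0.
    rewrite exprMn ler_wpM2l ?sqr_ge0//.
    by move: (x ^+ 2) p0 => z z0; rewrite -exprM -[leLHS]expr1 ler_weXn2l//; lra.
  have p0 : 0 <= x ^+ 2 := sqr_ge0 x.
  have q2 : a * (1 + x ^+ 2) <= m%:R * D ^+ 2.
    by apply: le_trans q; rewrite ler_wpM2r// addr_ge0.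
  have q3 : x ^+ 2 <= m%:R * D ^+ 2 / a.
    by rewrite ler_pdivlMr//; move: q2; nra.
  rewrite /M; move: q3; rewrite -real_normK ?num_real//.
  have := normr_ge0 x; move: (`|x|) (m%:R * D ^+ 2 / a) => z w z0 h.
  by nra.
have M0 : - M <= M.
  have : 0 <= m%:R * D ^+ 2 / a by rewrite divr_ge0 ?(ltW a0)// mulr_ge0// sqr_ge0.
  by rewrite /M; lra.
apply: (@le_lt_trans _ _ (mu `[- M, M]%classic)).
  apply: le_measure => //; rewrite inE//.
  have -> : [set x : R | (a <= sqn (bubble_sum x))%R] = setT `&` (fun x => sqn (bubble_sum x)) @^-1` `[a, +oo[%classic.
    by apply/seteqP; split=> x /=; rewrite in_itv /= andbT => // -[].
  exact: msq.
by rewrite lebesgue_measure_itv/= lte_fin; case: ifP => _; rewrite -?EFinB ltry.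
Qed.

(** The first N bubbles give the whole sum on [-N, N]. Outside, one factor of the decay yields 1 /
    (1 + N^2) and the other stays integrable, so the L^1 norm of the remainder, hence its transform,
    is below e for N large. *)
Lemma bubble_sum_osc (e : R) : 0 < e -> exists N, forall j k xi,
  `|osc (fun x => bubble_sum x ord0 j) k xi| <= \sum_(n < N) `|osc (fun x => bend n x ord0 j) k xi| + e.
Proof.
move=> e0.
pose w (x : R) : R := (1 + x ^+ 2)^-1.
have q0 (x : R) : 0 < 1 + x ^+ 2 by rewrite ltr_pwDl// sqr_ge0.
have w0 x : 0 <= w x by rewrite invr_ge0 ltW.
have sw : smooth w.
  apply: smoothV; first by move=> x; rewrite gt_eqF.
  have h := smoothD (@smooth_cst R 1) (smoothM (@smooth_id R) (@smooth_id R)).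
  by have -> : (fun x : R => 1 + x ^+ 2) = (fun x => cst 1 x + id x * id x) by apply/funext => x; rewrite expr2.
have iw : intble w.
  apply: (@intble_decay _ w 1 (continuous_measurable_fun (smooth_continuous sw))) => x.
    by rewrite ger0_norm// invf_le1// lerDl sqr_ge0.
  by rewrite ger0_norm// ler_pdivrMr// mul1r lerDr.
pose I := \int[mu]_(x in setT) w x.
have I0 : 0 <= I by apply: Rintegral_ge0 => x _; exact: w0.
have N_ex := archi_boundP (_ : 0 <= 5 * C * I / e).
exists (Num.bound (5 * C * I / e)) => j k xi.
have hN : 5 * C * I / e < (Num.bound (5 * C * I / e))%:R.
  by apply: N_ex; rewrite divr_ge0 ?(ltW e0)// mulr_ge0// mulr_ge0.
move: (Num.bound _) hN => N hN {N_ex}.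
pose r x := bubble_sum x ord0 j - \sum_(n < N) bend n x ord0 j.
have iG : intble (fun x => \sum_(n < N) bend n x ord0 j).
  by apply: intble_sum => n; exact: intble_bend.
have ir : intble r := intbleB (intble_bubble_sum j) iG.
have -> : (fun x => bubble_sum x ord0 j) = (fun x => \sum_(n < N) bend n x ord0 j + r x).
  by apply/funext => x; rewrite /r addrC subrK.
rewrite oscD//; apply: (le_trans (ler_normD _ _)); apply: lerD.
  have -> : osc (fun x => \sum_(n < N) bend n x ord0 j) k xi = \sum_(n < N) osc (fun x => bend n x ord0 j) k xi.
    elim: N {hN r iG ir} => [|N ih].
      rewrite big_ord0 (_ : (fun x => _) = (fun x => 0 * w x)); last first.
        by apply/funext => x; rewrite big_ord0 mul0r.
      by rewrite oscZ// mul0r.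
    rewrite big_ord_recr /= -ih -oscD//; last exact: intble_bend.
      by congr (osc _ k xi); apply/funext => x; rewrite big_ord_recr.
    by apply: intble_sum => n; exact: intble_bend.
  exact: ler_norm_sum.
apply: (le_trans (osc_L1_le _ _ ir)).
have rle x : `|r x| <= 5 * C / (1 + N%:R ^+ 2) * w x.
  have C5 : 0 <= 5 * C by rewrite mulr_ge0.
  have rhs0 : 0 <= 5 * C / (1 + N%:R ^+ 2) * w x by rewrite mulr_ge0// divr_ge0// ltW.
  have [xN|Nx] := leP `|x| N%:R.
    by rewrite /r (bubble_sumE xN) summxE subrr normr0.
  (* At most one bubble lives at x, so the remainder there is either zero or the whole sum. *)
  have r2 : `|r x| <= `|bubble_sum x ord0 j|.
    rewrite /r; have [[n hn fn]|[z ->]] := bubble_sum_cases x; last first.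
      by rewrite mxE big1 ?subrr ?normr0// => i _; rewrite z mxE.
    rewrite -summxE (@sum_bend_near n) ?fn; last first.
      by apply: (le_trans (ltW hn)); rewrite lerDr mulr_ge0.
    by case: ifP => _; rewrite ?subrr ?normr0// !mxE subr0.
  apply: (le_trans r2); rewrite /w ler_pdivlMr// ler_pdivlMr//.
  apply: le_trans (bubble_sum_decay x j); rewrite -mulrA ler_wpM2l// expr2 ler_wpM2l ?(ltW (q0 _))//.
  by rewrite lerD2l -[leRHS]real_normK ?num_real// lerXn2r ?nnegrE// ltW.
apply: (le_trans (le_Rintegral measurableT (intble_norm ir) (intbleZ _ iw) (fun x _ => rle x))).
rewrite RintegralZl// -/I mulrAC ler_pdivrMr//.
move: hN; rewrite ltr_pdivrMr// => h; apply: (le_trans (ltW h)); rewrite mulrC ler_pM2l//.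
by have : (0 : R) <= N%:R by []; move: (N%:R : R) => z z0; nra.
Qed.

End Family.

(** * Choice of the parameters *)

Section Bubbles.
Context {R : realType}.

Lemma sum_nat_mono (F : nat -> R) N p : (forall n, 0 <= F n) ->
  \sum_(n < N) F n <= \sum_(n < N + p) F n.
Proof.
move=> F0; elim: p => [|p ih]; first by rewrite addn0.
by rewrite addnS big_ord_recr /= (le_trans ih)// lerDl.
Qed.

Lemma sum_double (F : nat -> R) N :
  \sum_(n < N + N) F n = \sum_(k < N) (F k.*2 + F k.*2.+1).
Proof.
elim: N => [|N ih]; first by rewrite !big_ord0.
by rewrite addnS addSn !big_ord_recr /= ih addnn addrA.
Qed.

(** K depends on m only; in particular the widths L k do not enter, which leaves them free. The two
    scales d k and 2 L k of bubble k are interleaved as even and odd indices. *)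
Lemma Bhalf_bubble_sum m : exists2 K : R, 0 < K &
  forall (e1 e2 e3 : 'rV[R]_m) (eps d L : nat -> R) (b : nat -> bool) (C E : R),
  orthonormal3 e1 e2 e3 -> (forall k, 0 < d k) -> (forall k, d k <= 1) ->
  (forall k, 0 < L k) -> (forall k, L k < d k) ->
  (forall k, 0 < eps k) -> (forall k, eps k <= 1 / 2) ->
  (forall k, eps k * (1 + (anchor k + 2) ^+ 2) ^+ 2 <= C) ->
  0 < E -> (forall N, \sum_(k < N) eps k <= E) ->
  (Bhalf_norm (bubble_sum e1 e2 e3 eps d L b) <= (K * E)%:E)%E.
Proof.
have [K1 K10 H1] := @osc_height R; have [K2 K20 H2] := @osc_spin R.
pose kp := 2 * (K1 + K2); have kp0 : 0 < kp by rewrite mulr_gt0// addr_gt0.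
exists (11 * m.+1%:R * (2 * kp)); first by do 2![apply: mulr_gt0 => //].
move=> e1 e2 e3 eps d L b C E fr d0 d1 L0 Ld eps0 eps2 decay E0 sE.
pose Cn n := kp * eps n./2.
pose l n := if odd n then 2 * L n./2 else d n./2.
have Cn0 n : 0 <= Cn n by rewrite mulr_ge0 ?(ltW kp0)// ltW.
have l0 n : 0 < l n by rewrite /l; case: ifP => _ //; rewrite mulr_gt0.
rewrite -[X in (X%:E)%E]mulrA -[X in (_ * X)]mulrA.
have osc_bend n j k xi : `|osc (fun x => bend e1 e2 e3 eps d L b n x ord0 j) k xi| <=
    kp * eps n * (d n / (1 + (d n * xi) ^+ 2)) + kp * eps n * (2 * L n / (1 + (2 * L n * xi) ^+ 2)).
  rewrite /bend; case: (b n).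
    have -> : (fun x => (profile (eps n) (d n) (L n) (anchor n) e1 e2 e3 x - e1) ord0 j) =
      (fun x => profile (eps n) (d n) (L n) (anchor n) e1 e2 e3 x ord0 j - e1 ord0 j).
      by apply/funext => x; rewrite mxE [X in _ + X]mxE.
    exact: (osc_piece fr (anchor n) (d0 n) (L0 n) (Ld n) (eps0 n) (eps2 n) j k xi K10 K20 H1 H2).
  have -> : (fun x : R => (0 : 'rV[R]_m) ord0 j) = (fun x => 0 * (\1_(`[0, 1]%classic : set R) x)).
    by apply/funext => x; rewrite mxE mul0r.
  rewrite oscZ ?mul0r ?normr0; last exact: intble_indic.
  have q (z : R) : 0 <= z -> 0 <= kp * eps n * (z / (1 + (z * xi) ^+ 2)).
    move=> z0; rewrite mulr_ge0//; first by rewrite mulr_ge0// ltW.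
    by rewrite divr_ge0// addr_ge0// sqr_ge0.
  by rewrite addr_ge0// q ?(ltW (d0 n))// mulr_ge0// ltW.
apply: (@Bhalf_upper R m _ (5 * C) (2 * (kp * E)) Cn l).
- exact: (intble_bubble_sum fr b d0 d1 L0 Ld eps0 eps2 decay).
- exact: (bubble_sum_le fr b d0 d1 L0 Ld eps0 eps2 decay).
- by rewrite mulr_gt0// mulr_gt0.
- exact: Cn0.
- exact: l0.
- move=> N; apply: (le_trans (sum_nat_mono N N Cn0)); rewrite sum_double.
  have -> : \sum_(k < N) (Cn k.*2 + Cn k.*2.+1) = 2 * (kp * \sum_(k < N) eps k).
    by rewrite !mulr_sumr; apply: eq_bigr => k _; rewrite /Cn /= uphalf_double doubleK; ring.
  by rewrite !ler_pM2l.
move=> e e0; have [N hN] := bubble_sum_osc fr b d0 d1 L0 Ld eps0 eps2 decay e0.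
exists (N + N)%N => j k xi; apply: (le_trans (hN j k xi)); rewrite lerD2r.
rewrite (sum_double (fun n => Cn n * (l n / (1 + (l n * xi) ^+ 2)))).
apply: ler_sum => n _; rewrite /Cn /l /= odd_double /= uphalf_double doubleK.
exact: osc_bend.
Qed.

(** Two linear conditions on m > 2 unknowns have a nonzero common solution, which is then
    normalized. *)
Lemma unit_orth m (u z : 'rV[R]_m) : (2 < m)%N ->
  exists e : 'rV[R]_m, [/\ dot e e = 1, dot u e = 0 & dot z e = 0].
Proof.
move=> m2; pose A : 'M[R]_(m, 1 + 1) := row_mx (trmx u) (trmx z).
have : kermx A != 0.
  rewrite -mxrank_eq0 mxrank_ker subn_eq0 -ltnNge.
  exact: leq_ltn_trans (rank_leq_col A) m2.
move=> /rowV0Pn[v /sub_kermxP]; rewrite mul_mx_row -row_mx0 => /eq_row_mx[hu hw] v0.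
have dotE (y : 'rV[R]_m) : v *m trmx y = 0 -> dot y v = 0.
  move=> /(congr1 (fun M : 'M[R]_(1, 1) => M ord0 ord0)); rewrite !mxE => h; rewrite -[RHS]h.
  by apply: eq_bigr => i _; rewrite mxE mulrC.
have s0 : 0 < sqn v.
  rewrite lt_neqAle dot_ge0 andbT eq_sym; apply: contra v0 => /eqP s0.
  apply/eqP/rowP => i; rewrite mxE; apply/eqP; rewrite -sqrf_eq0.
  by rewrite eq_le sqr_ge0 andbT -s0 sqr_le_sqn.
exists ((Num.sqrt (sqn v))^-1 *: v); rewrite !dotZr !dotZl (dotE u hu) (dotE z hw) !mulr0.
split=> //; rewrite mulrA -invfM -expr2 sqr_sqrtr ?ltW// mulVf// gt_eqF//.
Qed.

Lemma complete_orthonormal m (e1 : 'rV[R]_m) : (2 < m)%N -> sqn e1 = 1 ->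
  exists e2 e3, orthonormal3 e1 e2 e3.
Proof.
move=> m2 h1; have [e2 [h2 h12 _]] := unit_orth e1 e1 m2.
have [e3 [h3 h13 h23]] := unit_orth e1 e2 m2.
by exists e2, e3.
Qed.

Lemma sum_half N : \sum_(k < N) (2 ^- k : R) <= 2.
Proof.
have -> : \sum_(k < N) (2 ^- k : R) = 2 - 2 * 2 ^- N.
  elim: N => [|N ih]; first by rewrite big_ord0 expr0 invr1; lra.
  by rewrite big_ord_recr /= ih exprS invfM; field; rewrite expf_neq0.
by rewrite gerBl mulr_ge0// invr_ge0 exprn_ge0.
Qed.

(** The amplitudes, lengths and widths are fixed before b, so every choice of bubbles obeys the same
    bounds. The last clause asks that bubble k be narrow against |t| and T - |t|, and that its
    neighbours be too far to interfere by time |t|. *)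
Lemma bubbles m (e1 : 'rV[R]_m) (delta : R) : (2 < m)%N -> sqn e1 = 1 -> 0 < delta ->
  exists F : (nat -> bool) -> R -> 'rV[R]_m, forall b,
  [/\ [/\ smoothv (F b), forall x, sqn (F b x) = 1,
         vanishes_at_infinity (fun x => F b x - e1) &
         (Bhalf_norm (fun x => F b x - e1)%R < delta%:E)%E],
      forall N, (forall k, (N <= k)%N -> ~~ b k) -> exists M, forall x, M <= `|x| -> F b x = e1,
      (forall k, ~~ b k) -> forall x, F b x = e1 &
      forall k T (phi : R -> R -> 'rV[R]_m) t, b k -> wave_map T (F b) phi -> t != 0 -> `|t| < T ->
        3 / (k%:R + 2) <= 2 * `|t| -> 3 / (k%:R + 2) + 2 * `|t| < 2 * T -> `|t| <= 4 * k%:R ->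
        ((k%:R + 1)%:E <= Hhalf_norm (fun x => phi t x - e1)%R)%E].
Proof.
move=> m2 h1 delta0; have [e2 [e3 fr]] := complete_orthonormal m2 h1.
have [K K0 HB] := Bhalf_bubble_sum m.
have m0 : 0 < m%:R :> R by rewrite ltr0n (ltn_trans _ m2).
pose q := 128 * 10 ^+ 4 * cansatz m : R.
(* The three summands give ep <= 1 / 10, q ep <= 1 and 4 K ep <= delta for ep = 1 / D. *)
pose D := 10 + `|q| + 4 * K / delta.
have Kd : 0 < 4 * K / delta by rewrite divr_gt0// mulr_gt0.
have D0 : 0 < D by rewrite /D; have := normr_ge0 q; lra.
pose ep := D^-1; have ep0 : 0 < ep by rewrite invr_gt0.
have Dep : D * ep = 1 by rewrite mulfV// gt_eqF.
have ep1 : ep <= 1 / 10 by move: Dep Kd (normr_ge0 q); rewrite /D; nra.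
have ep2 : q * ep <= 1 by move: Dep Kd (ler_norm q) ep0; rewrite /D; nra.
have ep3 : K * (2 * ep) < delta.
  have h : 4 * K / delta * ep <= 1 by move: Dep (normr_ge0 q); rewrite /D; nra.
  have : 4 * K * ep <= delta.
    by move: h; rewrite mulrAC ler_pdivrMr// mul1r.
  by move: (mulr_gt0 K0 ep0); nra.
pose w k : R := (1 + (anchor k + 2) ^+ 2) ^+ 2.
have w1 k : 1 <= w k by rewrite exprn_ege1// lerDl sqr_ge0.
have t0 k : 0 < 2 ^- k :> R by rewrite invr_gt0 exprn_gt0.
have t1 k : 2 ^- k <= 1 :> R by rewrite invf_le1 ?exprn_gt0// exprn_ege1// ler1n.
(* The factor 2^-k makes the amplitudes summable, with sum at most 2 ep; the weight provides the
   spatial decay. *)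
pose eps k := ep * 2 ^- k / w k.
have w0 k : 0 < w k by apply: lt_le_trans (w1 k).
have eps0 k : 0 < eps k by rewrite divr_gt0// mulr_gt0.
have epsle k : eps k <= ep * 2 ^- k.
  by rewrite ler_pdivrMr// ler_peMr// mulr_ge0// ltW.
have epsep k : eps k <= ep.
  by apply: (le_trans (epsle k)); rewrite ler_piMr// ltW.
have eps2 k : eps k <= 1 / 2 by have := epsep k; lra.
have decay k : eps k * w k <= ep.
  by rewrite divfK ?gt_eqF// ler_piMr// ltW.
have sumeps N : \sum_(k < N) eps k <= 2 * ep.
  apply: (@le_trans _ _ (\sum_(k < N) ep * 2 ^- k)); first by apply: ler_sum => k _.
  by rewrite -mulr_sumr mulrC ler_pM2r// sum_half.
(* Tends to 0, so at each fixed nonzero time all but finitely many bubbles have released their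
   jump. *)
pose d k : R := (k%:R + 2)^-1.
have k20 k : 0 < k%:R + 2 :> R by rewrite ltr_wpDl.
have d0 k : 0 < d k by rewrite invr_gt0.
have d2 k : d k <= 1 / 2.
  by rewrite /d div1r lef_pV2 ?posrE// lerDr.
have d1 k : d k <= 1 by have := d2 k; lra.
(* With eps k and d k fixed, the jump eps^3 / (128 m) and the plateau length are known, and L k is
   taken small enough for the norm to reach k + 1. *)
have /choice[L hL] k : exists L : R, [/\ 0 < L, L < d k &
    forall (f : R -> 'rV[R]_m) i y P Q, (forall x, `|f x ord0 i| <= 2) ->
      edge (fun x => f x ord0 i) y L (d k) P Q -> eps k ^+ 3 / (128 * m%:R) <= `|Q - P| ->
      ((k%:R + 1)%:E <= Hhalf_norm f)%E].
  have h0 : 0 < eps k ^+ 3 / (128 * m%:R) by rewrite divr_gt0 ?exprn_gt0// mulr_gt0.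
  have N0 : 0 < k%:R + 1 :> R by rewrite ltr_wpDl.
  have [L0 L00 hL0] := Hhalf_edge h0 (d0 k) N0.
  have L1 : 0 < Num.min L0 (d k / 2) by rewrite lt_min L00 divr_gt0.
  exists (Num.min L0 (d k / 2)); split => //.
    by rewrite gt_min; apply/orP; right; have := d0 k; lra.
  move=> f i y P Q f2 he hPQ; apply: (hL0 m f i y _ P Q _ f2 he hPQ).
  by rewrite L1 ge_min lexx.
have L0 k : 0 < L k by have [] := hL k.
have Ld k : L k < d k by have [] := hL k.
exists (fun b x => e1 + bubble_sum e1 e2 e3 eps d L b x) => b.
have eF : (fun x => e1 + bubble_sum e1 e2 e3 eps d L b x - e1) = bubble_sum e1 e2 e3 eps d L b.
  by apply/funext => x; rewrite addrC addKr.
have sF : smoothv (fun x => e1 + bubble_sum e1 e2 e3 eps d L b x).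
  move=> j; have -> : (fun x => (e1 + bubble_sum e1 e2 e3 eps d L b x) ord0 j) =
    (fun x => cst (e1 ord0 j) x + bubble_sum e1 e2 e3 eps d L b x ord0 j).
    by apply/funext => x; rewrite mxE.
  exact: (smoothD (@smooth_cst R _) (@smooth_bubble_sum R m e1 e2 e3 eps d L b d0 d1 j)).
split.
- split.
  + exact: sF.
  + move=> x; exact: (sqn_bubble_sum fr).
  + rewrite eF; exact: (vanishes_bubble_sum fr b d0 d1 L0 Ld eps0 eps2 decay).
  + rewrite eF; apply: le_lt_trans (_ : ((K * (2 * ep))%:E < _)%E); last by rewrite lte_fin.
    apply: (HB e1 e2 e3 eps d L b ep (2 * ep)) => //; exact: mulr_gt0.
- move=> N bN; exists (anchor N + 2) => x hx.
  rewrite /bubble_sum big1 ?addr0// => k _.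
  have [kN|Nk] := ltnP k N; last by rewrite /bend (negbTE (bN _ Nk)).
  have e : (N%:R : R) = k%:R + 1 + (N - k.+1)%:R by rewrite natrB// mulrS; ring.
  have cc : anchor k <= anchor N :> R.
    rewrite /anchor e; have : (0 : R) <= k%:R by []; have : (0 : R) <= (N - k.+1)%:R by [].
    by move: (k%:R : R) ((N - k.+1)%:R : R) => p r p0 r0; nra.
  have c0 := @anchor_ge R k 0 (leq0n _); rewrite mulr0n add0r in c0.
  apply: bend_far => //; move: hx; rewrite !ler_normr => /orP[h|h]; apply/orP; [left|right]; lra.
- by move=> b0 x; rewrite /bubble_sum big1 ?addr0// => k _; rewrite /bend (negbTE (b0 k)).
move=> k T phi t bk wm tn0 tT c1 c2 c3.
(* Since d k <= 1 / 2 and |t| <= 4 k, the domain of dependence stays within 8 k + 2 of the anchor,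
   where only bubble k is present. *)
have fp x : anchor k - 3 * d k < x < anchor k + 2 * d k + 2 * `|t| ->
    e1 + bubble_sum e1 e2 e3 eps d L b x = profile (eps k) (d k) (L k) (anchor k) e1 e2 e3 x.
  move=> /andP[x1 x2]; rewrite (@bubble_sum_near _ _ _ _ _ _ _ _ _ d0 d1 k); last first.
    have k0 : 0 <= k%:R :> R by [].
    have := d2 k; rewrite ler_norml => dk; apply/andP; split; lra.
  by rewrite /bend bk addrC subrK.
have small : 128 * 10 ^+ 4 * cansatz m * eps k <= 1.
  rewrite -/q; have [q0|q0] := leP 0 q.
    by apply: le_trans ep2; rewrite ler_wpM2l.
  by apply: (@le_trans _ _ 0) => //; rewrite nmulr_rle0// ltW.
have [i [P [Q [he hPQ]]]] := local_jump fr (d0 k) (L0 k) (Ld k) (eps0 k) (le_trans (epsep k) ep1)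
  sF wm tn0 tT c1 c2 fp small.
have [_ _ hH] := hL k; apply: (hH _ i _ P Q _ he hPQ) => x.
have [_ sph _ _ _] := wm.
have a1 := frame_le1 i (sph t x tT); have a2 := frame_le1 i h1.
rewrite mxE [X in _ + X]mxE; apply: (le_trans (ler_normB _ _)).
exact: (lerD a1 a2).
Qed.

End Bubbles.

(** * Failure of continuous dependence and of continuation *)

Section IllPosed.
Context {R : realType}.

Lemma wave_map_cst m (T : R) (f : R -> 'rV[R]_m) (e : 'rV[R]_m) : sqn e = 1 ->
  (forall x, f x = e) -> wave_map T f (fun _ _ => e).
Proof.
move=> e1 fe.
have z (c : R) : derive1 (fun _ : R => c) = (fun=> 0).
  by apply/funext => x; rewrite derive1E derive_cst.
have tz (c : R) : dt (fun _ _ => c) = (fun _ _ => 0 : R).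
  by apply/funext => t; apply/funext => x; rewrite /dt z.
have xz (c : R) : dx (fun _ _ => c) = (fun _ _ => 0 : R).
  by apply/funext => t; apply/funext => x; rewrite /dx z.
have C1 (c : R) : C1_strip T (fun _ _ => c).
  move=> t x _; rewrite tz xz; split; [exact: derivable_cst|exact: derivable_cst|exact: cvg_cst|exact: cvg_cst].
have tv : dtv (fun _ _ => e) = (fun _ _ => 0).
  by apply/funext => t; apply/funext => x; apply/rowP => i; rewrite !mxE tz.
have xv : dxv (fun _ _ => e) = (fun _ _ => 0).
  by apply/funext => t; apply/funext => x; apply/rowP => i; rewrite !mxE xz.
have tv0 : dtv (fun _ _ => 0 : 'rV[R]_m) = (fun _ _ => 0).
  apply/funext => t; apply/funext => x; apply/rowP => i; rewrite !mxE.
  by have -> : coordf (fun _ _ => 0 : 'rV[R]_m) i = (fun _ _ => (0 : 'rV[R]_m) ord0 i) by []; rewrite tz.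
have xv0 : dxv (fun _ _ => 0 : 'rV[R]_m) = (fun _ _ => 0).
  apply/funext => t; apply/funext => x; apply/rowP => i; rewrite !mxE.
  by have -> : coordf (fun _ _ => 0 : 'rV[R]_m) i = (fun _ _ => (0 : 'rV[R]_m) ord0 i) by []; rewrite xz.
split.
- move=> i; have -> : coordf (fun _ _ => e) i = (fun _ _ => e ord0 i) by [].
  by split; rewrite ?tz ?xz; exact: C1.
- by move=> t x _.
- by move=> t x _; rewrite tv xv tv0 xv0 subrr scale0r oppr0 !addr0.
- by move=> x; rewrite fe.
- by move=> x; rewrite tv.
Qed.

Lemma Hhalf_lt m (g : R -> 'rV[R]_m) (a : R) :
  (Bhalf_norm g < (a / 2)%:E)%E -> (Hhalf_norm g < a%:E)%E.
Proof.
move=> h; have := le_lt_trans (Hhalf_le_Bhalf g) h.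
case: (Hhalf_norm g) => [r||] /=; last by rewrite ltNyr.
  by rewrite -EFinM !lte_fin; lra.
by rewrite gt0_muley ?lte_fin// ltye_eq.
Qed.

(* The map is not even continuous at the constant datum: a single bubble is a
   compactly supported perturbation, arbitrarily small at time 0 and of size
   at least 2 at time T/2. *)
Lemma ill_posed m (N : (R -> 'rV[R]_m) -> \bar R) (e1 : 'rV[R]_m) :
  (2 < m)%N -> sqn e1 = 1 ->
  (forall g a, 0 < a -> (Bhalf_norm g < (a / 2)%:E)%E -> (N g < a%:E)%E) ->
  (forall g, (N g < 1%:E)%E -> (Hhalf_norm g < 2%:E)%E) ->
  ~ well_posed_small N e1.
Proof.
move=> m2 h1 NB HN [delta [T [S [[delta0 T0] _ Sw Sc]]]].
have data eta : 0 < eta -> exists F : (nat -> bool) -> R -> 'rV[R]_m, forall b,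
  [/\ small_data N e1 delta (F b) /\ (N (fun x => F b x - e1)%R < eta%:E)%E,
      forall n, (forall k, (n <= k)%N -> ~~ b k) -> test_data e1 (F b),
      (forall k, ~~ b k) -> forall x, F b x = e1 &
      forall k T (phi : R -> R -> 'rV[R]_m) t, b k -> wave_map T (F b) phi -> t != 0 -> `|t| < T ->
        3 / (k%:R + 2) <= 2 * `|t| -> 3 / (k%:R + 2) + 2 * `|t| < 2 * T -> `|t| <= 4 * k%:R ->
        ((k%:R + 1)%:E <= Hhalf_norm (fun x => phi t x - e1)%R)%E].
  move=> eta0; have del0 : 0 < Num.min delta eta / 2 by rewrite divr_gt0// lt_min delta0.
  have [F hF] := bubbles m2 h1 del0; exists F => b.
  have [[sF F1 Fv FB] Ft F0 Fw] := hF b.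
  have FN a : Num.min delta eta <= a -> (N (fun x => F b x - e1)%R < a%:E)%E.
    move=> ha; apply: lt_le_trans (NB _ _ _ FB) _; last by rewrite lee_fin.
    by rewrite lt_min delta0.
  have FNd : (N (fun x => F b x - e1)%R < delta%:E)%E by apply: FN; rewrite ge_min lexx.
  split => //; last by move=> n /Ft h; split.
  split; last by apply: FN; rewrite ge_min lexx orbT.
  by split => //; split => //; apply: lt_trans FNd _; rewrite ltry.
(* With no bubble switched on the datum is the constant e1, and uniqueness for test data forces S to
   be constant there. *)
have [F0 hF0] := data 1 ltr01.
have [[sd0 _] td0 c0 _] := hF0 xpred0.
have {}c0 : forall x, F0 xpred0 x = e1 by exact: c0.
have {}td0 : test_data e1 (F0 xpred0) by exact: (td0 0%N).
have [_ Su] := Sw _ sd0 td0.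
have S0 t x : `|t| < T -> S (F0 xpred0) t x = e1.
  by move=> tT; rewrite -(Su _ (wave_map_cst T h1 c0) t x tT).
have [eta eta0 heta] := Sc _ sd0 1 ltr01.
have [F hF] := data eta eta0.
(* K > T + 3 / T makes bubble K narrow and isolated enough at time T / 2. Its norm there is at least
   K + 1 >= 2, while continuity would keep it below 2. *)
pose K := (Num.bound (T + 3 / T)).+1.
have T3 : 0 < 3 / T by rewrite divr_gt0.
have hK : T + 3 / T < K%:R.
  apply: lt_trans (archi_boundP _) _; first by rewrite addr_ge0// ltW.
  by rewrite ltr_nat.
have [[sd sn] td _ Fw] := hF (pred1 K).
have {}td : test_data e1 (F (pred1 K)).
  by apply: (td K.+1) => k Kk /=; rewrite gtn_eqF.
have [wm _] := Sw _ sd td.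
have t0 : 0 < T / 2 by rewrite divr_gt0.
have tE : `|T / 2| = T / 2 by rewrite ger0_norm// ltW.
have tT : `|T / 2| < T by rewrite tE; lra.
have k2 : 3 / (K%:R + 2) < T.
  have K2 : 0 < K%:R + 2 :> R by rewrite ltr_wpDl.
  rewrite ltr_pdivrMr//; have : 3 / T < K%:R by lra.
  by rewrite ltr_pdivrMr//; nra.
have low := Fw K T (S (F (pred1 K))) (T / 2) (eqxx K) wm.
have {}low : ((K%:R + 1)%:E <= Hhalf_norm (fun x => S (F (pred1 K)) (T / 2) x - e1)%R)%E.
  by apply: low; rewrite ?tE ?gt_eqF//; lra.
have close : (N (fun x => F (pred1 K) x - F0 xpred0 x)%R < eta%:E)%E.
  by rewrite (_ : (fun x => _) = (fun x => F (pred1 K) x - e1))//; apply/funext => x; rewrite c0.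
have up := HN _ (heta _ sd close (T / 2) tT).
move: up; rewrite (_ : (fun x => _) = (fun x => S (F (pred1 K)) (T / 2) x - e1)); last first.
  by apply/funext => x; rewrite S0.
move=> /(le_lt_trans low); rewrite lte_fin.
have : (1 : R) <= K%:R by rewrite ler1n.
lra.
Qed.

End IllPosed.

Theorem corollary1p4 (R : realType) (m : nat) (hm : (2 < m)%N)
    (e1 : 'rV[R]_m) (he1 : sqn e1 = 1) :
  [/\ ~ well_posed_small (@Hhalf_norm R m) e1,
      ~ well_posed_small (@Bhalf_norm R m) e1 &
      forall eps : R, 0 < eps ->
      exists f : R -> 'rV[R]_m,
      [/\ smoothv f,
          small_data (@Bhalf_norm R m) e1 eps f,
          small_data (@Hhalf_norm R m) e1 eps f &
          forall (T : R) (phi : R -> R -> 'rV[R]_m),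
            0 < T -> wave_map T f phi ->
            forall t : R, t != 0 -> `|t| < T ->
              Bhalf_norm (fun x => phi t x - e1)%R = +oo%E /\
              Hhalf_norm (fun x => phi t x - e1)%R = +oo%E]].
Proof.
split.
(* The factors 1 / 2 and 2 left open in [ill_posed] absorb the constant of [Hhalf_le_Bhalf], for
   either norm. *)
- apply: ill_posed => // [g a _|g] h; first exact: Hhalf_lt.
  by apply: lt_trans h _; rewrite lte_fin; lra.
- apply: ill_posed => // [g a a0|g] h.
    by apply: lt_trans h _; rewrite lte_fin; lra.
  apply: Hhalf_lt; rewrite divff//.
move=> eps eps0; have e20 : 0 < eps / 2 by rewrite divr_gt0.
(* All bubbles are present, so that at each time arbitrarily large indices can be used. *)
have [F /(_ predT)[[sF F1 Fv FB] _ _ Fw]] := bubbles hm he1 e20.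
have FB' : (Bhalf_norm (fun x => F predT x - e1)%R < eps%:E)%E.
  by apply: lt_trans FB _; rewrite lte_fin; lra.
have FH := Hhalf_lt FB.
exists (F predT); split => //.
- by split => //; split => //; apply: lt_trans FB' _; rewrite ltry.
- by split => //; split => //; apply: lt_trans FH _; rewrite ltry.
move=> T phi T0 wm t t0 tT.
have nt0 : 0 < `|t| by rewrite normr_gt0.
suff H : Hhalf_norm (fun x => phi t x - e1)%R = +oo%E.
  split=> //; have := Hhalf_le_Bhalf (fun x => phi t x - e1).
  by rewrite H gt0_muley ?lte_fin// leye_eq => /eqP.
apply/eqyP => A A0.
have g0 : 0 < T - `|t| by rewrite subr_gt0.
(* An index k above s makes bubble k narrow against |t| and T - |t|; above |t| it is isolated, and
   above A its norm exceeds A. *)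
pose s := 3 / `|t| + 3 / (T - `|t|).
have s1 : 0 < 3 / `|t| by rewrite divr_gt0.
have s2 : 0 < 3 / (T - `|t|) by rewrite divr_gt0.
have := archi_boundP (_ : 0 <= A + `|t| + s).
move: (Num.bound _) => k /(_ _) hk.
have {}hk : A + `|t| + s < k%:R by apply: hk; rewrite !addr_ge0// ltW.
have k2 : 0 < k%:R + 2 :> R by rewrite ltr_wpDl.
have d1 : 3 / (k%:R + 2) <= `|t|.
  rewrite ler_pdivrMr//; have : 3 / `|t| <= k%:R by move: hk; rewrite /s; lra.
  by rewrite ler_pdivrMr//; nra.
have d2 : 3 / (k%:R + 2) <= T - `|t|.
  rewrite ler_pdivrMr//; have : 3 / (T - `|t|) <= k%:R by move: hk; rewrite /s; lra.
  by rewrite ler_pdivrMr//; nra.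
apply: le_trans (Fw k T phi t _ wm t0 tT _ _ _) => //.
- by rewrite lee_fin; move: hk; rewrite /s; lra.
- by lra.
- by lra.
- by move: hk; rewrite /s; lra.
Qed.
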